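(* Let $X$ be a killed diffusion on $(0,r)$ with $r<\infty$, as described in the context, where both endpoints $0$ and $r$ are regular. If both boundaries are reflecting ($p_0=p_r=1$) and $\kappa=0$ almost everywhere, then $\underline{\lambda}^{(r)}=0$; otherwise $\underline{\lambda}^{(r)}>0$. Moreover, writing $\phi=\phi_{\underline{\lambda}^{(r)}}$, for any Borel subset $A\subset(0,r)$ and any starting distribution $\mu$, $$\lim_{t\to\infty}e^{\underline{\lambda}^{(r)}t}\,\mathbb{P}_\mu\{X_t\in A\}=\frac{\int e^{-B(x)}\phi(x)\,d\mu(x)\cdot\int_A\phi(y)\,dy}{\int_0^re^{-B(y)}\phi(y)^2\,dy}.$$
   Context: $X=(X_t)$ is a one-dimensional diffusion on $(0,r)$, $r<\infty$, with diffusion coefficient identically $1$, drift $b\in C^1((0,r))$ extending continuously to both endpoints, and continuous killing rate $\kappa\ge0$; killed paths go to a cemetery state. $\mathbb{P}_\mu$ is the law started from $\mu$. Both endpoints are regular and not sticky (speed measure puts no mass on them). The behaviour at $0$ and $r$ is governed by parameters $p_0,p_r\in[0,1]$ ($p=1$ meaning instantaneous reflection, $p=0$ instantaneous killing at that endpoint), expressed for the adjoint generator by the boundary conditions $(1-p_0)\phi(0)=p_0(\tfrac12\phi'(0)-b(0)\phi(0))$ and $(1-p_r)\lim_{x\to r}e^{-B(x)}\phi(x)=-p_r\lim_{x\to r}(\tfrac12\phi'(x)-b(x)\phi(x))$. Here $B(x)=2\int_0^xb(z)\,dz$. The adjoint generator acts as $\mathcal{L}^*\phi=\tfrac12\phi''-(b\phi)'-\kappa\phi$.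 For $\lambda\in\mathbb{R}$, $\phi_\lambda$ is the solution of $\mathcal{L}^*\phi_\lambda=-\lambda\phi_\lambda$ with $\phi_\lambda(0)=p_0$ and $\tfrac12\phi_\lambda'(0)-b(0)\phi_\lambda(0)=1-p_0$. Define $\underline{\lambda}^{(r)}=\inf\{\lambda:\phi_\lambda\text{ satisfies the boundary condition at }r\}$. *)

(* Defs.v *)
From HB Require Import structures.
From mathcomp Require Import all_boot all_order all_algebra.
From mathcomp Require Import all_classical all_reals all_analysis.
From mathcomp Require Import measurable_realfun lebesgue_integral.
Set Implicit Arguments.
Unset Strict Implicit.
Unset Printing Implicit Defensive.
Import Order.TTheory GRing.Theory Num.Theory.
Import numFieldNormedType.Exports.
Local Open Scope ring_scope.
Local Open Scope classical_set_scope.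

Definition Bfun {R : realType} (b : R -> R) (x : R) : R :=
  2 * Rintegral lebesgue_measure `[0, x] b.

(* Generator of the (non-adjoint) process:  L f = 1/2 f'' + b f' - kappa f.
   gen_domain r b kappa p0 pr f g : f lies in the domain of the Feller
   generator of the killed diffusion and g is (the continuous extension to
   [0,r] of) L f.  The boundary conditions are the ones dual (via
   integration by parts) to the adjoint boundary conditions of the paper:
     at 0 :  (1 - p0) f(0) = p0 * f'(0)/2
     at r :  pr * f'(r)/2 = - (1 - pr) e^{-B(r)} f(r). *)
Definition gen_domain {R : realType} (r : R) (b kappa : R -> R) (p0 pr : R)
  (f g : R -> R) : Prop :=
  [/\ {within `[0, r], continuous f},
      (forall x, 0 < x < r -> derivable f x 1 /\ derivable (f^`())%classic x 1),
      {within `[0, r], continuous g},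
      (forall x, 0 < x < r ->
         g x = (f^`(2))%classic x / 2 + b x * (f^`())%classic x - kappa x * f x) &
      exists d0 dr : R,
        [/\ (f^`())%classic x @[x --> 0^'+] --> d0,
            (f^`())%classic x @[x --> r^'-] --> dr,
            (1 - p0) * f 0 = p0 * (d0 / 2) &
            pr * (dr / 2) = - ((1 - pr) * expR (- Bfun b r) * f r)]].

(* P t x A = P_x { X_t \in A } (killed paths are sent to the cemetery, so
   P t x is a sub-probability measure on the state space (0,r)).
   killed_diffusion: P is the transition function of the killed diffusion
   with generator L (Feller description: a measurable sub-Markov transition
   function satisfying Dynkin's formula on the generator domain). *)
Definition killed_diffusion {R : realType} (r : R) (b kappa : R -> R)
  (p0 pr : R) (P : R -> R -> {measure set (measurableTypeR R) -> \bar R})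
  : Prop :=
  [/\ (forall t x, 0 <= t -> 0 < x < r ->
         (P t x setT <= 1)%E /\ P t x (~` `]0, r[) = 0%E),
      (forall t A, 0 <= t -> measurable A ->
         measurable_fun (`]0, r[ : set R) (fun x => P t x A)) /\
      (forall x A, 0 < x < r -> measurable A ->
         measurable_fun (`[0, +oo[ : set R) (fun t => P t x A)),
      (forall x A, 0 < x < r -> measurable A -> P 0 x A = (\1_A x)%:E),
      (forall s t x A, 0 <= s -> 0 <= t -> 0 < x < r -> measurable A ->
         (P (s + t)%R x A = \int[P s x]_(y in `]0%R, r[) P t y A)%E) &
      (forall f g, gen_domain r b kappa p0 pr f g ->
       forall t x, 0 <= t -> 0 < x < r ->
         (\int[P t x]_(y in `]0%R, r[) (f y)%:E - (f x)%:E =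
          \int[lebesgue_measure]_(s in `[0%R, t])
              \int[P s x]_(y in `]0%R, r[) (g y)%:E)%E)].

Definition flux {R : realType} (b phi : R -> R) (x : R) : R :=
  (phi^`())%classic x / 2 - b x * phi x.

Definition adj_eigen {R : realType} (r : R) (b kappa : R -> R) (p0 lam : R)
  (phi : R -> R) : Prop :=
  [/\ (forall x, 0 < x < r ->
         [/\ derivable phi x 1, derivable (phi^`())%classic x 1 &
             derivable (fun y => b y * phi y) x 1]),
      (forall x, 0 < x < r ->
         (phi^`(2))%classic x / 2 - ((fun y => b y * phi y)^`())%classic x - kappa x * phi x
         = - lam * phi x),
      phi x @[x --> 0^'+] --> p0 &
      flux b phi x @[x --> 0^'+] --> 1 - p0].

Definition adj_bc_r {R : realType} (r : R) (b : R -> R) (pr : R)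
  (phi : R -> R) : Prop :=
  exists L1 L2 : R,
    [/\ expR (- Bfun b x) * phi x @[x --> r^'-] --> L1,
        flux b phi x @[x --> r^'-] --> L2 &
        (1 - pr) * L1 = - (pr * L2)].

Definition lambda_under {R : realType} (r : R) (b kappa : R -> R)
  (p0 pr : R) : R :=
  inf [set lam | exists phi, adj_eigen r b kappa p0 lam phi /\ adj_bc_r r b pr phi].

(* Main.v *)
(* Write p = e^B and v = u'/2.  The generator L u = u''/2 + b u' - kappa u is
   symmetric for <f, g> = int p f g, and - <L u, u> >= 2 <v, v>.  Let lam0 be
   the infimum of the Rayleigh quotient - <L u, u> / <u, u> over the domain.  If
   the solution h at lam0 of the initial value problem at 0 failed the boundary
   condition at r, then - L - lam0 would have a bounded inverse and the quotient
   would stay away from lam0; so h is an eigenfunction.  On the complement of h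
   every equation (- L - lam0) y = u is solvable with a bound, which gives a
   spectral gap without compactness.  Solutions phi of the adjoint equation are
   p h, so lam0 is the infimum of the statement, and - <L u, u> >= 2 <v, v>
   decides when it vanishes.

   The energy decays along the implicit Euler scheme, so by a Sobolev
   inequality the scheme, scaled by e^(lam0 t), converges uniformly to
   (<f, h> / <h, h>) h at rate |f| / sqrt t.  Telescoping with Dynkin's formula
   (Chernoff) carries this rate over to E_x [f (X_t)] for f in the domain.  As
   only the L^2 norm of f enters, density of the domain in
   L^2 (P_x {X_t in .} + Lebesgue) gives the same rate for indicators of Borel
   sets, uniformly in x, and one integrates over the starting distribution. *)

Require Import Defs.
From HB Require Import structures.
From mathcomp Require Import all_boot all_order all_algebra.
From mathcomp Require Import all_classical all_reals all_analysis.
From mathcomp Require Import measurable_realfun lebesgue_integral.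
From mathcomp Require Import ring lra.
Set Implicit Arguments.
Unset Strict Implicit.
Unset Printing Implicit Defensive.
Import Order.TTheory GRing.Theory Num.Theory.
Import numFieldNormedType.Exports.
Local Open Scope ring_scope.
Local Open Scope classical_set_scope.

Section pointwise_calculus.
Context {R : realType}.
Implicit Types f g : R -> R.

Lemma continuous_fun_cst (c : R) : continuous (fun _ : R => c).
Proof. by move=> x; exact: cvg_cst. Qed.

Lemma continuous_fun_id : continuous (fun x : R => x).
Proof. by move=> x; exact: cvg_id. Qed.

Lemma continuous_funD f g :
  continuous f -> continuous g -> continuous (fun x => f x + g x).
Proof. by move=> cf cg x; exact: cvgD (cf x) (cg x). Qed.

Lemma continuous_funN f : continuous f -> continuous (fun x => - f x).
Proof. by move=> cf x; exact: cvgN (cf x). Qed.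

Lemma continuous_funM f g :
  continuous f -> continuous g -> continuous (fun x => f x * g x).
Proof. by move=> cf cg x; exact: cvgM (cf x) (cg x). Qed.

Lemma continuous_funX f n : continuous f -> continuous (fun x => f x ^+ n).
Proof.
move=> cf; elim: n => [|n IH]; first exact: continuous_fun_cst.
by move=> x; under eq_fun do rewrite exprS; exact: cvgM (cf x) (IH x).
Qed.

Lemma continuous_fun_norm f : continuous f -> continuous (fun x => `|f x|).
Proof. by move=> cf x; exact: cvg_norm (cf x). Qed.

Lemma continuous_fun_comp f g :
  continuous f -> continuous g -> continuous (fun x => f (g x)).
Proof. by move=> cf cg x; exact: continuous_comp (cg x) (cf (g x)). Qed.

Lemma continuous_fun_exp f : continuous f -> continuous (fun x => expR (f x)).
Proof. by move=> cf; apply: continuous_fun_comp cf; exact: continuous_expR. Qed.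

Lemma is_derive_fun_cst (c x : R) : is_derive x 1 (fun _ : R => c) 0.
Proof. exact: is_derive_cst. Qed.

Lemma is_derive_fun_id (x : R) : is_derive x 1 (fun y : R => y) 1.
Proof. exact: is_derive_id. Qed.

Lemma is_derive_funD f g (x a c : R) : is_derive x 1 f a ->
  is_derive x 1 g c -> is_derive x 1 (fun y => f y + g y) (a + c).
Proof. by move=> df dg; exact: (@is_deriveD _ _ _ f g). Qed.

Lemma is_derive_funN f (x a : R) : is_derive x 1 f a ->
  is_derive x 1 (fun y => - f y) (- a).
Proof. by move=> df; exact: (@is_deriveN _ _ _ f). Qed.

Lemma is_derive_funM f g (x a c : R) : is_derive x 1 f a ->
  is_derive x 1 g c ->
  is_derive x 1 (fun y => f y * g y) (a * g x + f x * c).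
Proof.
move=> df dg; apply: is_derive_eq (@is_deriveM _ _ f g x 1 a c df dg) _.
by rewrite addrC; congr (_ + _); rewrite /GRing.scale/= mulrC.
Qed.

Lemma is_derive_funX f n (x a : R) : is_derive x 1 f a ->
  is_derive x 1 (fun y => f y ^+ n) (n%:R * f x ^+ n.-1 * a).
Proof.
move=> df; elim: n => [|n IH].
  by apply: is_derive_eq (is_derive_fun_cst 1 x) _; rewrite mul0r mul0r.
have := is_derive_funM df IH.
under [X in is_derive _ _ X]eq_fun do rewrite -exprS.
move=> H; apply: is_derive_eq H _ => /=; case: n {IH} => [|n] /=.
  by rewrite expr0; ring.
by rewrite !exprS; ring.
Qed.

Lemma is_derive_fun_exp f (x a : R) : is_derive x 1 f a ->
  is_derive x 1 (fun y => expR (f y)) (expR (f x) * a).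
Proof.
move=> df.
exact: (@is_derive1_comp _ expR f x (expR (f x)) a (is_derive_expR _) df).
Qed.

Lemma is_derive_continuous f (x a : R) : is_derive x 1 f a ->
  {for x, continuous f}.
Proof. by move=> [df _]; apply: differentiable_continuous; exact/derivable1_diffP. Qed.

Lemma is_derive_near_eq f g (x a : R) : (\near x, f x = g x) ->
  is_derive x 1 f a -> is_derive x 1 g a.
Proof. exact: near_eq_is_derive. Qed.

Lemma is_derive_eq_on f g (r x a : R) : 0 < x < r ->
  (forall y : R, 0 < y < r -> f y = g y) -> is_derive x 1 f a -> is_derive x 1 g a.
Proof.
move=> xr fg; apply: is_derive_near_eq.
have : x \in `]0, r[%R by rewrite in_itv.
by move=> /near_in_itvoo; apply: filterS => y; rewrite in_itv/= => /fg.
Qed.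

Lemma is_derive_val f (x a c : R) : is_derive x 1 f a -> a = c -> is_derive x 1 f c.
Proof. by move=> ? <-. Qed.

Lemma derive1_is_derive f (x a : R) : is_derive x 1 f a -> (f^`())%classic x = a.
Proof. by move=> [_ <-]; rewrite derive1E. Qed.

End pointwise_calculus.

(* Both tactics dispatch on the syntax of the function: unification up to
   conversion would unfold [expR]. *)
Ltac cont := repeat
  match goal with |- forall z, @continuous_at _ _ z ?F =>
    lazymatch F with
    | (fun x => x) => exact: continuous_fun_id
    | (fun x => @?f x + @?g x) => apply: (@continuous_funD _ f g)
    | (fun x => - @?f x) => apply: (@continuous_funN _ f)
    | (fun x => @?f x * @?g x) => apply: (@continuous_funM _ f g)
    | (fun x => @?f x ^+ ?n) => apply: (@continuous_funX _ f n)
    | (fun x => `|@?f x|) => apply: (@continuous_fun_norm _ f)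
    | (fun x => expR (@?f x)) => apply: (@continuous_fun_exp _ f)
    | (fun x => ?f x) =>
        match goal with
        | H : forall z, @continuous_at _ _ z f |- _ => exact: H
        | _ => assumption
        end
    | ?f =>
        match goal with
        | H : forall z, @continuous_at _ _ z f |- _ => exact: H
        | _ => first [exact: continuous_fun_cst | assumption]
        end
    end
  end.

Ltac deriv := repeat
  match goal with |- is_derive _ _ ?F _ =>
    lazymatch F with
    | (fun x => x) => eapply is_derive_fun_id
    | (fun x => @?f x + @?g x) => eapply (@is_derive_funD _ f g)
    | (fun x => - @?f x) => eapply (@is_derive_funN _ f)
    | (fun x => @?f x * @?g x) => eapply (@is_derive_funM _ f g)
    | (fun x => @?f x ^+ ?n) => eapply (@is_derive_funX _ f n)
    | (fun x => expR (@?f x)) => eapply (@is_derive_fun_exp _ f)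
    | (fun x => ?f x) =>
        match goal with
        | H : is_derive _ _ f _ |- _ => exact H
        | _ => eassumption
        end
    | ?f =>
        match goal with
        | H : is_derive _ _ f _ |- _ => exact H
        | _ => first [eapply is_derive_fun_cst | eassumption]
        end
    end
  end.

Ltac derivr := eapply is_derive_val; [deriv|cbv beta; rewrite /=; ring].

Section calculus.
Context {R : realType}.
Variable r : R.
Hypothesis r0 : 0 < r.
Implicit Types f g : R -> R.
Notation mu := (@lebesgue_measure R).

Definition clamp (x : R) : R := Num.max 0 (Num.min x r).

Lemma clamp_itv (x : R) : 0 <= clamp x <= r.
Proof. by rewrite /clamp le_max lexx /= ge_max (ltW r0) ge_min lexx orbT. Qed.

Lemma clamp_id (x : R) : 0 <= x <= r -> clamp x = x.
Proof. by case/andP=> x0 xr; rewrite /clamp (min_idPl xr) (max_idPr x0). Qed.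

Lemma clamp_continuous : continuous clamp.
Proof.
move=> x; apply: (@continuous_max _ R (fun=> 0) (fun x => Num.min x r)); first exact: cvg_cst.
by apply: (@continuous_min _ R id (fun=> r)); [exact: cvg_id|exact: cvg_cst].
Qed.

Lemma within_continuous_clamp f :
  {within `[0, r], continuous f} -> continuous (f \o clamp).
Proof.
move=> /subspace_continuousP cf x.
apply: (@cvg_comp _ _ _ clamp f (nbhs x) (within `[0, r]%classic (nbhs (clamp x)))).
  move=> A wA.
  have : nbhs x (clamp @^-1` (fun y => `[0, r]%classic y -> A y)).
    exact: (@clamp_continuous x _ wA).
  by apply: filterS => y; apply => /=; rewrite in_itv; exact: clamp_itv.
by apply: cf => /=; rewrite in_itv/=; exact: clamp_itv.
Qed.

Lemma interior_clamp (x : R) : 0 < x < r -> \near x, clamp x = x.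
Proof.
move=> xr; have : x \in `]0, r[%R by rewrite in_itv.
move=> /near_in_itvoo; apply: filterS => y; rewrite in_itv/= => /andP[y0 yr].
by rewrite clamp_id// !ltW.
Qed.

Definition prim f (x : R) : R := Rintegral mu `[0, clamp x] f.

Lemma prim0 f : prim f 0 = 0.
Proof. by rewrite /prim clamp_id ?lexx ?ltW// set_itv1 Rintegral_set1. Qed.

Lemma prim_continuous f :
  mu.-integrable `[0, r] (EFin \o f) -> continuous (prim f).
Proof.
move=> intf; rewrite (_ : prim f = (fun x => Rintegral mu `[0, x] f) \o clamp)//.
apply: within_continuous_clamp.
exact: parameterized_integral_continuous (ltW r0) intf.
Qed.

Lemma prim_is_derive f (x : R) : mu.-integrable `[0, r] (EFin \o f) -> 0 < x < r ->
  {for x, continuous f} -> is_derive x 1 (prim f) (f x).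
Proof.
move=> intf xr cf; have /andP[x0 xr'] := xr.
have [df dfE] := continuous_FTC1_closed xr' intf x0 cf.
have : is_derive x 1 (fun x => Rintegral mu `[0, x] f) (f x).
  by apply: DeriveDef; [exact: df|rewrite -derive1E].
apply: is_derive_near_eq.
by apply: filterS (interior_clamp xr) => y yE; rewrite /prim yE.
Qed.

Lemma continuous_integrable f : continuous f ->
  mu.-integrable `[0, r] (EFin \o f).
Proof.
move=> cf; apply: continuous_compact_integrable; first exact: segment_compact.
exact: continuous_subspaceT.
Qed.

Lemma primc_continuous f : continuous f -> continuous (prim f).
Proof. by move=> cf; apply: prim_continuous; exact: continuous_integrable. Qed.

Lemma primc_is_derive f (x : R) : continuous f -> 0 < x < r ->
  is_derive x 1 (prim f) (f x).
Proof. by move=> cf ?; apply: prim_is_derive => //; [exact: continuous_integrable|exact: cf]. Qed.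

Lemma le_of_derive f (df : R -> R) (x y : R) : continuous f ->
  (forall z : R, 0 < z < r -> is_derive z 1 f (df z)) ->
  (forall z : R, 0 < z < r -> 0 <= df z) -> 0 <= x -> x <= y -> y <= r -> f x <= f y.
Proof.
move=> cf fdf df0 x0; rewrite le_eqVlt => /predU1P[->//|xy] yr.
have [z|] := @MVT _ f df x y xy _ (continuous_subspaceT cf).
  rewrite in_itv/= => /andP[xz zy]; apply: fdf.
  by rewrite (le_lt_trans x0 xz) (lt_le_trans zy yr).
move=> z; rewrite in_itv/= => /andP[xz zy] fE; rewrite -subr_ge0 fE mulr_ge0//.
  by rewrite df0// (le_lt_trans x0 xz) (lt_le_trans zy yr).
by rewrite subr_ge0 ltW.
Qed.

Lemma eq_of_derive f g (d : R -> R) (x : R) : continuous f -> continuous g ->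
  (forall z : R, 0 < z < r -> is_derive z 1 f (d z)) ->
  (forall z : R, 0 < z < r -> is_derive z 1 g (d z)) -> 0 <= x <= r ->
  f x - f 0 = g x - g 0.
Proof.
move=> cf cg df dg /andP[x0 xr].
have H : forall f g, continuous f -> continuous g ->
  (forall z : R, 0 < z < r -> is_derive z 1 f (d z)) ->
  (forall z : R, 0 < z < r -> is_derive z 1 g (d z)) -> f 0 - g 0 <= f x - g x.
  move=> {cf cg df dg}f {}g cf cg df dg.
  apply: (@le_of_derive (fun z => f z - g z) (fun=> 0)) => //; first by cont.
  move=> z zr; move: (df z zr) (dg z zr) => d1 d2.
  by eapply is_derive_val; [deriv|rewrite subrr].
by have := H _ _ cf cg df dg; have := H _ _ cg cf dg df; lra.
Qed.

Lemma primE f g (x : R) : continuous f -> continuous g ->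
  (forall z : R, 0 < z < r -> is_derive z 1 g (f z)) -> 0 <= x <= r ->
  prim f x = g x - g 0.
Proof.
move=> cf cg dg xr.
have := @eq_of_derive (prim f) g f x (primc_continuous cf) cg _ dg xr.
by rewrite prim0 subr0; apply => z zr; exact: primc_is_derive.
Qed.

Lemma prim_le f g (x : R) : continuous f -> continuous g ->
  (forall z : R, 0 < z < r -> f z <= g z) -> 0 <= x <= r -> prim f x <= prim g x.
Proof.
move=> cf cg fg /andP[x0 xr].
have := @le_of_derive (fun x => prim g x - prim f x) (fun z => g z - f z) 0 x.
rewrite !prim0 subrr subr_ge0; apply => //.
- have ? := primc_continuous cf; have ? := primc_continuous cg; cont.
- move=> z zr; have ? := primc_is_derive cf zr; have ? := primc_is_derive cg zr.
  by deriv.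
- by move=> z /fg; rewrite subr_ge0.
Qed.

Lemma primD f g (x : R) : continuous f -> continuous g -> 0 <= x <= r ->
  prim (fun z => f z + g z) x = prim f x + prim g x.
Proof.
move=> cf cg xr;
apply: etrans (@primE _ (fun x => prim f x + prim g x) _ _ _ _ xr) _; last by rewrite !prim0 addr0 subr0.
- by cont.
- have ? := primc_continuous cf; have ? := primc_continuous cg; cont.
- move=> z zr; have ? := primc_is_derive cf zr; have ? := primc_is_derive cg zr.
  by deriv.
Qed.

Lemma primZ (c : R) f (x : R) : continuous f -> 0 <= x <= r ->
  prim (fun z => c * f z) x = c * prim f x.
Proof.
move=> cf xr;
apply: etrans (@primE _ (fun x => c * prim f x) _ _ _ _ xr) _; last by rewrite prim0 mulr0 subr0.
- by cont.
- have ? := primc_continuous cf; cont.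
- move=> z zr; have ? := primc_is_derive cf zr.
  by eapply is_derive_val; [deriv|rewrite mul0r add0r].
Qed.

Lemma prim_ext f g (x : R) : (forall z : R, 0 <= z <= r -> f z = g z) ->
  prim f x = prim g x.
Proof.
move=> fg; apply: eq_Rintegral => z; rewrite inE/= in_itv/= => /andP[z0 zx].
by rewrite fg// z0 (le_trans zx)//; have /andP[] := clamp_itv x.
Qed.

Lemma prim_cst (c : R) (x : R) : 0 <= x <= r -> prim (fun=> c) x = c * x.
Proof.
move=> xr;
apply: etrans (@primE _ (fun x => c * x) _ _ _ _ xr) _; last by rewrite mulr0 subr0.
- by cont.
- by cont.
- move=> z _; apply: is_derive_val (is_derive_funM (is_derive_fun_cst c z) (is_derive_fun_id z)) _.
  by rewrite mul0r add0r mulr1.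
Qed.

Lemma continuous_bounded_itv f : continuous f ->
  exists2 M : R, 0 < M & forall x : R, 0 <= x <= r -> `|f x| <= M.
Proof.
move=> cf.
have [|c _ cM] := @EVT_max R (fun x => `|f x|) 0 r (ltW r0).
  apply: continuous_subspaceT; cont.
exists (1 + `|f c|); first by rewrite ltr_pwDl.
by move=> x xr; apply: le_trans (cM x _) _; rewrite ?in_itv// lerDr.
Qed.

Lemma prim_definite f (x : R) : continuous f -> (forall z : R, 0 <= z <= r -> 0 <= f z) ->
  prim f r = 0 -> 0 <= x <= r -> f x = 0.
Proof.
move=> cf f0 If.
have F0 (z : R) : 0 <= z <= r -> prim f z = 0.
  move=> /andP[z0 zr].
  have H a c : 0 <= a -> a <= c -> c <= r -> prim f a <= prim f c.
    apply: (@le_of_derive (prim f) f).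
    - exact: primc_continuous.
    - by move=> y yr; exact: primc_is_derive.
    - by move=> y /andP[y0 yr]; rewrite f0// !ltW.
  apply/eqP; rewrite eq_le -{1}If H//= -(prim0 f) H//.
have fint (z : R) : 0 < z < r -> f z = 0.
  move=> zr; rewrite -(derive1_is_derive (primc_is_derive cf zr)).
  apply: derive1_is_derive; apply: is_derive_eq_on zr _ (is_derive_fun_cst 0 z).
  by move=> y /andP[y0 yr]; rewrite F0// !ltW.
move=> /andP[x0 xr]; apply/eqP; rewrite -normr_le0 leNgt; apply/negP => fx.
have /cvgrPdist_lt /(_ _ fx) [e /= e0 He] := cf x.
have [y yr xy] : exists2 y : R, 0 < y < r & `|x - y| < e.
  pose d := Num.min (e / 2) (r / 4).
  have [de dr d0] : [/\ d <= e / 2, d <= r / 4 & 0 < d].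
    by rewrite /d !ge_min !lexx orbT lt_min !divr_gt0.
  have [xr2|xr2] := leP x (r / 2).
    exists (x + d); first by apply/andP; split; lra.
    by rewrite (_ : x - (x + d) = - d) ?normrN ?gtr0_norm//; [lra|ring].
  exists (x - d); first by apply/andP; split; lra.
  by rewrite (_ : x - (x - d) = d) ?gtr0_norm//; [lra|ring].
by have := He y xy; rewrite (fint y yr) [_ - 0]subr0 ltxx.
Qed.

End calculus.

Section linear_ode.
Context {R : realType}.
Implicit Types f g : R -> R.

Lemma geometric_half_lt (C e : R) : 0 < e -> exists n, C / 2 ^+ n < e.
Proof.
move=> e0; pose n := (Num.truncn (`|C| / e)).+1.
exists n; rewrite ltr_pdivrMr ?exprn_gt0// mulrC -ltr_pdivrMr//.
apply: le_lt_trans (_ : `|C| / e < _); first by rewrite ler_pM2r ?invr_gt0// ler_norm.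
apply: lt_trans (_ : n%:R < _); first by rewrite /n truncnS_gt.
by rewrite -natrX ltr_nat ltn_expl.
Qed.

Lemma uniform_geometric_limit (f_ : nat -> R -> R) (C : R) :
  (forall n, continuous (f_ n)) ->
  (forall n x, `|f_ n.+1 x - f_ n x| <= C / 2 ^+ n) ->
  exists2 f, continuous f & forall n x, `|f x - f_ n x| <= 2 * C / 2 ^+ n.
Proof.
move=> cf fC.
pose l n x := f_ n x - 2 * C / 2 ^+ n; pose g n x := f_ n x + 2 * C / 2 ^+ n.
have C0 : 0 <= C.
  by have := fC 0%N 0; rewrite expr0 divr1; apply: le_trans.
have half n : C / 2 ^+ n = 2 * (C / 2 ^+ n.+1).
  by rewrite exprS; field; rewrite expf_neq0.
have C2n n : 0 <= C / 2 ^+ n by rewrite divr_ge0// exprn_ge0.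
have lS n x : l n x <= l n.+1 x.
  have := fC n x; rewrite ler_norml => /andP[h1 h2].
  by rewrite /l -!mulrA; have := half n; have := C2n n.+1; lra.
have gS n x : g n.+1 x <= g n x.
  have := fC n x; rewrite ler_norml => /andP[h1 h2].
  by rewrite /g -!mulrA; have := half n; have := C2n n.+1; lra.
have lg n m x : l n x <= g m x.
  have lmono i j : l i x <= l (i + j)%N x.
    by elim: j => [|j IH]; rewrite ?addn0// addnS (le_trans IH).
  have gmono i j : g (i + j)%N x <= g i x.
    by elim: j => [|j IH]; rewrite ?addn0// addnS (le_trans _ IH).
  rewrite (le_trans (lmono n m))// (le_trans _ (gmono m n))// addnC /l /g.
  by have := C2n (m + n)%N; rewrite -!mulrA; lra.
pose f x := sup [set l n x | n in setT].
have fE n x : `|f x - f_ n x| <= 2 * C / 2 ^+ n.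
  have hs : has_sup [set l n x | n in setT].
    split; first by exists (l 0%N x), 0%N.
    by exists (g 0%N x) => _ [m _ <-].
  have h1 : l n x <= f x by apply: ub_le_sup; [case: hs|exists n].
  have h2 : f x <= g n x by apply: ge_sup; [case: hs|move=> _ [m _ <-]].
  by move: h1 h2; rewrite /l /g ler_norml => h1 h2; apply/andP; split; lra.
exists f => // x; apply/cvgrPdist_lt => e e0.
have [n nC] := geometric_half_lt (2 * C) (divr_gt0 e0 (ltr0n _ 3)).
have /cvgrPdist_lt /(_ _ (divr_gt0 e0 (ltr0n _ 3))) := cf n x.
apply: filterS => y fxy.
have -> : f x - f y = (f x - f_ n x) + (f_ n x - f_ n y) - (f y - f_ n y) by ring.
apply: le_lt_trans (ler_normB _ _) _.
have := ler_normD (f x - f_ n x) (f_ n x - f_ n y).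
have := fE n x; have := fE n y; rewrite /= in fxy.
by lra.
Qed.

Variable r : R.
Hypothesis r0 : 0 < r.
Notation prim := (prim r).

Lemma primB f g (x : R) : continuous f -> continuous g -> 0 <= x <= r ->
  prim (fun z => f z - g z) x = prim f x - prim g x.
Proof.
move=> cf cg xr; rewrite (primD r0 cf (continuous_funN cg) xr); congr (_ + _).
rewrite -mulN1r -(primZ r0 (-1) cg xr).
by apply: prim_ext => // z _; rewrite mulN1r.
Qed.

Lemma prim_norm_le f g (x : R) : continuous f -> continuous g ->
  (forall z : R, 0 < z < r -> `|f z| <= g z) -> 0 <= x <= r ->
  `|prim f x| <= prim g x.
Proof.
move=> cf cg fg xr; rewrite ler_norml; apply/andP; split; last first.
  by apply: prim_le => // z /fg; apply: le_trans; rewrite ler_norm.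
rewrite lerNl -mulN1r -(primZ r0 (-1) cf xr); apply: prim_le => //; first by cont.
by move=> z /fg; apply: le_trans; rewrite mulN1r -normrN ler_norm.
Qed.

Lemma prim_clamp f (x : R) : prim f (clamp r x) = prim f x.
Proof. by rewrite /prim (clamp_id (clamp_itv r0 x)). Qed.

Variables (a1 a2 a3 a4 f1 f2 : R -> R) (u0 z0 : R).
Hypotheses (c1 : continuous a1) (c2 : continuous a2) (c3 : continuous a3)
  (c4 : continuous a4) (cf1 : continuous f1) (cf2 : continuous f2).

Let step (s : (R -> R) * (R -> R)) : (R -> R) * (R -> R) :=
  (fun x => u0 + prim (fun y => a1 y * s.1 y + a2 y * s.2 y + f1 y) x,
   fun x => z0 + prim (fun y => a3 y * s.1 y + a4 y * s.2 y + f2 y) x).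

Let picard n := iter n step (fun=> u0, fun=> z0).

Let step_continuous s : continuous s.1 -> continuous s.2 ->
  continuous (step s).1 /\ continuous (step s).2.
Proof.
move=> cs1 cs2; rewrite /step/=.
by split; (apply: continuous_funD; [cont|apply: primc_continuous => //; cont]).
Qed.

Let picard_continuous n :
  continuous (picard n).1 /\ continuous (picard n).2.
Proof.
elim: n => [|n [h1 h2]]; first by split => /=; cont.
exact: step_continuous.
Qed.

Let picard_clamp n x : (picard n).1 (clamp r x) = (picard n).1 x /\
  (picard n).2 (clamp r x) = (picard n).2 x.
Proof. by case: n => [//|n] /=; rewrite !prim_clamp. Qed.

Let step_lipschitz s t (g : R -> R) (M x : R) :
  continuous s.1 -> continuous s.2 -> continuous t.1 -> continuous t.2 ->
  (forall z : R, 0 <= z <= r -> [/\ `|a1 z| <= M, `|a2 z| <= M, `|a3 z| <= M & `|a4 z| <= M]) ->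
  continuous g ->
  (forall z : R, 0 <= z <= r -> `|s.1 z - t.1 z| + `|s.2 z - t.2 z| <= g z) ->
  0 <= x <= r ->
  `|(step s).1 x - (step t).1 x| <= M * prim g x /\
  `|(step s).2 x - (step t).2 x| <= M * prim g x.
Proof.
move=> s1 s2 t1 t2 aM cg stg xr.
have key (a c h : R -> R) : continuous a -> continuous c -> continuous h ->
    (forall z : R, 0 <= z <= r -> `|a z| <= M) ->
    (forall z : R, 0 <= z <= r -> `|c z| <= M) -> forall w : R,
    `|w + prim (fun y => a y * s.1 y + c y * s.2 y + h y) x
      - (w + prim (fun y => a y * t.1 y + c y * t.2 y + h y) x)| <= M * prim g x.
  move=> ca cc ch aM' cM w.
  rewrite opprD addrACA subrr add0r -primB//; [|by cont|by cont].
  rewrite -(primZ r0 M cg xr); apply: prim_norm_le => //; [by cont|by cont|].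
  move=> z /andP[z0' zr]; have zr' : 0 <= z <= r by rewrite !ltW.
  have -> : a z * s.1 z + c z * s.2 z + h z - (a z * t.1 z + c z * t.2 z + h z)
    = a z * (s.1 z - t.1 z) + c z * (s.2 z - t.2 z) by ring.
  apply: le_trans (ler_normD _ _) _; rewrite !normrM.
  apply: le_trans (_ : M * (`|s.1 z - t.1 z| + `|s.2 z - t.2 z|) <= _).
    by rewrite mulrDr lerD// ler_wpM2r// ?aM' ?cM.
  rewrite ler_wpM2l ?stg//.
  by apply: le_trans (aM' z zr').
by split; apply: key => // z /aM[].
Qed.

Lemma linear_ode_exists : exists u z : R -> R,
  [/\ continuous u, continuous z, u 0 = u0, z 0 = z0 &
   forall x : R, 0 < x < r ->
     is_derive x 1 u (a1 x * u x + a2 x * z x + f1 x) /\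
     is_derive x 1 z (a3 x * u x + a4 x * z x + f2 x)].
Proof.
have [M1 M10 M1P] := continuous_bounded_itv r0 c1.
have [M2 M20 M2P] := continuous_bounded_itv r0 c2.
have [M3 M30 M3P] := continuous_bounded_itv r0 c3.
have [M4 M40 M4P] := continuous_bounded_itv r0 c4.
pose M := M1 + M2 + M3 + M4.
have M0 : 0 < M by rewrite /M; lra.
have aM (z : R) : 0 <= z <= r ->
    [/\ `|a1 z| <= M, `|a2 z| <= M, `|a3 z| <= M & `|a4 z| <= M].
  move=> zr; have := M1P z zr; have := M2P z zr; have := M3P z zr; have := M4P z zr.
  by rewrite /M => *; split; lra.
pose dist n x := `|(picard n.+1).1 x - (picard n).1 x| +
                 `|(picard n.+1).2 x - (picard n).2 x|.
have cdist n : continuous (dist n).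
  have [? ?] := picard_continuous n; have [? ?] := picard_continuous n.+1.
  rewrite /dist; cont.
have [C C0 CP] := continuous_bounded_itv r0 (cdist 0%N).
pose w x := expR (4 * M * x).
have cw : continuous w by rewrite /w; cont.
have primw (x : R) : 0 <= x <= r -> 4 * M * prim w x <= w x.
  move=> xr; rewrite -(primZ r0 _ cw xr).
  rewrite (_ : prim _ x = w x - w 0) ?lerBlDr ?lerDl ?expR_ge0//.
  apply: (@primE _ _ r0 (fun z => 4 * M * w z) w) => //; first by cont.
  by move=> z _; rewrite /w; eapply is_derive_val; [deriv|rewrite /=; ring].
have distw n (x : R) : 0 <= x <= r -> dist n x <= C / 2 ^+ n * w x.
  elim: n x => [|n IH] x xr.
    rewrite expr0 divr1; apply: le_trans (_ : C <= _).
      by apply: le_trans (ler_norm _) (CP x xr).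
    rewrite ler_peMr ?(ltW C0)// /w -expR0 ler_expR.
    by case/andP: xr => x0 _; rewrite !mulr_ge0// ltW.
  have [p1 p2] := picard_continuous n; have [q1 q2] := picard_continuous n.+1.
  have cg : continuous (fun x => C / 2 ^+ n * w x) by cont.
  have [h1 h2] := @step_lipschitz (picard n.+1) (picard n) _ M x q1 q2 p1 p2 aM cg IH xr.
  rewrite (_ : dist n.+1 x = `|(step (picard n.+1)).1 x - (step (picard n)).1 x| +
    `|(step (picard n.+1)).2 x - (step (picard n)).2 x|)//.
  apply: le_trans (lerD h1 h2) _.
  rewrite (primZ r0 _ cw xr).
  rewrite (_ : _ + _ = C / 2 ^+ n.+1 * (4 * M * prim w x)); last first.
    by rewrite exprS; field; rewrite expf_neq0.
  by rewrite ler_wpM2l ?primw// divr_ge0 ?exprn_ge0// ltW.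
pose C' := C * w r.
have C'0 : 0 < C' by rewrite mulr_gt0// expR_gt0.
have distC n x : dist n x <= C' / 2 ^+ n.
  have -> : dist n x = dist n (clamp r x).
    rewrite /dist; have [-> ->] := picard_clamp n x.
    by have [-> ->] := picard_clamp n.+1 x.
  apply: le_trans (distw n _ (clamp_itv r0 x)) _.
  rewrite /C' mulrAC ler_wpM2r ?invr_ge0 ?exprn_ge0// ler_wpM2l ?(ltW C0)//.
  rewrite /w ler_expR ler_wpM2l ?mulr_ge0 ?(ltW M0)//.
  by have /andP[] := clamp_itv r0 x.
have [|n x|u cu uP] := @uniform_geometric_limit (fun n => (picard n).1) C'.
- by move=> n; have [] := picard_continuous n.
- by apply: le_trans (distC n x); rewrite lerDl.
have [|n x|z cz zP] := @uniform_geometric_limit (fun n => (picard n).2) C'.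
- by move=> n; have [] := picard_continuous n.
- by apply: le_trans (distC n x); rewrite lerDr.
have zitv : 0 <= (0 : R) <= r by rewrite lexx ltW.
have oitv (y : R) : 0 < y < r -> 0 <= y <= r by move=> /andP[y0 yr]; rewrite !ltW.
have fixed (x : R) : 0 <= x <= r -> u x = (step (u, z)).1 x /\ z x = (step (u, z)).2 x.
  move=> xr.
  pose D := 2 * C' + 4 * M * C' * r.
  have bnd n : `|u x - (step (u, z)).1 x| <= D / 2 ^+ n /\
               `|z x - (step (u, z)).2 x| <= D / 2 ^+ n.
    have [p1 p2] := picard_continuous n.
    have cc : continuous (fun _ : R => 4 * C' / 2 ^+ n) by cont.
    have [y yr|h1 h2] := @step_lipschitz (picard n) (u, z) _ M x p1 p2 cu cz aM cc _ xr.
      rewrite /= distrC [X in _ + X]distrC.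
      by apply: le_trans (lerD (uP n y) (zP n y)) _; rewrite -!mulrA; lra.
    rewrite (prim_cst r0 _ xr) in h1 h2.
    have xr' : M * (4 * C' / 2 ^+ n * x) <= 4 * M * C' * r / 2 ^+ n.
      rewrite (_ : _ * _ = (4 * M * C' / 2 ^+ n) * x); last by ring.
      rewrite [leRHS]mulrAC; apply: ler_wpM2l; last by case/andP: xr.
      by rewrite divr_ge0 ?exprn_ge0// mulr_ge0 ?(ltW C'0)// mulr_ge0// ltW.
    have half : 2 * C' / 2 ^+ n.+1 <= 2 * C' / 2 ^+ n.
      apply: ler_wpM2l; first by rewrite mulr_ge0// ltW.
      by rewrite lef_pV2 ?posrE ?exprn_gt0// ler_weXn2l// ler1n.
    have e1 := uP n.+1 x; have e2 := zP n.+1 x.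
    rewrite (_ : picard n.+1 = step (picard n))// in e1 e2.
    rewrite /D mulrDl; split.
    - rewrite -(subrKA ((step (picard n)).1 x)); apply: le_trans (ler_normD _ _) _.
      by lra.
    - rewrite -(subrKA ((step (picard n)).2 x)); apply: le_trans (ler_normD _ _) _.
      by lra.
  have zero (y : R) : (forall n, `|y| <= D / 2 ^+ n) -> y = 0.
    move=> yD; apply/eqP; rewrite -normr_le0 leNgt; apply/negP => y0.
    by have [n] := geometric_half_lt D y0; rewrite ltNge yD.
  split; apply/eqP; rewrite -subr_eq0; apply/eqP; apply: zero => n;
    by have [] := bnd n.
have [csu csz] := @step_continuous (u, z) cu cz.
have [F1 F2] : continuous (fun y => a1 y * u y + a2 y * z y + f1 y) /\
   continuous (fun y => a3 y * u y + a4 y * z y + f2 y) by split; cont.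
exists u, z; split => //.
- by have [-> _] := fixed 0 zitv; rewrite /= prim0// addr0.
- by have [_ ->] := fixed 0 zitv; rewrite /= prim0// addr0.
move=> x xr; split.
- apply: (@is_derive_eq_on _ (step (u, z)).1 _ r) => //.
    by move=> y /oitv/fixed[].
  have ? := primc_is_derive F1 xr.
  by rewrite /step/=; eapply is_derive_val; [deriv|rewrite /= add0r].
- apply: (@is_derive_eq_on _ (step (u, z)).2 _ r) => //.
    by move=> y /oitv/fixed[].
  have ? := primc_is_derive F2 xr.
  by rewrite /step/=; eapply is_derive_val; [deriv|rewrite /= add0r].
Qed.

End linear_ode.

(* Coefficients of a regular Sturm-Liouville problem on [0, r], extended to
   continuous functions on R.  The killing rate kap may be unbounded near the
   endpoints and only enters through its continuous primitive K. *)
Record sl_data (R : realType) := SLData {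
  sl_r : R;
  sl_b : R -> R;
  sl_B : R -> R;
  sl_K : R -> R;
  sl_kap : R -> R;
  sl_p0 : R;
  sl_pr : R;
  sl_r_gt0 : 0 < sl_r;
  sl_b_continuous : continuous sl_b;
  sl_B_continuous : continuous sl_B;
  sl_K_continuous : continuous sl_K;
  sl_B_at0 : sl_B 0 = 0;
  sl_K_at0 : sl_K 0 = 0;
  sl_B_is_derive : forall x, 0 < x < sl_r -> is_derive x 1 sl_B (2 * sl_b x);
  sl_K_is_derive : forall x, 0 < x < sl_r -> is_derive x 1 sl_K (sl_kap x);
  sl_kap_ge0 : forall x, 0 < x < sl_r -> 0 <= sl_kap x;
  sl_p0_itv : 0 <= sl_p0 <= 1;
  sl_pr_itv : 0 <= sl_pr <= 1 }.

Section diffusion.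
Context {R : realType} (S : sl_data R).
Notation r := (sl_r S).
Notation b := (sl_b S).
Notation B := (sl_B S).
Notation K := (sl_K S).
Notation kap := (sl_kap S).
Notation p0 := (sl_p0 S).
Notation pr := (sl_pr S).
Notation prim := (prim r).
Let r0 : 0 < r := sl_r_gt0 S.
Let cb : continuous b := @sl_b_continuous _ S.
Let cB : continuous B := @sl_B_continuous _ S.
Let cK : continuous K := @sl_K_continuous _ S.
Let B0 : B 0 = 0 := sl_B_at0 S.
Let dB := @sl_B_is_derive _ S.
Let dK := @sl_K_is_derive _ S.
Let kap0 := @sl_kap_ge0 _ S.
Let p0_itv := sl_p0_itv S.
Let pr_itv := sl_pr_itv S.
Implicit Types f g u v : R -> R.

Definition wt (x : R) : R := expR (B x).
Notation p := wt.

Lemma wt_gt0 x : 0 < p x. Proof. exact: expR_gt0. Qed.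

Lemma wt_continuous : continuous p. Proof. by rewrite /wt; cont. Qed.

Lemma wt_is_derive (x : R) : 0 < x < r -> is_derive x 1 p (2 * b x * p x).
Proof.
by move=> /dB ?; rewrite /wt; eapply is_derive_val; [deriv|rewrite mulrC].
Qed.

Definition ip f g : R := prim (fun x => p x * f x * g x) r.

Let rr : 0 <= r <= r. Proof. by rewrite lexx ltW. Qed.
Let cp := wt_continuous.

Lemma ip_sym f g : ip f g = ip g f.
Proof. by apply: prim_ext => // x _; rewrite mulrAC. Qed.

Lemma ip_linl (c : R) f1 f2 g : continuous f1 -> continuous f2 -> continuous g ->
  ip (fun x => f1 x + c * f2 x) g = ip f1 g + c * ip f2 g.
Proof.
move=> h1 h2 h3; rewrite /ip -primZ ?rr//; last by cont.
rewrite -primD ?rr//; [|by cont|by cont].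
by apply: prim_ext => // x _; ring.
Qed.

Lemma ip_linr (c : R) f1 f2 g : continuous f1 -> continuous f2 -> continuous g ->
  ip g (fun x => f1 x + c * f2 x) = ip g f1 + c * ip g f2.
Proof. by move=> *; rewrite ip_sym ip_linl// !(ip_sym g). Qed.

Lemma ipZl (c : R) f g : continuous f -> continuous g ->
  ip (fun x => c * f x) g = c * ip f g.
Proof.
move=> h1 h2; rewrite /ip -primZ ?rr//; last by cont.
by apply: prim_ext => // x _; ring.
Qed.

Lemma ip_sqr (c : R) f g : continuous f -> continuous g ->
  ip (fun x => f x + c * g x) (fun x => f x + c * g x) =
  ip f f + 2 * c * ip f g + c ^+ 2 * ip g g.
Proof.
move=> h1 h2; have h : continuous (fun x => f x + c * g x) by cont.
by rewrite ip_linl// !ip_linr// (ip_sym g f); ring.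
Qed.

Lemma ip_ge0 f : continuous f -> 0 <= ip f f.
Proof.
move=> cf; rewrite /ip -[leLHS](mul0r r) -(prim_cst r0 0 rr).
apply: prim_le => //; [by cont|by cont|move=> x _].
by rewrite -mulrA -expr2 mulr_ge0 ?sqr_ge0// ltW// wt_gt0.
Qed.

Lemma ip_eq0 f (x : R) : continuous f -> ip f f = 0 -> 0 <= x <= r -> f x = 0.
Proof.
move=> cf f0 xr; have : p x * f x * f x = 0.
  apply: (prim_definite r0 _ _ f0 xr); first by cont.
  by move=> z _; rewrite -mulrA -expr2 mulr_ge0 ?sqr_ge0// ltW// wt_gt0.
move/eqP; rewrite -mulrA mulf_eq0 gt_eqF ?wt_gt0//= -expr2 sqrf_eq0.
by move/eqP.
Qed.

Lemma ip_le_half f g : continuous f -> continuous g ->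
  2 * ip f g <= ip f f + ip g g.
Proof.
move=> cf cg; have := @ip_sqr (-1) f g cf cg.
have /ip_ge0 : continuous (fun x => f x + -1 * g x) by cont.
by lra.
Qed.

Definition dom u v g : Prop :=
  [/\ [/\ continuous u, continuous v & continuous g],
      forall x : R, 0 < x < r -> is_derive x 1 u (2 * v x) /\
        is_derive x 1 v (g x + kap x * u x - 2 * b x * v x),
      (1 - p0) * u 0 = p0 * v 0 &
      pr * v r = - ((1 - pr) * expR (- B r) * u r)].

Lemma dom_lin (c : R) u1 v1 g1 u2 v2 g2 : dom u1 v1 g1 -> dom u2 v2 g2 ->
  dom (fun x => u1 x + c * u2 x) (fun x => v1 x + c * v2 x)
      (fun x => g1 x + c * g2 x).
Proof.
move=> [[? ? ?] d1 l1 r1] [[? ? ?] d2 l2 r2]; split.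
- by split; cont.
- move=> x xr; have [? ?] := d1 x xr; have [? ?] := d2 x xr.
  by split; (derivr).
- by rewrite !mulrDr mulrCA l2 l1; ring.
- by rewrite !mulrDr mulrCA r2 r1; ring.
Qed.

Lemma dom_scale (c : R) u v g : dom u v g ->
  dom (fun x => c * u x) (fun x => c * v x) (fun x => c * g x).
Proof.
move=> [[? ? ?] d1 l1 r1]; split.
- by split; cont.
- move=> x xr; have [? ?] := d1 x xr.
  by split; (derivr).
- by rewrite mulrCA l1; ring.
- by rewrite mulrCA r1; ring.
Qed.

Lemma dom_bnd0 u v g : dom u v g -> 0 <= u 0 * v 0.
Proof.
move=> [_ _ l _]; have /andP[p00 p01] := p0_itv.
have [p0E|p0N] := eqVneq p0 0.
  by move: l; rewrite p0E subr0 mul1r mul0r => ->; rewrite mul0r.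
have p0P : 0 < p0 by rewrite lt_neqAle eq_sym p0N.
have -> : v 0 = (1 - p0) / p0 * u 0
  by apply: (mulfI p0N); rewrite -l; field.
by rewrite mulrCA mulr_ge0 ?divr_ge0 ?subr_ge0// -expr2 sqr_ge0.
Qed.

Lemma dom_bndr u v g : dom u v g -> u r * v r <= 0.
Proof.
move=> [_ _ _ l]; have /andP[p00 p01] := pr_itv.
have [p0E|p0N] := eqVneq pr 0.
  move: l; rewrite p0E mul0r subr0 mul1r => /eqP.
  rewrite eq_sym oppr_eq0 mulf_eq0 gt_eqF ?expR_gt0//= => /eqP ->.
  by rewrite mul0r.
have p0P : 0 < pr by rewrite lt_neqAle eq_sym p0N.
have -> : v r = - ((1 - pr) / pr * expR (- B r) * u r).
  by apply: (mulfI p0N); rewrite l; field.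
rewrite mulrN oppr_le0 mulrCA -expr2 mulr_ge0 ?sqr_ge0//.
by rewrite mulr_ge0 ?expR_ge0// divr_ge0 ?subr_ge0.
Qed.

Lemma dom_wronskian_r u1 v1 g1 u2 v2 g2 : dom u1 v1 g1 -> dom u2 v2 g2 ->
  v1 r * u2 r - u1 r * v2 r = 0.
Proof.
move=> [_ _ _ l1] [_ _ _ l2]; set E := expR (- B r) in l1 l2.
have [prE|prN] := eqVneq pr 0.
  move: l1 l2; rewrite prE !mul0r subr0 !mul1r => /eqP.
  rewrite eq_sym oppr_eq0 mulf_eq0 gt_eqF ?expR_gt0//= => /eqP -> /eqP.
  rewrite eq_sym oppr_eq0 mulf_eq0 gt_eqF ?expR_gt0//= => /eqP ->.
  by rewrite mulr0 mul0r subr0.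
by apply: (mulfI prN); rewrite mulr0 mulrBr mulrA l1 (mulrCA pr) l2; ring.
Qed.

Lemma dom_wronskian_0 u1 v1 g1 u2 v2 g2 : dom u1 v1 g1 -> dom u2 v2 g2 ->
  v1 0 * u2 0 - u1 0 * v2 0 = 0.
Proof.
move=> [_ _ l1 _] [_ _ l2 _].
have [pE|pN] := eqVneq p0 0.
  by move: l1 l2; rewrite pE !mul0r subr0 !mul1r => -> ->; rewrite mulr0 mul0r subr0.
by apply: (mulfI pN); rewrite mulr0 mulrBr mulrA -l1 (mulrCA p0) -l2; ring.
Qed.

(* Green's identity: both sides have the derivative [p (g1 u2 - u1 g2)]. *)
Lemma green u1 v1 g1 u2 v2 g2 :
  continuous u1 -> continuous v1 -> continuous g1 ->
  continuous u2 -> continuous v2 -> continuous g2 ->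
  (forall x : R, 0 < x < r -> is_derive x 1 u1 (2 * v1 x) /\
        is_derive x 1 v1 (g1 x + kap x * u1 x - 2 * b x * v1 x)) ->
  (forall x : R, 0 < x < r -> is_derive x 1 u2 (2 * v2 x) /\
        is_derive x 1 v2 (g2 x + kap x * u2 x - 2 * b x * v2 x)) ->
  ip g1 u2 - ip u1 g2 =
  p r * (v1 r * u2 r - u1 r * v2 r) - (v1 0 * u2 0 - u1 0 * v2 0).
Proof.
move=> cu1 cv1 cg1 cu2 cv2 cg2 d1 d2.
rewrite /ip -primB ?rr//; [|by cont|by cont].
have -> : prim (fun z => p z * g1 z * u2 z - p z * u1 z * g2 z) r =
  p r * (v1 r * u2 r - u1 r * v2 r) - p 0 * (v1 0 * u2 0 - u1 0 * v2 0).
  apply: (@primE _ _ r0 _ (fun x => p x * (v1 x * u2 x - u1 x * v2 x))) => //.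
  - by cont.
  - by cont.
  move=> x xr; have [? ?] := d1 x xr; have [? ?] := d2 x xr.
  have ? := wt_is_derive xr.
  by derivr.
by rewrite {2}/wt B0 expR0 mul1r.
Qed.

Lemma dom_sym u1 v1 g1 u2 v2 g2 : dom u1 v1 g1 -> dom u2 v2 g2 ->
  ip g1 u2 = ip u1 g2.
Proof.
move=> D1 D2; apply/eqP; rewrite -subr_eq0; apply/eqP.
have [[? ? ?] d1 _ _] := D1; have [[? ? ?] d2 _ _] := D2.
rewrite (@green u1 v1 g1 u2 v2 g2)//.
by rewrite (dom_wronskian_r D1 D2) (dom_wronskian_0 D1 D2) mulr0 subr0.
Qed.

Lemma dom_energy u v g : dom u v g -> 2 * ip v v <= - ip g u.
Proof.
move=> D; have [[cu cv cg] d _ _] := D.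
have cG : continuous (fun x => p x * g x * u x) by cont.
have cV : continuous (fun x => p x * v x * v x) by cont.
have := @le_of_derive _ r (fun x => p x * u x * v x -
   prim (fun x => p x * g x * u x) x - 2 * prim (fun x => p x * v x * v x) x)
   (fun x => p x * kap x * u x ^+ 2) 0 r.
rewrite !prim0// mulr0 !subr0 -/(ip _ _) -/(ip _ _).
have : 0 <= p 0 * u 0 * v 0 by rewrite -mulrA mulr_ge0 ?(dom_bnd0 D) ?ltW ?wt_gt0.
have : p r * u r * v r <= 0.
  by rewrite -mulrA pmulr_rle0 ?wt_gt0// (dom_bndr D).
move=> h1 h2 /(_ _ _ _ _ (ltW r0) (lexx _)) h3.
suff : p 0 * u 0 * v 0 <= p r * u r * v r - ip g u - 2 * ip v v by lra.
apply: h3 => //.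
- have ? := primc_continuous r0 cG; have ? := primc_continuous r0 cV; cont.
- move=> x xr; have [? ?] := d x xr; have ? := wt_is_derive xr.
  have ? := primc_is_derive cG xr; have ? := primc_is_derive cV xr.
  by derivr.
- move=> x xr; rewrite mulr_ge0 ?sqr_ge0// mulr_ge0 ?kap0// ltW//.
  exact: wt_gt0.
Qed.

Lemma wt_lower : exists2 m : R, 0 < m & forall x : R, 0 <= x <= r -> m <= p x.
Proof.
have [M M0 MP] := continuous_bounded_itv r0 cB.
exists (expR (- M)); first exact: expR_gt0.
by move=> x /MP; rewrite ler_norml ler_expR => /andP[].
Qed.

Lemma prim_sqr_le_ip : exists2 C : R, 0 < C &
  forall f, continuous f -> prim (fun x => f x ^+ 2) r <= C * ip f f.
Proof.
have [m m0 mp] := wt_lower; exists m^-1; first by rewrite invr_gt0.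
move=> f cf; rewrite /ip -primZ ?rr//; last by cont.
apply: prim_le => //; [by cont|by cont|move=> x /andP[x0 xr]].
rewrite -mulrA -expr2 mulrA ler_peMl ?sqr_ge0// mulrC ler_pdivlMr// mul1r.
by apply: mp; rewrite !ltW.
Qed.

(* Average the bound [u x ^+ 2 - u y ^+ 2 <= 2 * int (u^2 + v^2)] over y. *)
Lemma sobolev : exists2 C : R, 0 < C & forall u v,
  continuous u -> continuous v ->
  (forall x : R, 0 < x < r -> is_derive x 1 u (2 * v x)) ->
  forall x : R, 0 <= x <= r -> u x ^+ 2 <= C * (ip u u + ip v v).
Proof.
have [C C0 CP] := prim_sqr_le_ip.
exists ((r^-1 + 2) * C); first by rewrite mulr_gt0// addr_gt0// invr_gt0.
move=> u v cu cv du x xr.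
pose I f := prim (fun x => f x ^+ 2) r.
have I0 f : continuous f -> 0 <= I f.
  move=> cf; rewrite -[leLHS](mul0r r) -(prim_cst r0 0 rr).
  by apply: prim_le => //; [by cont|by cont|move=> z _; exact: sqr_ge0].
have cq : continuous (fun x => 2 * (u x ^+ 2 + v x ^+ 2)) by cont.
have cQ := primc_continuous r0 cq.
pose Q := prim (fun x => 2 * (u x ^+ 2 + v x ^+ 2)).
have QE : Q r = 2 * (I u + I v).
  by rewrite /Q primZ ?rr// ?primD ?rr//; cont.
have up (y z : R) : 0 <= y -> y <= z -> z <= r -> u y ^+ 2 + Q y <= u z ^+ 2 + Q z /\
    u z ^+ 2 - Q z <= u y ^+ 2 - Q y.
  move=> y0 yz zr; split.
    apply: (@le_of_derive _ r (fun x => u x ^+ 2 + Q x)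
      (fun x => 2 * (u x + v x) ^+ 2) y z) => //.
    - by rewrite /Q; cont.
    - move=> t tr; have ? := du t tr; have ? := primc_is_derive cq tr.
      by rewrite /Q; derivr.
    - by move=> t _; rewrite mulr_ge0// sqr_ge0.
  have := @le_of_derive _ r (fun x => Q x - u x ^+ 2)
      (fun x => 2 * (u x - v x) ^+ 2) y z.
  move=> /(_ _ _ _ y0 yz zr) H; suff : Q y - u y ^+ 2 <= Q z - u z ^+ 2 by lra.
  apply: H.
  - by rewrite /Q; cont.
  - move=> t tr; have ? := du t tr; have ? := primc_is_derive cq tr.
    by rewrite /Q; derivr.
  - by move=> t _; rewrite mulr_ge0// sqr_ge0.
have Qmono (y : R) : 0 <= y <= r -> 0 <= Q y <= Q r.
  move=> /andP[y0 yr].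
  have H (s t : R) : 0 <= s -> s <= t -> t <= r -> Q s <= Q t.
    apply: (@le_of_derive _ r Q (fun x => 2 * (u x ^+ 2 + v x ^+ 2))) => //.
      by move=> ? ?; exact: primc_is_derive.
    by move=> t' _; rewrite mulr_ge0// addr_ge0 ?sqr_ge0.
  by rewrite -{1}(prim0 r0 (fun x => 2 * (u x ^+ 2 + v x ^+ 2))) !H.
have pt (y : R) : 0 <= y <= r -> u x ^+ 2 - Q r <= u y ^+ 2.
  move=> yr; have /andP[x0 xr'] := xr; have /andP[y0 yr'] := yr.
  have /andP[qx0 qxr] := Qmono x xr; have /andP[qy0 qyr] := Qmono y yr.
  have [xy|/ltW yx] := leP x y.
    by have [+ _] := up x y x0 xy yr'; lra.
  by have [_ +] := up y x y0 yx xr'; lra.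
have : (u x ^+ 2 - Q r) * r <= I u.
  rewrite -(prim_cst r0 _ rr); apply: prim_le => //; [by cont|by cont|].
  by move=> y /andP[y0 yr]; rewrite pt// !ltW.
rewrite -ler_pdivlMr// => h1.
have h2 := CP u cu; have h3 := CP v cv.
have h4 := ip_ge0 cu; have h5 := ip_ge0 cv.
have h6 : I u / r <= C * ip u u / r by rewrite ler_pM2r ?invr_gt0.
have h7 : 0 <= C * ip v v / r by rewrite divr_ge0 ?(ltW r0)// mulr_ge0// ltW.
rewrite (_ : _ * _ * _ = C * ip u u / r + C * ip v v / r + 2 * (C * ip u u + C * ip v v)); last by ring.
by rewrite /I in h1 h2 h3 h6 QE; lra.
Qed.

End diffusion.

Section spectrum.
Context {R : realType} (S : sl_data R).
Notation r := (sl_r S).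
Notation b := (sl_b S).
Notation B := (sl_B S).
Notation K := (sl_K S).
Notation kap := (sl_kap S).
Notation p0 := (sl_p0 S).
Notation pr := (sl_pr S).
Notation prim := (prim r).
Notation p := (wt S).
Notation ip := (ip S).
Notation dom := (dom S).
Let r0 : 0 < r := sl_r_gt0 S.
Let rr : 0 <= r <= r. Proof. by rewrite lexx ltW. Qed.
Let cp := @wt_continuous _ S.
Implicit Types f g u v : R -> R.

Let cb : continuous b := @sl_b_continuous _ S.
Let cK : continuous K := @sl_K_continuous _ S.
Let dK := @sl_K_is_derive _ S.

(* [generator u v g]: on (0, r), v = u' / 2 and g = u'' / 2 + b u' - kap u. *)
Definition generator u v g : Prop := forall x : R, 0 < x < r ->
  is_derive x 1 u (2 * v x) /\
  is_derive x 1 v (g x + kap x * u x - 2 * b x * v x).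

(* The substitution z = v - K u removes kap from the system. *)
Lemma ivp_exists (q : R) f (u0 v0 : R) : continuous f -> exists u v,
  [/\ continuous u, continuous v, u 0 = u0, v 0 = v0 &
      generator u v (fun x => q * u x - f x)].
Proof.
move=> cf.
have [u [z [cu cz u00 z00 uz]]] := @linear_ode_exists _ r r0
  (fun x => 2 * K x) (fun=> 2) (fun x => q - 2 * (b x + K x) * K x)
  (fun x => - (2 * (b x + K x))) (fun=> 0) (fun x => - f x) u0 v0
  ltac:(cont) ltac:(cont) ltac:(cont) ltac:(cont) ltac:(cont) ltac:(cont).
exists u, (fun x => z x + K x * u x); split => //.
- by cont.
- by rewrite sl_K_at0 mul0r addr0.
move=> x xr; have [? ?] := uz x xr; have ? := dK xr.
by split; derivr.
Qed.

Lemma double_prod_le (c k x y : R) : `|c| <= k ->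
  2 * c * x * y <= k * (x ^+ 2 + y ^+ 2).
Proof.
move=> ck; have k0 : 0 <= k by apply: le_trans ck.
apply: le_trans (_ : `|c| * (x ^+ 2 + y ^+ 2) <= _); last first.
  by rewrite ler_wpM2r// addr_ge0 ?sqr_ge0.
have [c0|c0] := leP 0 c.
  rewrite (ger0_norm c0); have : 0 <= c * (x - y) ^+ 2 by rewrite mulr_ge0 ?sqr_ge0.
  by nra.
rewrite (ltr0_norm c0); have : 0 <= - c * (x + y) ^+ 2 by rewrite mulr_ge0 ?sqr_ge0// oppr_ge0 ltW.
by nra.
Qed.

(* Gronwall for y = u^2 + z^2 with z = v - K u: y' <= N y + f^2. *)
Lemma ivp_bound (q : R) : exists2 C : R, 0 < C & forall f u v,
  continuous f -> continuous u -> continuous v ->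
  generator u v (fun x => q * u x - f x) ->
  forall x : R, 0 <= x <= r -> u x ^+ 2 + v x ^+ 2 <=
    C * (u 0 ^+ 2 + v 0 ^+ 2 + prim (fun x => f x ^+ 2) r).
Proof.
have [k k0 kP] := continuous_bounded_itv r0 cK.
have [m m0 mP] := continuous_bounded_itv r0 cb.
pose a := m + k.
pose N := 2 + 4 * k + `|q| + 1 + 4 * a + 2 * a * k.
have a0 : 0 < a by rewrite addr_gt0.
have N0 : 0 < N.
  have q0 := normr_ge0 q; have ak : 0 < a * k by rewrite mulr_gt0.
  by rewrite /N; lra.
exists ((2 + 2 * k ^+ 2) * expR (N * r)).
  by rewrite mulr_gt0 ?expR_gt0// addr_gt0// mulr_gt0// exprn_gt0.
move=> f u v cf cu cv uv x xr.
pose z x := v x - K x * u x.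
have cz : continuous z by rewrite /z; cont.
pose y x := u x ^+ 2 + z x ^+ 2.
pose y' x := 4 * u x * v x +
  2 * z x * (q * u x - f x - 2 * (b x + K x) * v x).
have cf2 : continuous (fun x => f x ^+ 2) by cont.
have dy (t : R) : 0 < t < r -> is_derive t 1 y (y' t).
  move=> tr; have [? ?] := uv t tr; have ? := dK tr.
  by rewrite /y /y' /z; derivr.
have yN (t : R) : 0 < t < r -> y' t <= N * y t + f t ^+ 2.
  move=> /andP[t0 tr]; have tr' : 0 <= t <= r by rewrite !ltW.
  have hK := kP t tr'; have hb := mP t tr'.
  have hA : `|b t + K t| <= a by rewrite (le_trans (ler_normD _ _))// lerD.
  have h1 : 2 * 2 * u t * z t <= 2 * (u t ^+ 2 + z t ^+ 2).
    by apply: double_prod_le; rewrite ger0_norm.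
  have h2 : 2 * K t * u t * u t <= k * (u t ^+ 2 + u t ^+ 2) by apply: double_prod_le.
  have h3 : 2 * q * z t * u t <= `|q| * (z t ^+ 2 + u t ^+ 2) by apply: double_prod_le.
  have h4 : 2 * (-1) * z t * f t <= 1 * (z t ^+ 2 + f t ^+ 2).
    by apply: double_prod_le; rewrite normrN normr1.
  have h5 : 2 * (- (b t + K t)) * z t * z t <= a * (z t ^+ 2 + z t ^+ 2).
    by apply: double_prod_le; rewrite normrN.
  have h6 : 2 * (- ((b t + K t) * K t)) * z t * u t <= a * k * (z t ^+ 2 + u t ^+ 2).
    by apply: double_prod_le; rewrite normrN normrM ler_pM.
  have u2 : 0 <= u t ^+ 2 by rewrite sqr_ge0.
  have z2 : 0 <= z t ^+ 2 by rewrite sqr_ge0.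
  have e1 : 0 <= k * z t ^+ 2 by rewrite mulr_ge0// ltW.
  have e2 : 0 <= a * u t ^+ 2 by rewrite mulr_ge0// ltW.
  have -> : y' t = 2 * 2 * u t * z t + 2 * (2 * K t * u t * u t) +
    2 * q * z t * u t + 2 * (-1) * z t * f t +
    2 * (2 * (- (b t + K t)) * z t * z t) +
    2 * (2 * (- ((b t + K t) * K t)) * z t * u t) by rewrite /y' /z; ring.
  by rewrite /y /N; lra.
have key : expR (- (N * x)) * y x <= y 0 + prim (fun x => f x ^+ 2) r.
  have := @le_of_derive _ r (fun x => prim (fun x => f x ^+ 2) x - expR (- (N * x)) * y x)
    (fun x => f x ^+ 2 - expR (- (N * x)) * (y' x - N * y x)) 0 x.
  have /andP[x0 xr'] := xr.
  rewrite prim0// mulr0 oppr0 expR0 mul1r sub0r.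
  have mono : prim (fun x => f x ^+ 2) x <= prim (fun x => f x ^+ 2) r.
    apply: (@le_of_derive _ r _ (fun x => f x ^+ 2)) => //.
    - exact: primc_continuous.
    - by move=> ? ?; exact: primc_is_derive.
    - by move=> t _; exact: sqr_ge0.
  move=> /(_ _ _ _ (lexx 0) x0 xr') H.
  suff : - y 0 <= prim (fun x => f x ^+ 2) x - expR (- (N * x)) * y x by lra.
  apply: H.
  - by have ? := primc_continuous r0 cf2; rewrite /y; cont.
  - move=> t tr; have ? := dy t tr; have ? := primc_is_derive cf2 tr; derivr.
  - move=> t tr; have h := yN t tr.
    have E1 : expR (- (N * t)) <= 1.
      by rewrite -[leRHS]expR0 ler_expR oppr_le0 mulr_ge0 ?(ltW N0)//; case/andP: tr => /ltW.
    have E0 := expR_gt0 (- (N * t)).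
    have h' : y' t - N * y t <= f t ^+ 2 by lra.
    have := ler_wpM2l (ltW E0) h'.
    have := ler_wpM2r (sqr_ge0 (f t)) E1; rewrite mul1r; lra.
have y0E : y 0 = u 0 ^+ 2 + v 0 ^+ 2 by rewrite /y /z sl_K_at0 mul0r subr0.
have yx : y x <= expR (N * r) * (u 0 ^+ 2 + v 0 ^+ 2 + prim (fun x => f x ^+ 2) r).
  rewrite -y0E; apply: le_trans (_ : expR (N * x) * (y 0 + prim (fun x => f x ^+ 2) r) <= _).
    have := ler_wpM2l (expR_ge0 (N * x)) key.
    by rewrite mulrA -expRD subrr expR0 mul1r.
  rewrite ler_wpM2r//; last first.
    by rewrite ler_expR ler_pM2l//; case/andP: xr.
  by apply: le_trans key; rewrite mulr_ge0 ?expR_ge0// addr_ge0 ?sqr_ge0.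
have vz : v x ^+ 2 <= 2 * z x ^+ 2 + 2 * k ^+ 2 * u x ^+ 2.
  have -> : v x = z x + K x * u x by rewrite /z; ring.
  have : (K x * u x) ^+ 2 <= k ^+ 2 * u x ^+ 2.
    rewrite exprMn ler_wpM2r ?sqr_ge0// -[K x ^+ 2]real_normK ?num_real//.
    by rewrite ler_pXn2r ?nnegrE ?kP// ltW.
  have := sqr_ge0 (z x - K x * u x); nra.
have k2 : 0 <= k ^+ 2 * z x ^+ 2 by rewrite mulr_ge0 ?sqr_ge0.
apply: le_trans (_ : (2 + 2 * k ^+ 2) * y x <= _); last first.
  by rewrite -mulrA ler_wpM2l// addr_ge0// mulr_ge0// sqr_ge0.
by have := sqr_ge0 (u x); have := sqr_ge0 (z x); rewrite /y; lra.
Qed.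

Lemma ivp_unique (q : R) u v : continuous u -> continuous v ->
  generator u v (fun x => q * u x) -> u 0 = 0 -> v 0 = 0 ->
  forall x : R, 0 <= x <= r -> u x = 0 /\ v x = 0.
Proof.
move=> cu cv uv u00 v00 x xr; have [C C0 CP] := ivp_bound q.
have := CP (fun=> 0) u v ltac:(cont) cu cv _ x xr.
rewrite u00 v00 !expr0n/= (prim_cst r0 _ rr) mul0r !addr0 mulr0 => H.
have {}H : u x ^+ 2 + v x ^+ 2 <= 0.
  by apply: H => t /uv[? ?]; split => //; rewrite subr0.
have := sqr_ge0 (u x); have := sqr_ge0 (v x) => h1 h2.
by split; apply/eqP; rewrite -sqrf_eq0; apply/eqP; lra.
Qed.

Lemma dom_generator u v g : dom u v g -> generator u v g.
Proof. by case. Qed.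

Lemma generator_zero u v g : generator u v g ->
  (forall x : R, 0 <= x <= r -> u x = 0) -> forall x : R, 0 < x < r -> v x = 0 /\ g x = 0.
Proof.
move=> uv u0.
have u0' (t : R) : 0 < t < r -> u t = 0 by move=> /andP[? ?]; rewrite u0// !ltW.
have v0 (t : R) : 0 < t < r -> v t = 0.
  move=> tr; have [du _] := uv t tr.
  have : 2 * v t = 0.
    rewrite -(derive1_is_derive du); apply: derive1_is_derive.
    by apply: is_derive_eq_on tr _ (is_derive_fun_cst 0 t) => s /u0' ->.
  by move/eqP; rewrite mulf_eq0 pnatr_eq0/= => /eqP.
move=> x xr; split; first exact: v0.
have [_ dv] := uv x xr.
have : g x + kap x * u x - 2 * b x * v x = 0.
  rewrite -(derive1_is_derive dv); apply: derive1_is_derive.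
  by apply: is_derive_eq_on xr _ (is_derive_fun_cst 0 x) => s /v0 ->.
by rewrite v0// u0'// !mulr0 subr0 addr0.
Qed.

Definition bcr u v : R := pr * v r + (1 - pr) * expR (- B r) * u r.

Lemma bcr_dom u v g : continuous u -> continuous v -> continuous g ->
  generator u v g -> (1 - p0) * u 0 = p0 * v 0 -> bcr u v = 0 -> dom u v g.
Proof.
move=> cu cv cg uv l; rewrite /bcr => /eqP; rewrite addr_eq0 => /eqP H.
by split.
Qed.

Lemma generator_lin (c : R) u1 v1 g1 u2 v2 g2 :
  generator u1 v1 g1 -> generator u2 v2 g2 ->
  generator (fun x => u1 x + c * u2 x) (fun x => v1 x + c * v2 x)
      (fun x => g1 x + c * g2 x).
Proof.
move=> d1 d2 x xr; have [? ?] := d1 x xr; have [? ?] := d2 x xr.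
by split; derivr.
Qed.

Lemma generator_ext u v g1 g2 : (forall x : R, 0 < x < r -> g1 x = g2 x) ->
  generator u v g1 -> generator u v g2.
Proof. by move=> g12 d x xr; have [? ?] := d x xr; split => //; rewrite -g12. Qed.

Lemma dom_ext u v g1 g2 : continuous g2 -> (forall x : R, 0 < x < r -> g1 x = g2 x) ->
  dom u v g1 -> dom u v g2.
Proof.
by move=> c2 g12 [[? ? ?] d l e]; split => //; apply: generator_ext d.
Qed.

Lemma ip_le_sup u (M : R) : continuous u ->
  (forall x : R, 0 <= x <= r -> u x ^+ 2 <= M) -> ip u u <= M * ip (fun=> 1) (fun=> 1).
Proof.
move=> cu uM; rewrite /ip -primZ ?rr//; last by cont.
apply: prim_le => //; [by cont|by cont|move=> x /andP[x0 xr]].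
rewrite -mulrA -expr2 !mulr1 mulrC; apply: ler_wpM2r.
  exact/ltW/wt_gt0.
by apply: uM; rewrite !ltW.
Qed.

Lemma ivp0_bound (q : R) : exists2 C : R, 0 < C & forall f u v,
  continuous f -> continuous u -> continuous v -> u 0 = 0 -> v 0 = 0 ->
  generator u v (fun x => q * u x - f x) ->
  [/\ ip u u <= C * ip f f, u r ^+ 2 <= C * ip f f & v r ^+ 2 <= C * ip f f].
Proof.
have [C1 C10 C1P] := ivp_bound q; have [C2 C20 C2P] := prim_sqr_le_ip S.
pose I1 := ip (fun=> 1) (fun=> 1).
have I10 : 0 <= I1 by apply: ip_ge0; cont.
exists (C1 * C2 * (1 + I1)); first by rewrite !mulr_gt0//; lra.
move=> f u v cf cu cv u00 v00 uv; have f0 := ip_ge0 S cf.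
have X (x : R) : 0 <= x <= r -> u x ^+ 2 + v x ^+ 2 <= C1 * C2 * ip f f.
  move=> xr; apply: le_trans (C1P f u v cf cu cv uv x xr) _.
  by rewrite u00 v00 !expr0n/= !add0r -mulrA ler_pM2l// C2P.
have X0 : 0 <= C1 * C2 * ip f f by rewrite !mulr_ge0// ltW.
have h1 : C1 * C2 * ip f f <= C1 * C2 * (1 + I1) * ip f f.
  by rewrite [leRHS]mulrAC; apply: ler_peMr => //; rewrite lerDl.
split.
- apply: le_trans (_ : C1 * C2 * ip f f * I1 <= _).
    apply: ip_le_sup => // x /X; have := sqr_ge0 (v x); lra.
  by rewrite [leRHS]mulrAC ler_wpM2l//; lra.
- by apply: le_trans h1; have := X r rr; have := sqr_ge0 (v r); lra.
- by apply: le_trans h1; have := X r rr; have := sqr_ge0 (u r); lra.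
Qed.

Lemma resolvent_exists (lam : R) psi vpsi :
  continuous psi -> continuous vpsi ->
  generator psi vpsi (fun x => - lam * psi x) ->
  (1 - p0) * psi 0 = p0 * vpsi 0 -> bcr psi vpsi != 0 ->
  exists2 C : R, 0 < C & forall f, continuous f -> exists u v,
    dom u v (fun x => - lam * u x - f x) /\ ip u u <= C * ip f f.
Proof.
move=> cpsi cvpsi dpsi l bN; have [C C0 CP] := ivp0_bound (- lam).
pose E := expR (- B r); pose ips := ip psi psi.
have ips0 : 0 <= ips by exact: ip_ge0.
have b2 : 0 < bcr psi vpsi ^+ 2 by rewrite lt_neqAle eq_sym sqrf_eq0 bN sqr_ge0.
pose C' := 2 * C + 2 * ips * (2 * (1 + E ^+ 2) * C / bcr psi vpsi ^+ 2).
have E20 : 0 <= E ^+ 2 by exact: sqr_ge0.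
exists C'.
  apply: ltr_pwDl; first by rewrite mulr_gt0.
  apply: mulr_ge0; first by rewrite mulr_ge0.
  apply: divr_ge0 (ltW b2); apply: mulr_ge0 (ltW C0).
  by rewrite mulr_ge0// addr_ge0.
move=> f cf; have f0 := ip_ge0 S cf.
have [u1 [v1 [cu1 cv1 u10 v10 uv1]]] := @ivp_exists (- lam) f 0 0 cf.
have [h1 h2 h3] := CP f u1 v1 cf cu1 cv1 u10 v10 uv1.
pose c := - bcr u1 v1 / bcr psi vpsi.
exists (fun x => u1 x + c * psi x), (fun x => v1 x + c * vpsi x); split.
  apply: bcr_dom; [by cont|by cont|by cont| | |].
  - apply: generator_ext (generator_lin c uv1 dpsi) => x _; ring.
  - by rewrite u10 v10 !add0r mulrCA l; ring.
  - rewrite (_ : bcr _ _ = bcr u1 v1 + c * bcr psi vpsi); last by rewrite /bcr; ring.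
    by rewrite /c; field.
have c2 : c ^+ 2 <= 2 * (1 + E ^+ 2) * C / bcr psi vpsi ^+ 2 * ip f f.
  rewrite /c expr_div_n sqrrN [leRHS]mulrAC ler_pM2r ?invr_gt0//.
  have /andP[pr0 pr1] := sl_pr_itv S.
  apply: le_trans (_ : 2 * (v1 r ^+ 2 + E ^+ 2 * u1 r ^+ 2) <= _).
    have -> : bcr u1 v1 = pr * v1 r + (1 - pr) * (E * u1 r) by rewrite /bcr /E; ring.
    have pr2 : pr ^+ 2 <= 1 by rewrite expr2; nra.
    have pr3 : (1 - pr) ^+ 2 <= 1 by rewrite expr2; nra.
    have := sqr_ge0 (pr * v1 r - (1 - pr) * (E * u1 r)).
    have := ler_wpM2r (sqr_ge0 (v1 r)) pr2.
    have := ler_wpM2r (sqr_ge0 (E * u1 r)) pr3.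
    by rewrite !mul1r => ? ? ?; nra.
  have := ler_wpM2l E20 h2; lra.
have : 0 <= ip (fun x => u1 x + (- c) * psi x) (fun x => u1 x + (- c) * psi x).
  by apply: ip_ge0; cont.
rewrite !ip_sqr// => h4.
have h5 : c ^+ 2 * ips <= 2 * (1 + E ^+ 2) * C / bcr psi vpsi ^+ 2 * ip f f * ips.
  exact: ler_wpM2r.
rewrite -/ips in h4 *; rewrite /C' [leRHS]mulrDl.
have -> : 2 * ips * (2 * (1 + E ^+ 2) * C / bcr psi vpsi ^+ 2) * ip f f =
  2 * (2 * (1 + E ^+ 2) * C / bcr psi vpsi ^+ 2 * ip f f * ips) by ring.
by lra.
Qed.

(* With S(u) := - ip g u - lam * ip u u and - L y - lam y = u, expand S(u - s y) >= 0. *)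
Lemma coercive_of_inverse (lam C : R) u v g y vy : 0 <= C ->
  (forall u v g, dom u v g -> lam * ip u u <= - ip g u) ->
  dom u v g -> dom y vy (fun x => - lam * y x - u x) -> ip y y <= C * ip u u ->
  ip u u <= (1 + C) / 2 * (- ip g u - lam * ip u u).
Proof.
move=> C0 low Du Dy yC; pose C' := (1 + C) / 2.
have C'0 : 0 < C' by rewrite divr_gt0//; lra.
pose s := C'^-1.
have [[cu cv cg] _ _ _] := Du; have [[cy cvy cgy] _ _ _] := Dy.
have := low _ _ _ (dom_lin (- s) Du Dy).
have clam : continuous (fun x => - lam * y x) by cont.
have gyE : (fun x => - lam * y x - u x) = (fun x => - lam * y x + (-1) * u x).
  by apply/funext => x; rewrite mulN1r.
have gy f : continuous f ->
    ip (fun x => - lam * y x - u x) f = - lam * ip y f - ip u f.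
  by move=> cf; rewrite gyE ip_linl// ipZl// mulN1r.
have sym : ip g y = - lam * ip y u - ip u u.
  by rewrite (dom_sym Du Dy) ip_sym gy.
have uy := ip_le_half S cu cy.
rewrite ip_sqr//.
have -> : ip (fun x => g x + - s * (- lam * y x - u x)) (fun x => u x + - s * y x) =
  ip g u + (- s) * ip g y + (- s) * (ip (fun x => - lam * y x - u x) u +
     (- s) * ip (fun x => - lam * y x - u x) y).
  rewrite ip_linl//; last by cont.
  by rewrite !ip_linr.
rewrite !gy// sym (ip_sym _ y u) => H.
have a0 := ip_ge0 S cu.
have s0 : 0 < s by rewrite invr_gt0.
have uyC : ip u y <= C' * ip u u by rewrite /C'; lra.
have h1 : 2 * s * ip u u - s ^+ 2 * ip u y <= - ip g u - lam * ip u u by lra.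
have h2 : s ^+ 2 * ip u y <= s * ip u u.
  rewrite expr2 -mulrA ler_pM2l//.
  by have := ler_wpM2l (ltW s0) uyC; rewrite mulrA mulVf ?gt_eqF// mul1r.
have := ler_wpM2l (ltW C'0) (le_trans (lerB (lexx (2 * s * ip u u)) h2) h1).
have C's : C' * s = 1 by rewrite divff// gt_eqF.
have -> : C' * (2 * s * ip u u - s * ip u u) = C' * s * ip u u by ring.
by rewrite C's mul1r.
Qed.

Lemma eigenpair_neg_trivial (lam : R) psi vpsi : lam < 0 ->
  dom psi vpsi (fun x => - lam * psi x) ->
  forall x : R, 0 <= x <= r -> psi x = 0 /\ vpsi x = 0.
Proof.
move=> lam0 D x xr; have [[c1 c2 c3] _ _ _] := D.
have := dom_energy D; rewrite ipZl// mulNr opprK => h.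
have h1 := ip_ge0 S c1; have h2 := ip_ge0 S c2.
have h3 : lam * ip psi psi <= 0 by rewrite nmulr_rle0.
have v0 : ip vpsi vpsi = 0 by lra.
have : lam * ip psi psi = 0 by lra.
move/eqP; rewrite mulf_eq0 lt_eqF//= => /eqP u0.
by rewrite (ip_eq0 c1 u0 xr) (ip_eq0 c2 v0 xr).
Qed.

Lemma dom_resolvent (lam : R) : lam < 0 -> forall f, continuous f ->
  exists u v, dom u v (fun x => - lam * u x - f x).
Proof.
move=> lam0 f cf.
have [psi [vpsi [c1 c2 e1 e2]]] := @ivp_exists (- lam) (fun=> 0) p0 (1 - p0) ltac:(cont).
move=> /(generator_ext (g2 := fun x => - lam * psi x)) d.
have {}d := d ltac:(by move=> ? _; rewrite subr0).
have l : (1 - p0) * psi 0 = p0 * vpsi 0 by rewrite e1 e2 mulrC.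
have [b0|bN] := eqVneq (bcr psi vpsi) 0; last first.
  have [C _ /(_ f cf)[u [v [D _]]]] := resolvent_exists c1 c2 d l bN.
  by exists u, v.
have D : dom psi vpsi (fun x => - lam * psi x) by apply: bcr_dom => //; cont.
have [|] := @eigenpair_neg_trivial _ _ _ lam0 D 0; first by rewrite lexx ltW.
by rewrite e1 e2; lra.
Qed.

Lemma dom_nontrivial : exists u v g, dom u v g /\ 0 < ip u u.
Proof.
have [u [v D]] := @dom_resolvent (-1) ltac:(lra) (fun=> 1) ltac:(cont).
have [[cu _ _] _ _ _] := D.
exists u, v, (fun x => - (-1) * u x - 1); split => //.
rewrite lt_neqAle ip_ge0// andbT; apply/eqP => u0.
have uz (x : R) : 0 <= x <= r -> u x = 0 by exact: ip_eq0 (esym u0).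
have rp := sl_r_gt0 S; have mid : 0 < r / 2 < r by apply/andP; split; lra.
have [_] := generator_zero (dom_generator D) uz mid.
by rewrite uz ?mulr0; [lra|apply/andP; split; lra].
Qed.

Lemma eigenpair_norm_gt0 (lam : R) h vh : dom h vh (fun x => - lam * h x) ->
  h 0 = p0 -> vh 0 = 1 - p0 -> 0 < ip h h.
Proof.
move=> Dh e1 e2; have [[ch cvh _] _ _ _] := Dh.
rewrite lt_neqAle ip_ge0// andbT; apply/eqP => h0.
have hz (x : R) : 0 <= x <= r -> h x = 0 by exact: ip_eq0 (esym h0).
have h00 : h 0 = 0 by apply: hz; rewrite lexx ltW.
have := dom_energy Dh; rewrite ipZl// -h0 mulr0 oppr0 => vv.
have vh0 : ip vh vh = 0 by have := ip_ge0 S cvh; lra.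
have := ip_eq0 cvh vh0 (x := 0); rewrite e2 lexx ltW// => /(_ isT).
by move: h00; rewrite e1; lra.
Qed.

(* lam0 is the infimum of the Rayleigh quotient.  Were the shooting solution
   at lam0 to miss the boundary condition at r, then - L - lam0 would have a
   bounded inverse and the quotient would stay away from lam0. *)
Theorem principal_eigenpair : exists lam0 gam h vh,
  [/\ 0 <= lam0 /\ 0 < gam, dom h vh (fun x => - lam0 * h x),
      [/\ h 0 = p0, vh 0 = 1 - p0 & 0 < ip h h],
      (forall u v g, dom u v g -> lam0 * ip u u <= - ip g u) &
      (forall u v g, dom u v g -> ip u h = 0 ->
         gam * ip u u <= - ip g u - lam0 * ip u u)].
Proof.
pose A : set R := [set q | exists u v g,
  [/\ dom u v g, 0 < ip u u & q = - ip g u / ip u u]].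
have Age0 q : A q -> 0 <= q.
  move=> [u [v [g [D u0 ->]]]]; apply: divr_ge0 (ltW u0).
  apply: le_trans (dom_energy D); rewrite mulr_ge0// ip_ge0//.
  by have [[]] := D.
have hA : has_inf A.
  split; last by exists 0 => q /Age0.
  have [u [v [g [D u0]]]] := dom_nontrivial.
  by exists (- ip g u / ip u u), u, v, g.
pose lam0 := inf A.
have lam00 : 0 <= lam0 by apply: lb_le_inf; [case: hA|move=> q /Age0].
have low u v g : dom u v g -> lam0 * ip u u <= - ip g u.
  move=> D; have [[cu cv _] _ _ _] := D.
  have [u0|u0] := eqVneq (ip u u) 0.
    rewrite u0 mulr0; apply: le_trans (dom_energy D).
    by rewrite mulr_ge0// ip_ge0.
  have uP : 0 < ip u u by rewrite lt_neqAle eq_sym u0 ip_ge0.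
  rewrite -ler_pdivlMr//; apply: ge_inf; first by case: hA.
  by exists u, v, g.
have [h [vh [ch cvh e1 e2]]] := @ivp_exists (- lam0) (fun=> 0) p0 (1 - p0) ltac:(cont).
move=> /(generator_ext (g2 := fun x => - lam0 * h x)) dh.
have {}dh := dh ltac:(by move=> ? _; rewrite subr0).
have l : (1 - p0) * h 0 = p0 * vh 0 by rewrite e1 e2 mulrC.
have bh : bcr h vh = 0.
  apply/eqP/negPn/negP => bN.
  have [C C0 CP] := resolvent_exists ch cvh dh l bN.
  pose C' := (1 + C) / 2; have C'0 : 0 < C' by rewrite divr_gt0//; lra.
  suff : lam0 + C'^-1 <= lam0 by rewrite gerDl leNgt invr_gt0 C'0.
  apply: lb_le_inf; first by case: hA.
  move=> _ [u [v [g [D u0 ->]]]].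
  have [[cu _ _] _ _ _] := D.
  have [y [vy [Dy yC]]] := CP u cu.
  have H := coercive_of_inverse (ltW C0) low D Dy yC.
  rewrite ler_pdivlMr// mulrDl.
  have : C'^-1 * ip u u <= - ip g u - lam0 * ip u u by rewrite mulrC ler_pdivrMr// mulrC.
  by lra.
have Dh : dom h vh (fun x => - lam0 * h x) by apply: bcr_dom => //; cont.
have hN : 0 < ip h h := eigenpair_norm_gt0 Dh e1 e2.
have [C C0 CP] := ivp0_bound (- lam0).
pose C' := (1 + C) / 2; have C'0 : 0 < C' by rewrite divr_gt0//; lra.
exists lam0, C'^-1, h, vh; split => //; first by rewrite invr_gt0.
have wron f y vy : continuous f -> continuous y -> continuous vy ->
    y 0 = 0 -> vy 0 = 0 -> generator y vy (fun x => - lam0 * y x - f x) ->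
    - ip f h = p r * (vy r * h r - y r * vh r).
  move=> cf cy cvy y0 vy0 dy.
  have cg : continuous (fun x => - lam0 * y x - f x) by cont.
  have ch' : continuous (fun x => - lam0 * h x) by cont.
  have := @green _ S y vy _ h vh _ cy cvy cg ch cvh ch' dy dh.
  rewrite y0 vy0 !mul0r subrr subr0 => <-.
  rewrite (_ : (fun x => - lam0 * y x - f x) = (fun x => - lam0 * y x + (-1) * f x)); last first.
    by apply/funext => x; rewrite mulN1r.
  have ? : continuous (fun x => - lam0 * y x) by cont.
  have -> : ip y (fun x => - lam0 * h x) = - lam0 * ip y h.
    by rewrite ip_sym ipZl// (ip_sym _ h).
  by rewrite ip_linl// !ipZl//; ring.
have nz : ~ (h r = 0 /\ vh r = 0).
  move=> [hr vhr].
  have [y [vy [cy cvy y0 vy0 dy]]] := @ivp_exists (- lam0) h 0 0 ch.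
  have := wron h y vy ch cy cvy y0 vy0 dy.
  by rewrite hr vhr !mulr0 subrr mulr0; lra.
move=> u v g D uh; have [[cu _ _] _ _ _] := D.
have [y [vy [cy cvy y0 vy0 dy]]] := @ivp_exists (- lam0) u 0 0 cu.
have W : vy r * h r = y r * vh r.
  have := wron u y vy cu cy cvy y0 vy0 dy.
  rewrite uh oppr0 => /esym/eqP; rewrite mulf_eq0 gt_eqF ?wt_gt0//= subr_eq0.
  by move/eqP.
have Dy : dom y vy (fun x => - lam0 * y x - u x).
  apply: bcr_dom => //; [by cont|by rewrite y0 vy0 !mulr0|].
  have E0 := expR_gt0 (- B r).
  have [prE|prN] := eqVneq pr 0.
    move: bh; rewrite /bcr prE !mul0r !add0r subr0 !mul1r => /eqP.
    rewrite mulf_eq0 gt_eqF//= => /eqP hr.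
    move: W; rewrite hr mulr0 => /esym/eqP; rewrite mulf_eq0 => /orP[/eqP ->|/eqP vhr].
      by rewrite mulr0.
    by case: nz.
  have vhE : pr * vh r = - ((1 - pr) * expR (- B r) * h r).
    by move: bh; rewrite /bcr => /eqP; rewrite addr_eq0 => /eqP.
  have hr : h r != 0.
    apply/eqP => hr; apply: nz; split => //; apply: (mulfI prN).
    by rewrite vhE hr !mulr0 oppr0.
  apply: (mulIf hr); rewrite /bcr mul0r mulrDl -[pr * _ * _]mulrA W mulrCA vhE.
  by ring.
have [yC _ _] := CP u y vy cu cy cvy y0 vy0 dy.
have := coercive_of_inverse (ltW C0) low D Dy yC.
by rewrite [_^-1 * _]mulrC ler_pdivrMr// [X in _ <= X]mulrC.
Qed.

End spectrum.

Section implicit_euler.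
Context {R : realType} (S : sl_data R).
Notation r := (sl_r S).
Notation ip := (ip S).
Notation dom := (dom S).
Let r0 : 0 < r := sl_r_gt0 S.
Let rr : 0 <= r <= r. Proof. by rewrite lexx ltW. Qed.
Let cp := @wt_continuous _ S.
Implicit Types f g u v : R -> R.

Lemma dom_sup : exists2 C : R, 0 < C & forall u v g, dom u v g ->
  forall x : R, 0 <= x <= r -> u x ^+ 2 <= C * (ip u u - ip g u).
Proof.
have [C C0 CP] := sobolev S; exists C => // u v g D x xr.
have [[cu cv _] d _ _] := D.
have h := CP u v cu cv (fun t tr => (d t tr).1) x xr.
apply: le_trans h _; rewrite ler_pM2l// lerD2l.
by have := dom_energy D; have := ip_ge0 S cv; lra.
Qed.

Section one_step.
Variables (lam tau : R).
Hypotheses (lam0 : 0 <= lam) (tau0 : 0 < tau).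
Hypothesis low : forall u v g, dom u v g -> lam * ip u u <= - ip g u.
Let a := 1 + tau * lam.
Let a0 : 0 < a. Proof. by rewrite ltr_pwDl// mulr_ge0// ltW. Qed.

Definition energy u g : R := - ip g u - lam * ip u u.

Lemma energy_ge0 u v g : dom u v g -> 0 <= energy u g.
Proof. by move=> /low; rewrite /energy subr_ge0. Qed.

Lemma energy_sqr (c : R) u v g u' v' g' : dom u v g -> dom u' v' g' ->
  energy (fun x => u x + c * u' x) (fun x => g x + c * g' x) =
  energy u g + 2 * c * (- ip g u' - lam * ip u u') + c ^+ 2 * energy u' g'.
Proof.
move=> D D'; have [[cu _ cg] _ _ _] := D; have [[cu' _ cg'] _ _ _] := D'.
have cs : continuous (fun x => u x + c * u' x) by cont.
rewrite /energy ip_sqr// ip_linl// !ip_linr// (dom_sym D' D) (ip_sym _ u' g).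
by ring.
Qed.

Lemma euler_step_norm f u v : continuous f ->
  dom u v (fun x => (u x - f x) / tau) ->
  a ^+ 2 * ip u u + 2 * a * tau * energy u (fun x => (u x - f x) / tau) <= ip f f.
Proof.
move=> cf D; have [[cu _ cg] _ _ _] := D.
set g := (fun x => (u x - f x) / tau) in D cg *.
pose w x := - g x - lam * u x.
have cw : continuous w by rewrite /w; cont.
have fE : f = (fun x => a * u x + tau * w x).
  by apply/funext => x; rewrite /w /g /a; field; rewrite gt_eqF.
have cau : continuous (fun x => a * u x) by cont.
rewrite {1 2}fE ip_sqr// ipZl// ipZl// (ip_sym _ u (fun x => a * u x)) ipZl//.
have wE : ip u w = energy u g.
  rewrite ip_sym /energy /w.
  rewrite (_ : (fun x => - g x - lam * u x) = (fun x => -1 * g x + (- lam) * u x)).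
    by rewrite ip_linl//; [rewrite ipZl//; ring|cont].
  by apply/funext => x; ring.
rewrite wE; have := ip_ge0 S cw => w0.
have : 0 <= tau ^+ 2 * ip w w by rewrite mulr_ge0// sqr_ge0.
by lra.
Qed.

Lemma euler_step_energy f vf gf u v : dom f vf gf ->
  dom u v (fun x => (u x - f x) / tau) ->
  a ^+ 2 * energy u (fun x => (u x - f x) / tau) <= energy f gf.
Proof.
move=> Df D; have [[cu _ cg] _ _ _] := D; have [[cf _ cgf] _ _ _] := Df.
set g := (fun x => (u x - f x) / tau) in D cg *.
pose d x := f x + (- a) * u x.
have Dd := dom_lin (- a) Df D.
have := energy_ge0 Dd; rewrite (energy_sqr (- a) Df D).
have key : - ip gf u - lam * ip f u = a * energy u g + tau * ip (fun x => - g x - lam * u x) (fun x => - g x - lam * u x).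
  rewrite (dom_sym Df D) -/g.
  have cw : continuous (fun x => - g x - lam * u x) by cont.
  have fE : f = (fun x => a * u x + tau * (- g x - lam * u x)).
    by apply/funext => x; rewrite /g /a; field; rewrite gt_eqF.
  have cau : continuous (fun x => a * u x) by cont.
  have wE h : continuous h ->
      ip (fun x => - g x - lam * u x) h = - ip g h - lam * ip u h.
    move=> ch.
    rewrite (_ : (fun x => - g x - lam * u x) = (fun x => -1 * g x + (- lam) * u x)).
      by rewrite ip_linl//; [rewrite ipZl//; ring|cont].
    by apply/funext => x; ring.
  have <- : ip (fun x => - g x - lam * u x) f = - ip f g - lam * ip f u.
    by rewrite wE// (ip_sym _ f g) (ip_sym _ f u).
  rewrite {1}fE ip_linr// (ip_sym _ _ (fun x => a * u x)) ipZl// (ip_sym _ u).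
  by rewrite wE.
have w0 : 0 <= ip (fun x => - g x - lam * u x) (fun x => - g x - lam * u x).
  by apply: ip_ge0; cont.
rewrite key => H; have at0 := mulr_ge0 (ltW a0) (mulr_ge0 (ltW tau0) w0).
lra.
Qed.

End one_step.

Definition chain (tau : R) (z : nat -> R -> R) : Prop :=
  (forall n, continuous (z n)) /\
  forall n, exists v, dom (z n.+1) v (fun x => (z n.+1 x - z n x) / tau).

Definition euler (tau : R) f : R -> R :=
  xget f [set u | exists v, dom u v (fun x => (u x - f x) / tau)].

Lemma eulerP (tau : R) f : 0 < tau -> continuous f ->
  exists v, dom (euler tau f) v (fun x => (euler tau f x - f x) / tau).
Proof.
move=> tau0 cf; rewrite /euler; case: xgetP => [u -> //|none].
have cf' : continuous (fun x => tau^-1 * f x) by cont.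
have [|u [v D]] := @dom_resolvent _ S (- tau^-1) _ _ cf'.
  by rewrite oppr_lt0 invr_gt0.
have [[cu _ _] _ _ _] := D; case: (none u); exists v.
by apply: dom_ext D; [cont|move=> x _; ring].
Qed.

Lemma chain_iter (tau : R) f : 0 < tau -> continuous f ->
  chain tau (fun n => iter n (euler tau) f).
Proof.
move=> tau0 cf; have c n : continuous (iter n (euler tau) f).
  by elim: n => // n IH; have [v [[]]] := eulerP tau0 IH.
by split => // n; have [v D] := eulerP tau0 (c n); exists v.
Qed.

Lemma dom_diff (tau : R) u v g u' v' g' : dom u v g -> dom u' v' g' ->
  exists w, dom (fun x => (u x - u' x) / tau) w (fun x => (g x - g' x) / tau).
Proof.
move=> D D'; have := dom_scale tau^-1 (dom_lin (-1) D D').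
have E f g0 : (fun x => tau^-1 * (f x + -1 * g0 x)) = (fun x => (f x - g0 x) / tau).
  by apply/funext => x; ring.
by rewrite !E => DD; eexists; exact: DD.
Qed.

Definition dchain (tau : R) g0 (z : nat -> R -> R) n : R -> R :=
  if n is m.+1 then (fun x => (z m.+1 x - z m x) / tau) else g0.

Lemma dchain_dom (tau : R) v0 g0 z : chain tau z -> dom (z 0%N) v0 g0 ->
  forall n, exists v, dom (z n) v (dchain tau g0 z n).
Proof. by move=> [_ H] D [|n] /=; [exists v0|exact: H]. Qed.

Lemma dchain_chain (tau : R) v0 g0 v1 g1 z : chain tau z ->
  dom (z 0%N) v0 g0 -> dom g0 v1 g1 -> chain tau (dchain tau g0 z).
Proof.
move=> cz D0 D1; have [c H] := cz; split.
  move=> [|n] /=; first by have [[]] := D1.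
  by have [v [[]]] := H n.
move=> n; have [v D] := dchain_dom cz D0 n.
have [v' D'] := H n; exact: dom_diff D' D.
Qed.

Lemma dom_low0 u v g : dom u v g -> 0 * ip u u <= - ip g u.
Proof.
move=> D; rewrite mul0r; apply: le_trans (dom_energy D).
by rewrite mulr_ge0// ip_ge0//; have [[]] := D.
Qed.

Lemma chain_bounded f v0 g0 : dom f v0 g0 -> exists2 M : R, 0 <= M &
  forall tau z, 0 < tau -> chain tau z -> z 0%N = f ->
  forall n (x : R), 0 <= x <= r -> `|z n x| <= M.
Proof.
move=> D0; have [C C0 CP] := dom_sup.
pose Q0 := ip f f + energy 0 f g0.
exists (Num.sqrt (C * Q0)); first exact: sqrtr_ge0.
move=> tau z tau0 [cz zS] z0.
have Q n : exists v g, dom (z n) v g /\ ip (z n) (z n) + energy 0 (z n) g <= Q0.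
  elim: n => [|n [v [g [D H]]]]; first by exists v0, g0; rewrite z0.
  have [v' D'] := zS n; exists v', (fun x => (z n.+1 x - z n x) / tau); split => //.
  have h1 := @euler_step_norm 0 tau tau0 _ _ _ (cz n) D'.
  have h2 := @euler_step_energy 0 tau (lexx 0) tau0 dom_low0 _ _ _ _ _ D D'.
  have h3 := energy_ge0 dom_low0 D'.
  rewrite mulr0 addr0 expr1n !mul1r mulr1 in h1 h2.
  have h4 := mulr_ge0 (mulr_ge0 (ler0n R 2) (ltW tau0)) h3.
  by lra.
move=> n x xr; have [v [g [D H]]] := Q n.
rewrite -(sqrtr_sqr (z n x)) ler_wsqrtr//.
apply: le_trans (CP _ _ _ D x xr) _; rewrite ler_pM2l//.
by move: H; rewrite /energy mul0r subr0.
Qed.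

Lemma chain_decay (lam tau : R) z : 0 <= lam -> 0 < tau ->
  (forall u v g, dom u v g -> lam * ip u u <= - ip g u) -> chain tau z ->
  forall n, exists2 v, dom (z n.+1) v (fun x => (z n.+1 x - z n x) / tau) &
  let a := 1 + tau * lam in
  (a ^+ 2) ^+ n.+1 * (ip (z n.+1) (z n.+1) + 2 * (tau / a) * n.+1%:R *
     energy lam (z n.+1) (fun x => (z n.+1 x - z n x) / tau)) <=
  ip (z 0%N) (z 0%N).
Proof.
move=> lam0 tau0 low [cz zS] n; set a := 1 + tau * lam.
have a0 : 0 < a by rewrite ltr_pwDl// mulr_ge0// ltW.
have aN : a != 0 by rewrite gt_eqF.
elim: n => [|n [v D IH]].
  have [v D] := zS 0%N; exists v => //=.
  have := @euler_step_norm lam tau tau0 _ _ _ (cz 0%N) D; rewrite -/a.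
  set e := energy _ _ _; set i := ip _ _; move=> h.
  rewrite (_ : _ * _ = a ^+ 2 * i + 2 * a * tau * e)//.
  by rewrite expr1; field.
have [v' D'] := zS n.+1; exists v' => //=; rewrite /= in IH.
have := @euler_step_norm lam tau tau0 _ _ _ (cz n.+1) D'; rewrite -/a.
have := euler_step_energy lam0 tau0 low D D'; rewrite -/a.
set e' := energy lam (z n.+2) _; set i' := ip (z n.+2) _.
set e := energy lam (z n.+1) _ in IH *; set i := ip (z n.+1) _ in IH *.
move=> h1 h2; apply: le_trans IH.
rewrite [_ ^+ n.+2]exprSr -mulrA; apply: ler_wpM2l; first by rewrite !exprn_ge0// ltW.
have -> : a ^+ 2 * (i' + 2 * (tau / a) * n.+2%:R * e') =
  a ^+ 2 * i' + 2 * a * tau * e' + 2 * (tau / a) * n.+1%:R * (a ^+ 2 * e').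
  by rewrite -[n.+2%:R]natr1; field.
have k0 : 0 <= 2 * (tau / a) * n.+1%:R by rewrite mulr_ge0// mulr_ge0// divr_ge0// ltW.
by have := ler_wpM2l k0 h1; lra.
Qed.

Section convergence.
Variables (lam gam : R) (h vh : R -> R).
Hypotheses (lam0 : 0 <= lam) (gam0 : 0 < gam).
Hypothesis low : forall u v g, dom u v g -> lam * ip u u <= - ip g u.
Hypothesis Dh : dom h vh (fun x => - lam * h x).
Hypothesis hh : 0 < ip h h.
Hypothesis gap : forall u v g, dom u v g -> ip u h = 0 ->
  gam * ip u u <= - ip g u - lam * ip u u.
Let ch : continuous h. Proof. by have [[]] := Dh. Qed.

Definition coef f : R := ip f h / ip h h.

Lemma ortho_chain (tau : R) z : 0 < tau -> chain tau z -> ip (z 0%N) h = 0 ->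
  forall n, ip (z n) h = 0.
Proof.
move=> tau0 [cz zS] z0; elim=> // n IH; have [v D] := zS n.
have [[cu _ cg] _ _ _] := D; have cn := cz n.
have a0 : 0 < 1 + tau * lam by rewrite ltr_pwDl// mulr_ge0// ltW.
have := dom_sym D Dh; rewrite (ip_sym _ (z n.+1)) ipZl// (ip_sym _ h).
rewrite (_ : (fun x => (z n.+1 x - z n x) / tau) =
  (fun x => tau^-1 * z n.+1 x + (- tau^-1) * z n x)); last first.
  by apply/funext => x; ring.
have c1 : continuous (fun x => tau^-1 * z n.+1 x) by cont.
rewrite ip_linl// ipZl// IH mulr0 addr0 => E.
apply: (mulfI (lt0r_neq0 a0)); rewrite mulr0.
have : tau * (tau^-1 * ip (z n.+1) h) = tau * (- lam * ip (z n.+1) h) by rewrite E.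
by rewrite mulrA mulfV ?gt_eqF// mul1r; lra.
Qed.

Lemma chain_ortho_sup : exists2 C : R, 0 < C &
  forall tau z, 0 < tau -> chain tau z -> ip (z 0%N) h = 0 ->
  forall n (x : R), 0 <= x <= r ->
  ((1 + tau * lam) ^+ n.+1 * z n.+1 x) ^+ 2 <=
    C * ip (z 0%N) (z 0%N) * (1 + tau * lam) / (tau * n.+1%:R).
Proof.
have [C C0 CP] := dom_sup; pose C' := C * (gam^-1 + 1 + lam / gam).
have c0 : 0 < gam^-1 + 1 + lam / gam.
  by rewrite ltr_wpDr ?divr_ge0// ?(ltW gam0)// addr_gt0// invr_gt0.
have C'0 : 0 < C' by rewrite mulr_gt0.
exists C' => // tau z tau0 cz z0 n x xr.
have [v D /=] := chain_decay lam0 tau0 low cz n.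
set a := 1 + tau * lam; set g := (fun x => _) in D *.
have a0 : 0 < a by rewrite ltr_pwDl// mulr_ge0// ltW.
have on := ortho_chain tau0 cz z0 n.+1.
have h1 := gap D on; rewrite -/(energy lam _ _) in h1.
have [[cu _ _] _ _ _] := D.
set e := energy lam (z n.+1) g in h1 *; set i := ip (z n.+1) (z n.+1) in h1 *.
have i0 : 0 <= i by exact: ip_ge0.
have e0 : 0 <= e by apply: le_trans h1; rewrite mulr_ge0// ltW.
move=> H.
have k0 : 0 < tau / a * n.+1%:R by rewrite mulr_gt0// divr_gt0.
have {}H : (a ^+ 2) ^+ n.+1 * e <= ip (z 0%N) (z 0%N) * a / (tau * n.+1%:R).
  rewrite ler_pdivlMr ?mulr_gt0//.
  have -> : (a ^+ 2) ^+ n.+1 * e * (tau * n.+1%:R) =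
    (a ^+ 2) ^+ n.+1 * (tau / a * n.+1%:R * e) * a by field; rewrite gt_eqF.
  rewrite ler_pM2r//; apply: le_trans H.
  apply: ler_wpM2l; first by rewrite !exprn_ge0// ltW.
  have : 0 <= tau / a * n.+1%:R * e by rewrite mulr_ge0// ltW.
  by rewrite [X in _ <= _ + X](_ : _ = 2 * (tau / a * n.+1%:R * e)); [lra|ring].
have sup : z n.+1 x ^+ 2 <= C' * e.
  apply: le_trans (CP _ _ _ D x xr) _; rewrite /C' -mulrA ler_pM2l//.
  have -> : i - ip g (z n.+1) = e + (1 + lam) * i by rewrite /e /energy /i; ring.
  have ie : i <= e / gam by rewrite ler_pdivlMr// mulrC.
  have l1 : 0 <= 1 + lam by rewrite addr_ge0.
  have := ler_wpM2l l1 ie.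
  rewrite (_ : (gam^-1 + 1 + lam / gam) * e = e + (1 + lam) * (e / gam)); last by ring.
  by lra.
rewrite exprMn -exprM mulnC exprM.
have A0 : 0 <= (a ^+ 2) ^+ n.+1 by rewrite !exprn_ge0// ltW.
apply: le_trans (ler_wpM2l A0 sup) _; rewrite mulrCA.
by apply: le_trans (ler_wpM2l (ltW C'0) H) _; rewrite !mulrA.
Qed.

Lemma coef_sqr_le f : continuous f ->
  ip (fun x => f x + - coef f * h x) h = 0 /\
  ip (fun x => f x + - coef f * h x) (fun x => f x + - coef f * h x) <= ip f f.
Proof.
move=> cf; have hN : ip h h != 0 by rewrite gt_eqF.
split; first by rewrite ip_linl// /coef; field.
rewrite ip_sqr//.
have -> : ip f f + 2 * - coef f * ip f h + (- coef f) ^+ 2 * ip h h =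
  ip f f - (coef f) ^+ 2 * ip h h by rewrite /coef; field.
by rewrite gerBl mulr_ge0 ?sqr_ge0// ltW.
Qed.

Lemma euler_converges : exists2 C : R, 0 < C &
  forall tau z, 0 < tau -> chain tau z -> forall n (x : R), 0 <= x <= r ->
  ((1 + tau * lam) ^+ n.+1 * z n.+1 x - coef (z 0%N) * h x) ^+ 2 <=
    C * ip (z 0%N) (z 0%N) * (1 + tau * lam) / (tau * n.+1%:R).
Proof.
have [C C0 CP] := chain_ortho_sup; exists C => // tau z tau0 cz n x xr.
have [czn zS] := cz.
set a := 1 + tau * lam; set c := coef (z 0%N).
have a0 : 0 < a by rewrite ltr_pwDl// mulr_ge0// ltW.
have aN : a != 0 by rewrite gt_eqF.
pose w k x := z k x + - (c / a ^+ k) * h x.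
have cw : chain tau w.
  split; first by move=> k; have ? := czn k; rewrite /w; cont.
  move=> k; have [v D] := zS k; eexists.
  apply: dom_ext (dom_lin (- (c / a ^+ k.+1)) D Dh).
    by have ? := czn k; have ? := czn k.+1; rewrite /w; cont.
  move=> y _; rewrite /w exprS /a; field.
  by rewrite expf_neq0 gt_eqF.
have w0E : w 0%N = (fun x => z 0%N x + - c * h x).
  by apply/funext => y; rewrite /w expr0 divr1.
have [q1 q2] := coef_sqr_le (czn 0%N); rewrite -/c -w0E in q1 q2.
have := CP tau w tau0 cw q1 n x xr; rewrite -/a.
have -> : a ^+ n.+1 * w n.+1 x = a ^+ n.+1 * z n.+1 x - c * h x.
  by rewrite /w; field; rewrite expf_neq0.
move=> /le_trans; apply; rewrite -!mulrA ler_pM2l// ler_wpM2r//.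
by rewrite divr_ge0 ?mulr_ge0// ltW.
Qed.

End convergence.

End implicit_euler.

Section limits.
Context {R : realType}.

Lemma expR_compound (x : R) (n : nat) : 0 <= x ->
  (1 + x / n.+1%:R) ^+ n.+1 <= expR x /\
  expR x - (1 + x / n.+1%:R) ^+ n.+1 <= expR x * x ^+ 2 / n.+1%:R.
Proof.
move=> x0; set N : R := n.+1%:R; have N0 : 0 < N by rewrite ltr0n.
set y := x / N; have y0 : 0 <= y by rewrite divr_ge0// ltW.
have Ny : N * y = x by rewrite /y mulrC divfK// gt_eqF.
have pw (z : R) : expR z ^+ n.+1 = expR (N * z) by rewrite -expRM_natl.
split.
  by rewrite -[X in expR X]Ny -pw ler_pXn2r ?nnegrE ?expR_ge0 ?expR_ge1Dx// addr_ge0.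
have h1 : expR (y - y ^+ 2) <= 1 + y.
  apply: le_trans (_ : expR (y / (1 + y)) <= _).
    rewrite ler_expR ler_pdivlMr; last by lra.
    have : 0 <= y ^+ 3 by rewrite exprn_ge0.
    by rewrite !exprS expr0; lra.
  have := expR_ge1Dx (- (y / (1 + y))).
  rewrite expRN => H.
  rewrite -lef_pV2 ?posrE ?expR_gt0//; last by lra.
  by apply: le_trans H; rewrite le_eqVlt; apply/orP; left; apply/eqP; field; rewrite gt_eqF//; lra.
have h2 : expR (x - x ^+ 2 / N) <= (1 + y) ^+ n.+1.
  have -> : x - x ^+ 2 / N = N * (y - y ^+ 2).
    by rewrite /y; field; rewrite gt_eqF.
  by rewrite -pw ler_pXn2r ?nnegrE ?expR_ge0// addr_ge0.
have h3 := expR_ge1Dx (- (x ^+ 2 / N)).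
have h4 := ler_wpM2l (expR_ge0 x) h3; rewrite -expRD mulrBr mulr1 in h4.
by rewrite -[leRHS]mulrA lerBlDr -lerBlDl (le_trans h4).
Qed.

Lemma le_of_harmonic (X C D : R) (N : nat) :
  (forall n, (N <= n)%N -> X <= C / n.+1%:R + D) -> X <= D.
Proof.
move=> H; rewrite leNgt; apply/negP => DX.
have XD : 0 < X - D by rewrite subr_gt0.
pose n := maxn N (Num.truncn (`|C| / (X - D))).
have := H n (leq_maxl _ _); apply/negP; rewrite -ltNge -ltrBrDr.
rewrite ltr_pdivrMr ?ltr0n// mulrC -ltr_pdivrMr//.
apply: le_lt_trans (_ : `|C| / (X - D) < _).
  by rewrite ler_pM2r ?invr_gt0// ler_norm.
apply: lt_le_trans (truncnS_gt _) _.
by rewrite ler_nat ltnS leq_maxr.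
Qed.

End limits.

Section chernoff.
Context {R : realType} (S : sl_data R).
Notation r := (sl_r S).
Notation prim := (prim r).
Notation p := (wt S).
Notation ip := (ip S).
Notation dom := (dom S).
Let r0 : 0 < r := sl_r_gt0 S.
Let rr : 0 <= r <= r. Proof. by rewrite lexx ltW. Qed.
Let cp := @wt_continuous _ S.
Implicit Types f g u v : R -> R.

(* What is used of f |-> E_x [f (X_t)]: the last item is Dynkin's formula for
   u and for g = L u, with k = L g. *)
Definition dynkin_functional (x : R) (Phi : R -> (R -> R) -> R) : Prop :=
  [/\ forall t (c : R) f g, 0 <= t -> continuous f -> continuous g ->
        Phi t (fun y => f y + c * g y) = Phi t f + c * Phi t g,
      forall t f (M : R), 0 <= t -> continuous f ->
        (forall y : R, 0 <= y <= r -> `|f y| <= M) -> `|Phi t f| <= M,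
      forall f, continuous f -> Phi 0 f = f x &
      forall t tau u v g w k (M : R), 0 <= t -> 0 < tau ->
        dom u v g -> dom g w k -> (forall y : R, 0 <= y <= r -> `|k y| <= M) ->
        `|Phi (t + tau) u - Phi t u - tau * Phi (t + tau) g| <= tau ^+ 2 * M].

Variables (x : R) (Phi : R -> (R -> R) -> R).
Hypotheses (xr : 0 <= x <= r) (PhiP : dynkin_functional x Phi).

Lemma chernoff f0 v0 f1 v1 f2 v2 f3 :
  dom f0 v0 f1 -> dom f1 v1 f2 -> dom f2 v2 f3 ->
  exists2 M : R, 0 <= M & forall tau z, 0 < tau -> chain S tau z -> z 0%N = f0 ->
  forall n, `|z n x - Phi (tau * n%:R) f0| <= n%:R * (tau ^+ 2 * M).
Proof.
move=> D0 D1 D2; have [M M0 MP] := chain_bounded D2; exists M => // tau z tau0 cz z0 n.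
have [lin _ at0 step] := PhiP; have [czn zS] := cz.
have Dz0 : dom (z 0%N) v0 f1 by rewrite z0.
pose z1 := dchain tau f1 z; have cz1 : chain S tau z1 := dchain_chain cz Dz0 D1.
pose z2 := dchain tau f2 z1; have cz2 : chain S tau z2 := @dchain_chain _ _ _ _ _ _ _ z1 cz1 D1 D2.
have dz := dchain_dom cz Dz0; have dz1 := @dchain_dom _ _ _ _ _ z1 cz1 D1.
have key k j : `|z (j + k)%N x - Phi (tau * k%:R) (z j)| <= k%:R * (tau ^+ 2 * M).
  elim: k j => [|k IH] j; first by rewrite addn0 mulr0 at0// subrr normr0 mul0r.
  have tk0 : 0 <= tau * k%:R by rewrite mulr_ge0// ltW.
  have tkE : tau * k.+1%:R = tau * k%:R + tau by rewrite -natr1; ring.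
  have [v Dv] := dz j.+1; have [w Dw] := dz1 j.+1.
  have := step _ _ _ _ _ _ _ M tk0 tau0 Dv Dw (MP tau z2 tau0 cz2 erefl j.+1).
  have [[cv _ cg] _ _ _] := Dv.
  have -> : Phi (tau * k.+1%:R) (z j) =
      Phi (tau * k%:R + tau) (z j.+1) - tau * Phi (tau * k%:R + tau) (z1 j.+1).
    rewrite -mulNr -lin//; last by rewrite addr_ge0// ltW.
    rewrite tkE; congr (Phi _ _); apply/funext => y.
    by rewrite /z1/=; field; rewrite gt_eqF.
  have := IH j.+1; rewrite addSnnS -natr1 mulrDl mul1r.
  set A := z _ x; set B' := Phi (tau * k%:R) _ => h1 h2.
  rewrite -(subrKA B'); apply: le_trans (ler_normD _ _) _.
  by apply: lerD => //; rewrite distrC [_ - _ - B']addrAC.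
by have := key n 0%N; rewrite add0n z0.
Qed.

Section rate.
Variables (lam gam : R) (h vh : R -> R).
Hypotheses (lam0 : 0 <= lam) (gam0 : 0 < gam).
Hypothesis low : forall u v g, dom u v g -> lam * ip u u <= - ip g u.
Hypothesis Dh : dom h vh (fun x => - lam * h x).
Hypothesis hh : 0 < ip h h.
Hypothesis gap : forall u v g, dom u v g -> ip u h = 0 ->
  gam * ip u u <= - ip g u - lam * ip u u.
Variable C : R.
Hypothesis C0 : 0 < C.
Hypothesis CP : forall tau z, 0 < tau -> chain S tau z ->
  forall n (x : R), 0 <= x <= r ->
  ((1 + tau * lam) ^+ n.+1 * z n.+1 x - coef S h (z 0%N) * h x) ^+ 2 <=
    C * ip (z 0%N) (z 0%N) * (1 + tau * lam) / (tau * n.+1%:R).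
Let ch : continuous h. Proof. by have [[]] := Dh. Qed.

Lemma semigroup_rate_dom3 (t : R) f0 v0 f1 v1 f2 v2 f3 : 0 < t ->
  dom f0 v0 f1 -> dom f1 v1 f2 -> dom f2 v2 f3 ->
  `|expR (lam * t) * Phi t f0 - coef S h f0 * h x| <=
  Num.sqrt (2 * C * ip f0 f0 / t).
Proof.
move=> t0 D0 D1 D2; have [M M0 MP] := chernoff D0 D1 D2.
have [_ bnd _ _] := PhiP; have [[cf0 _ _] _ _ _] := D0.
have [Mf Mf0 MfP] := continuous_bounded_itv (sl_r_gt0 S) cf0.
set E := expR _; set X := lam * t; have X0 : 0 <= X by rewrite mulr_ge0// ltW.
have E0 : 0 < E by exact: expR_gt0.
apply: (@le_of_harmonic _ _ (E * X ^+ 2 * Mf + E * (t ^+ 2 * M)) _ (Num.truncn X)) => n nX.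
set N : R := n.+1%:R; have N0 : 0 < N by rewrite ltr0n.
pose tau := t / N; have tau0 : 0 < tau by rewrite divr_gt0.
have tauN : tau * N = t by rewrite divfK// gt_eqF.
have cz := chain_iter S tau0 cf0; set z := (fun n => _) in cz.
have h1 := CP tau0 cz n xr; rewrite -/N tauN in h1.
have h2 := MP tau z tau0 cz erefl n.+1; rewrite -/N tauN in h2.
have [h3 h4] := expR_compound n X0; rewrite -/N in h3 h4.
have XE : X / N = tau * lam by rewrite /X /tau; ring.
rewrite -[expR X]/E XE in h3 h4; set a := (1 + tau * lam) ^+ n.+1 in h1 h3 h4.
have a0 : 0 <= a by rewrite exprn_ge0// addr_ge0// mulr_ge0// ltW.
have tl1 : tau * lam <= 1.
  rewrite -XE ler_pdivrMr// mul1r (le_trans (ltW (truncnS_gt X)))//.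
  by rewrite /N ler_nat ltnS.
have f0p := ip_ge0 S cf0.
have h5 : `|a * z n.+1 x - coef S h f0 * h x| <= Num.sqrt (2 * C * ip f0 f0 / t).
  rewrite -sqrtr_sqr ler_wsqrtr//; apply: le_trans h1 _.
  rewrite ler_pM2r ?invr_gt0// (_ : 2 * C * _ = C * ip f0 f0 * 2); last by ring.
  rewrite ler_wpM2l//; first by rewrite mulr_ge0// ltW.
  by lra.
have h6 : `|Phi t f0| <= Mf by apply: bnd => //; exact: ltW.
have -> : E * Phi t f0 - coef S h f0 * h x = (E - a) * Phi t f0 +
  (a * (Phi t f0 - z n.+1 x) + (a * z n.+1 x - coef S h f0 * h x)) by ring.
apply: le_trans (ler_normD _ _) _.
rewrite [X in _ <= X + _]mulrDl -[leRHS]addrA; apply: lerD.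
  rewrite normrM ger0_norm ?subr_ge0//.
  rewrite mulrAC; apply: ler_pM => //; rewrite ?subr_ge0//.
apply: le_trans (ler_normD _ _) _; apply: lerD => //.
rewrite normrM (ger0_norm a0) distrC -mulrA; apply: ler_pM => //.
apply: le_trans h2 _; rewrite /tau le_eqVlt; apply/orP; left; apply/eqP.
by field; rewrite gt_eqF.
Qed.

(* Two implicit Euler steps of size 1 / m^2 turn an element of the domain of L
   into one of the domain of L^3, at uniform distance O(1 / m). *)
Lemma dom_approx f v g : dom f v g -> exists2 D : R, 0 <= D &
  forall n, exists f0 v0 f1 v1 f2 v2 f3,
  [/\ dom f0 v0 f1 /\ dom f1 v1 f2, dom f2 v2 f3, ip f0 f0 <= ip f f &
    forall y : R, 0 <= y <= r -> `|f0 y - f y| <= D / n.+1%:R].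
Proof.
move=> D; have [Cs Cs0 CsP] := dom_sup S.
have [[cf _ cg] _ _ _] := D; have g0 := ip_ge0 S cg.
exists (Num.sqrt (8 * Cs * ip g g)); first exact: sqrtr_ge0.
move=> n; set N : R := n.+1%:R; have N0 : 0 < N by rewrite ltr0n.
pose tau := N^-1 ^+ 2; have tau0 : 0 < tau by rewrite exprn_gt0// invr_gt0.
have tau1 : tau <= 1 by rewrite expr_le1// ?invf_le1// ?invr_ge0 ?(ltW N0)// ler1n.
have [v1 D1] := eulerP S tau0 cf; set z1 := euler S tau f in D1.
have [[cz1 _ cw1] _ _ _] := D1; set w1 := (fun x => _) in D1 cw1.
have [v2 D2] := eulerP S tau0 cz1; set z2 := euler S tau z1 in D2.
have [[cz2 _ cw2] _ _ _] := D2; set w2 := (fun x => _) in D2 cw2.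
have [v3 D3] := dom_diff tau D1 D; rewrite -/w1 in D3.
set k1 := (fun x => _) in D3.
have [v4 D4] := dom_diff tau D2 D1; rewrite -/w2 in D4.
set k2 := (fun x => _) in D4.
have [v5 D5] := dom_diff tau D4 D3; rewrite -/k2 in D5.
exists z2, v2, w2, v4, k2, v5; eexists; split.
- by split.
- exact: D5.
- have := @euler_step_norm _ S 0 tau tau0 _ _ _ cf D1.
  have := @euler_step_norm _ S 0 tau tau0 _ _ _ cz1 D2.
  have := energy_ge0 (@dom_low0 _ S) D1; have := energy_ge0 (@dom_low0 _ S) D2.
  rewrite mulr0 addr0 expr1n !mul1r mulr1 -/w1 -/w2 => e1 e2.
  have := mulr_ge0 (ltW tau0) e1; have := mulr_ge0 (ltW tau0) e2.
  by rewrite -/z1 -/z2; lra.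
have small k u w : continuous k -> dom u w (fun x => (u x - k x) / tau) ->
    ip k k <= ip g g -> ip u u <= ip g g /\
    forall y : R, 0 <= y <= r -> tau * u y ^+ 2 <= 2 * Cs * ip g g.
  move=> ck Du kg.
  have := @euler_step_norm _ S 0 tau tau0 _ _ _ ck Du.
  have := energy_ge0 (@dom_low0 _ S) Du.
  rewrite mulr0 addr0 expr1n !mul1r mulr1.
  have [[cu _ _] _ _ _] := Du; have u0 := ip_ge0 S cu.
  set e := energy _ _ _ _ => e0 hk; have te := mulr_ge0 (ltW tau0) e0.
  split; first by lra.
  move=> y yr; have := CsP _ _ _ Du y yr.
  have -> : ip u u - ip (fun x => (u x - k x) / tau) u = ip u u + e.
    by rewrite /e /energy mul0r subr0.
  move=> /(ler_wpM2l (ltW tau0)) /le_trans; apply.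
  have tu : tau * ip u u <= ip u u by rewrite ler_piMl.
  rewrite mulrCA -[leRHS]mulrA [leRHS]mulrCA ler_pM2l//.
  by rewrite mulrDr; lra.
have [a1 b1] := small g w1 v3 cg D3 (lexx _).
have [_ b2] := small w1 w2 v4 cw1 D4 a1.
move=> y yr; have := b1 y yr; have := b2 y yr => c2 c1.
have -> : z2 y - f y = tau * (w1 y + w2 y).
  by rewrite /w1 /w2; field; rewrite gt_eqF.
rewrite ler_pdivlMr// -{1}(ger0_norm (ltW N0)) -normrM -sqrtr_sqr.
apply: ler_wsqrtr.
have -> : (tau * (w1 y + w2 y) * N) ^+ 2 = tau * (w1 y + w2 y) ^+ 2.
  by rewrite /tau; field; rewrite gt_eqF.
have := mulr_ge0 (ltW tau0) (sqr_ge0 (w1 y - w2 y)).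
by rewrite sqrrB sqrrD !mulrDr mulrN mulrnAr; lra.
Qed.

Lemma ip_norm_le f g (M : R) : continuous f -> continuous g ->
  (forall y : R, 0 <= y <= r -> `|f y| <= M) ->
  `|ip f g| <= M * prim (fun y => p y * `|g y|) r.
Proof.
move=> cf cg fM; have cpg : continuous (fun y => p y * `|g y|) by cont.
rewrite /ip -primZ//; apply: prim_norm_le => //; [by cont|by cont|].
move=> y /andP[y0 yr]; rewrite !normrM (gtr0_norm (wt_gt0 _ _)).
rewrite mulrAC mulrC; apply: ler_wpM2r; last by apply: fM; rewrite !ltW.
by rewrite mulr_ge0// ltW// wt_gt0.
Qed.

Lemma semigroup_rate (t : R) f v g : 0 < t -> dom f v g ->
  `|expR (lam * t) * Phi t f - coef S h f * h x| <=
  Num.sqrt (2 * C * ip f f / t).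
Proof.
move=> t0 Df; have [D D0 DP] := dom_approx Df.
have [lin bnd _ _] := PhiP; have [[cf _ _] _ _ _] := Df.
set E := expR _; have E0 : 0 < E by exact: expR_gt0.
pose H := prim (fun y => p y * `|h y|) r.
apply: (@le_of_harmonic _ _ (E * D + D * H / ip h h * `|h x|) _ 0) => n _.
set N : R := n.+1%:R; have N0 : 0 < N by rewrite ltr0n.
have [f0 [v0 [f1 [v1 [f2 [v2 [f3 [[D0' D1'] D2' n0 d0]]]]]]]] := DP n.
have [[cf0 _ _] _ _ _] := D0'.
have h1 := semigroup_rate_dom3 t0 D0' D1' D2'; rewrite -/E in h1.
have cd : continuous (fun y => f0 y + -1 * f y) by cont.
have dd (y : R) : 0 <= y <= r -> `|f0 y + -1 * f y| <= D / N.
  by move=> yr; rewrite mulN1r; exact: d0.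
have h2 : `|Phi t f0 - Phi t f| <= D / N.
  by have := bnd t _ (D / N) (ltW t0) cd dd; rewrite lin ?(ltW t0)// mulN1r.
have h3 : `|coef S h f0 - coef S h f| <= D / N * H / ip h h.
  rewrite /coef -mulrBl normrM [X in _ * X]gtr0_norm ?invr_gt0//.
  rewrite ler_pM2r ?invr_gt0//; have := ip_norm_le cd ch dd.
  by rewrite ip_linl// mulN1r.
have h4 : Num.sqrt (2 * C * ip f0 f0 / t) <= Num.sqrt (2 * C * ip f f / t).
  by rewrite ler_wsqrtr// ler_pM2r ?invr_gt0// ler_pM2l// mulr_gt0.
have -> : E * Phi t f - coef S h f * h x = - (E * (Phi t f0 - Phi t f)) +
  ((coef S h f0 - coef S h f) * h x + (E * Phi t f0 - coef S h f0 * h x)) by ring.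
apply: le_trans (ler_normD _ _) _; rewrite [X in _ <= X + _]mulrDl -[leRHS]addrA; apply: lerD.
  by rewrite normrN normrM (gtr0_norm E0) -mulrA ler_pM2l.
apply: le_trans (ler_normD _ _) _; apply: lerD; last exact: le_trans h4.
rewrite normrM; apply: le_trans (ler_wpM2r (normr_ge0 _) h3) _.
by rewrite le_eqVlt; apply/orP; left; apply/eqP; field; rewrite !gt_eqF.
Qed.

End rate.
End chernoff.

Section bounded_integrals.
Context {R : realType}.
Notation mu := (@lebesgue_measure R).
Implicit Types (nu : {measure set (measurableTypeR R) -> \bar R}) (f g : R -> R).

Lemma integrable_of_bounded nu (D : set R) f (M : R) : measurable D ->
  (nu D < +oo)%E -> measurable_fun D f -> (forall y, D y -> `|f y| <= M) ->
  nu.-integrable D (EFin \o f).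
Proof.
move=> mD nuD mf fM; apply: measurable_bounded_integrable => //.
exists M; split; first exact: num_real.
by move=> M' MM' y /= Dy; rewrite (le_trans (fM y Dy))// ltW.
Qed.

Lemma Rintegral_norm_le nu (D : set R) f (M : R) : measurable D ->
  (nu D < +oo)%E -> measurable_fun D f -> (forall y, D y -> `|f y| <= M) ->
  `|\int[nu]_(y in D) f y| <= M * fine (nu D).
Proof.
move=> mD nuD mf fM; rewrite -Rintegral_cst//.
apply: le_trans (le_normr_Rintegral _ _) _ => //.
  exact: integrable_of_bounded fM.
apply: le_Rintegral => //.
- apply: (@integrable_of_bounded _ _ _ M) => //.
    exact: measurableT_comp.
  by move=> y /fM; rewrite normr_id.
- by apply: (@integrable_of_bounded _ _ _ `|M|) => // y _.
Qed.

Lemma lebesgue_itv_lty (a c : R) : (mu `[a, c] < +oo)%E.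
Proof. by rewrite lebesgue_measure_itv/=; case: ifP => //; rewrite -EFinD ltry. Qed.

Lemma Rintegral_increment (q : R -> R) (M c D t tau : R) :
  measurable_fun setT q -> (forall s, `|q s| <= M) -> 0 <= t -> 0 <= tau ->
  (forall s, t < s <= t + tau -> `|q s - c| <= D) ->
  `|\int[mu]_(s in `[0, t + tau]) q s - \int[mu]_(s in `[0, t]) q s - tau * c|
    <= tau * D.
Proof.
move=> mq qM t0 tau0 qcD.
have iq : mu.-integrable `[0, t + tau] (EFin \o q).
  apply: (integrable_of_bounded (M := M)) => //.
    exact: lebesgue_itv_lty.
  exact: measurable_funTS.
rewrite Rintegral_itvB//; last by rewrite bnd_simp lerDl.
have mI : measurable (`]t, t + tau] : set R) by exact: measurable_itv.
have muI : mu `]t, t + tau] = tau%:E.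
  rewrite lebesgue_measure_itv/= lte_fin; case: ltP => [_|].
    by rewrite -EFinD addrAC subrr add0r.
  by rewrite gerDl => tau0'; congr EFin; apply/eqP; rewrite eq_le tau0 tau0'.
have muIy : (mu `]t, (t + tau)%R] < +oo)%E by rewrite muI ltry.
have -> : tau * c = \int[mu]_(s in `]t, t + tau]) c.
  rewrite (Rintegral_cst mu mI c) mulrC; congr (c * _).
  by apply/esym; exact: (congr1 fine muI).
have iq' : mu.-integrable `]t, t + tau] (EFin \o q).
  by apply: (integrable_of_bounded (M := M)) => //; exact: measurable_funTS.
rewrite -RintegralB//; last first.
  by apply: (integrable_of_bounded (M := `|c|)).
apply: le_trans (Rintegral_norm_le (M := D) _ _ _ _) _ => //.
- by apply: measurable_funB => //; exact: measurable_funTS.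
- rewrite mulrC (_ : fine _ = tau)//; exact: (congr1 fine muI).
Qed.

End bounded_integrals.

Section transition.
Context {R : realType} (S : sl_data R).
Notation r := (sl_r S).
Notation b := (sl_b S).
Notation B := (sl_B S).
Notation kap := (sl_kap S).
Notation p0 := (sl_p0 S).
Notation pr := (sl_pr S).
Notation dom := (dom S).
Let r0 : 0 < r := sl_r_gt0 S.
Let rr : 0 <= r <= r. Proof. by rewrite lexx ltW. Qed.
Let cp := @wt_continuous _ S.
Implicit Types f g u v : R -> R.

Variables (b' kappa : R -> R).
Variable P : R -> R -> {measure set (measurableTypeR R) -> \bar R}.
Hypothesis bE : forall x : R, 0 < x < r -> b x = b' x.
Hypothesis kapE : forall x : R, 0 < x < r -> kap x = kappa x.
Hypothesis BE : B r = Bfun b' r.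
Hypothesis PP : killed_diffusion r b' kappa p0 pr P.
Notation mu := (@lebesgue_measure R).

Lemma dom_gen_domain u v g : dom u v g -> gen_domain r b' kappa p0 pr u g.
Proof.
move=> [[cu cv cg] d l e].
have u' (x : R) : 0 < x < r -> (u^`())%classic x = 2 * v x.
  by move=> /d[du _]; exact: derive1_is_derive.
have du' (x : R) : 0 < x < r -> is_derive x 1 (u^`())%classic
    (2 * (g x + kap x * u x - 2 * b x * v x)).
  move=> xr; have [_ dv] := d x xr.
  apply: (@is_derive_eq_on _ (fun y => 2 * v y) _ r) => //.
  by move=> y yr; rewrite u'.
split.
- exact: continuous_subspaceT.
- by move=> x xr; have [[? _] _] := d x xr; have [? _] := du' x xr.
- exact: continuous_subspaceT.
- move=> x xr; rewrite derive1nS derive1n1 (derive1_is_derive (du' x xr)) u'//.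
  by rewrite -bE// -kapE//; field.
have c2v : continuous (fun x => 2 * v x) by cont.
exists (2 * v 0), (2 * v r); split.
- apply: (cvg_trans (G := (fun x => 2 * v x) @ 0^'+)); last first.
    by apply: cvg_at_right_filter; exact: c2v.
  apply: near_eq_cvg; apply: filterS2 (nbhs_right_gt 0) (nbhs_right_lt r0).
  by move=> y y0 yr; rewrite u'// y0.
- apply: (cvg_trans (G := (fun x => 2 * v x) @ r^'-)); last first.
    by apply: cvg_at_left_filter; exact: c2v.
  apply: near_eq_cvg; apply: filterS2 (nbhs_left_lt r) (nbhs_left_gt r0).
  by move=> y yr y0; rewrite u'// y0.
- by rewrite l mulrAC divff// mul1r.
- by rewrite mulrAC divff// mul1r -BE.
Qed.

Variable x : R.
Hypothesis xr : 0 < x < r.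

Definition pexp (t : R) f : R := \int[P t x]_(y in `]0, r[) f y.

Let mI : measurable (`]0, r[ : set R). Proof. exact: measurable_itv. Qed.

Lemma trans_le1 (t : R) : 0 <= t -> (P t x `]0%R, r[ <= 1)%E.
Proof.
move=> t0; have [/(_ t x t0 xr)[+ _] _ _ _ _] := PP.
by apply: le_trans; apply: le_measure; rewrite ?inE//; exact: measurableT.
Qed.

Let transy (t : R) : 0 <= t -> (P t x `]0%R, r[ < +oo)%E.
Proof. by move=> /trans_le1 H; apply: le_lt_trans H _; rewrite ltry. Qed.

Lemma trans_integrable (t : R) f : 0 <= t -> continuous f ->
  (P t x).-integrable `]0, r[ (EFin \o f).
Proof.
move=> t0 cf; have [M _ MP] := continuous_bounded_itv r0 cf.
apply: (integrable_of_bounded (M := M)) => //; first exact: transy.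
  by apply: measurable_funTS; exact: continuous_measurable_fun.
by move=> y /=; rewrite in_itv/= => /andP[y0 yr]; rewrite MP// !ltW.
Qed.

Lemma pexp_lin (t c : R) f g : 0 <= t -> continuous f -> continuous g ->
  pexp t (fun y => f y + c * g y) = pexp t f + c * pexp t g.
Proof.
move=> t0 cf cg; have cg' : continuous (fun y => c * g y) by cont.
transitivity (pexp t f + pexp t (fun y => c * g y)).
  by apply: RintegralD => //; exact: trans_integrable.
by congr (_ + _); apply: RintegralZl => //; exact: trans_integrable.
Qed.

Lemma pexp_bound (t M : R) f : 0 <= t -> continuous f ->
  (forall y : R, 0 <= y <= r -> `|f y| <= M) -> `|pexp t f| <= M.
Proof.
move=> t0 cf fM; apply: le_trans (Rintegral_norm_le (M := M) _ _ _ _) _ => //.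
- exact: transy.
- by apply: measurable_funTS; exact: continuous_measurable_fun.
- by move=> y /=; rewrite in_itv/= => /andP[y0 yr]; rewrite fM// !ltW.
- have M0 : 0 <= M by apply: le_trans (fM 0 _); rewrite ?normr_ge0// lexx ltW.
  rewrite ler_piMr// -[leRHS]/(fine 1%E) fine_le// ?trans_le1//.
  by rewrite ge0_fin_numE// transy.
Qed.

Lemma pexp0 f : continuous f -> pexp 0 f = f x.
Proof.
move=> cf; have [_ _ P0 _ _] := PP.
pose d := (\d_(x : measurableTypeR R) : {measure set (measurableTypeR R) -> \bar R}).
have E : (\int[P 0%R x]_(y in `]0%R, r[) (f y)%:E =
          \int[d]_(y in `]0%R, r[) (f y)%:E)%E.
  by apply: eq_measure_integral => A mA _; rewrite P0// /d diracE.
rewrite /pexp /Rintegral E integral_dirac//; last first.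
  by apply/measurable_EFinP; apply: measurable_funTS; exact: continuous_measurable_fun.
by rewrite diracE mem_set ?mul1e//= in_itv.
Qed.

Lemma pexp_measurable f : continuous f ->
  measurable_fun [set: R] (fun s => pexp (Num.max 0 s) f).
Proof.
move=> cf; have [M M0 MP] := continuous_bounded_itv r0 cf.
have s0 (s : R) : 0 <= Num.max 0 s by rewrite le_max lexx.
have [_ [_ mP] _ _ _] := PP.
have ml U : measurable U -> measurable_fun [set: R] (fun s => P (Num.max 0 s) x U).
  move=> mU; apply: (@measurable_comp _ _ _ R R (\bar R) `[0, +oo[%classic (fun t => P t x U)) => //.
  - by move=> _ [s _ <-] /=; rewrite in_itv/= andbT.
  - exact: mP.
  - by apply: measurable_maxr => //; exact: measurable_id.
have key g : continuous g -> (forall y : R, 0 <= y <= r -> 0 <= g y) ->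
    measurable_fun [set: R] (fun s => pexp (Num.max 0 s) g).
  move=> cg g0; rewrite /pexp /Rintegral.
  apply: (measurableT_comp (f := fine)) => //.
  under eq_fun do rewrite integral_mkcond.
  apply: (@measurable_fun_integral_kernel _ _ R (measurableTypeR R) R
    (fun s => P (Num.max 0 s) x) ml).
  - move=> y; rewrite patchE; case: ifPn => // /set_mem/=.
    by rewrite in_itv/= lee_fin => /andP[y0 yr]; rewrite g0// !ltW.
  - apply/(measurable_restrictT _ _).1 => //; apply/measurable_EFinP.
    by apply: measurable_funTS; exact: continuous_measurable_fun.
have -> : (fun s => pexp (Num.max 0 s) f) = (fun s =>
    pexp (Num.max 0 s) (fun y => f y + M * 1) - M * pexp (Num.max 0 s) (fun=> 1)).
  by apply/funext => s; rewrite pexp_lin//; [ring|cont].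
apply: measurable_funB; last apply: measurable_funM => //.
  apply: key; first by cont.
  by move=> y /MP; rewrite mulr1 ler_norml => /andP[h _]; lra.
by apply: key => //; cont.
Qed.

Lemma pexp_dynkin (t : R) u v g : 0 <= t -> dom u v g ->
  pexp t u - u x = \int[mu]_(s in `[0, t]) pexp (Num.max 0 s) g.
Proof.
move=> t0 D; have [_ _ _ _ dyn] := PP; have [[cu _ cg] _ _ _] := D.
have /(_ t x t0 xr) := dyn u g (dom_gen_domain D).
have fin s f : 0 <= s -> continuous f ->
    (\int[P s x]_(y in `]0%R, r[) (f y)%:E = (pexp s f)%:E)%E.
  by move=> s0 cf; rewrite fineK//; apply: integrable_fin_num => //; exact: trans_integrable.
rewrite fin// => H.
rewrite /Rintegral.
have -> : (\int[mu]_(s in `[0%R, t]) (pexp (Num.max 0 s) g)%:E =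
   \int[mu]_(s in `[0%R, t]) \int[P s x]_(y in `]0%R, r[) (g y)%:E)%E.
  apply: eq_integral => s; rewrite inE/= in_itv/= => /andP[s0 _].
  by rewrite fin// (max_idPr s0).
by rewrite -H.
Qed.

Lemma pexp_functional : dynkin_functional S x pexp.
Proof.
have [_ [_ _] _ _ _] := PP.
split.
- by move=> *; exact: pexp_lin.
- by move=> *; exact: pexp_bound.
- exact: pexp0.
move=> t tau u v g w k M t0 tau0 Du Dg kM.
have [[cu _ cg] _ _ _] := Du; have [[_ _ ck] _ _ _] := Dg.
have s0 (s : R) : 0 <= Num.max 0 s by rewrite le_max lexx.
have mx (s : R) : 0 <= s -> Num.max 0 s = s by move=> ?; apply/max_idPr.
have M0 : 0 <= M by apply: le_trans (kM 0 _); rewrite ?normr_ge0// lexx ltW.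
have lip (s s' : R) : 0 <= s -> s <= s' -> `|pexp s' g - pexp s g| <= (s' - s) * M.
  move=> s_0 ss'; have := @Rintegral_increment _ (fun s => pexp (Num.max 0 s) k)
    M 0 M s (s' - s) (pexp_measurable ck) _ s_0 _ _.
  rewrite subrKC mulr0 subr0 -!(pexp_dynkin _ Dg)//; last exact: le_trans ss'.
  rewrite opprB addrA subrK; apply.
  - by move=> s1; exact: pexp_bound.
  - by rewrite subr_ge0.
  - by move=> s1 _; rewrite subr0; exact: pexp_bound.
have [Mg _ MgP] := continuous_bounded_itv r0 cg.
have tt0 : 0 <= t + tau by rewrite addr_ge0// ltW.
have := @Rintegral_increment _ (fun s => pexp (Num.max 0 s) g)
    Mg (pexp (t + tau) g) (tau * M) t tau (pexp_measurable cg) _ t0 (ltW tau0) _.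
rewrite -!(pexp_dynkin _ Du)// opprB addrA subrK expr2 -mulrA; apply.
- by move=> s1; exact: pexp_bound.
- move=> s /andP[ts st]; rewrite mx; last by apply: le_trans (ltW ts).
  rewrite distrC; apply: le_trans (lip s (t + tau) _ st) _.
    exact: le_trans (ltW ts).
  by rewrite ler_wpM2r//; lra.
Qed.

End transition.

Section positive_part.
Context {R : realType}.

Definition pos (y : R) : R := Num.max 0 y.

Lemma pos_continuous : continuous pos.
Proof.
move=> x; apply: (@continuous_max _ R (fun=> 0) id); first exact: cvg_cst.
exact: cvg_id.
Qed.

Lemma pos_mul (y : R) : pos y * y = pos y ^+ 2.
Proof.
by rewrite /pos; case: leP => _; rewrite expr2 ?mul0r.
Qed.

Lemma is_derive_pos2 (y : R) : is_derive y 1 (fun z => pos z ^+ 2) (2 * pos y).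
Proof.
have [y0|y0|->] := ltgtP y 0.
- rewrite {2}/pos (max_idPl (ltW y0)) mulr0.
  apply: is_derive_near_eq (is_derive_fun_cst 0 y).
  apply: filterS (lt_nbhsl y0) => z /ltW z0.
  by rewrite /pos (max_idPl z0) expr0n.
- rewrite {2}/pos (max_idPr (ltW y0)).
  have : is_derive y 1 (fun z : R => z ^+ 2) (2 * y).
    by eapply is_derive_val; [deriv|rewrite /= expr1 mulr1].
  apply: is_derive_near_eq.
  by apply: filterS (lt_nbhsr y0) => z /ltW z0; rewrite /pos (max_idPr z0).
- apply/is_derive1_caratheodory; exists pos; split.
  + by move=> z; rewrite subr0 pos_mul /pos maxxx expr0n subr0.
  + exact: pos_continuous.
  + by rewrite /pos maxxx mulr0.
Qed.

End positive_part.

Section density.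
Context {R : realType} (S : sl_data R).
Notation r := (sl_r S).
Notation b := (sl_b S).
Notation B := (sl_B S).
Notation kap := (sl_kap S).
Notation dom := (dom S).
Let r0 : 0 < r := sl_r_gt0 S.
Let rr : 0 <= r <= r. Proof. by rewrite lexx ltW. Qed.
Let cp := @wt_continuous _ S.
Implicit Types f g u v : R -> R.

Hypothesis kap_continuous : forall x : R, 0 < x < r -> {for x, continuous kap}.
Let cb : continuous b := @sl_b_continuous _ S.

Definition bump (a c k y : R) : R :=
  1 - expR (- (k * (pos ((y - a) * (c - y)) ^+ 2 * ((y - a) * (c - y))))).

Lemma bump_dom (a c k : R) : 0 < a -> a <= c -> c < r ->
  exists v g, dom (bump a c k) v g.
Proof.
move=> a0 ac cr.
pose q (y : R) : R := (y - a) * (c - y); pose q' (y : R) : R := a + c - 2 * y.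
pose t (y : R) : R := pos (q y); pose s (y : R) : R := pos (q y) ^+ 2.
pose e (y : R) : R := expR (- (k * (s y * q y))).
have cq : continuous q by rewrite /q; cont.
have cq' : continuous q' by rewrite /q'; cont.
have ct : continuous t by apply: continuous_fun_comp cq; exact: pos_continuous.
have cs : continuous s by rewrite /s -/(t _); have : continuous (fun y => t y ^+ 2) by cont.
have ce : continuous e by rewrite /e; cont.
have dq (y : R) : is_derive y 1 q (q' y) by rewrite /q /q'; derivr.
have ds (y : R) : is_derive y 1 s (2 * t y * q' y).
  exact: (@is_derive1_comp _ (fun z => pos z ^+ 2) q y _ _ (is_derive_pos2 _) (dq y)).
have sq (y : R) : t y * q y = s y by rewrite /t /s pos_mul.
have de (y : R) : is_derive y 1 e (- (3 * k * s y * q' y * e y)).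
  have ? := ds y; have ? := dq y; rewrite /e; eapply is_derive_val; first by deriv.
  by rewrite /= -/(e y) -sq; ring.
have dq' (y : R) : is_derive y 1 q' (- 2) by rewrite /q'; derivr.
pose u (y : R) : R := 1 - e y.
have uE : bump a c k = u by [].
pose v (y : R) : R := 3 / 2 * k * s y * q' y * e y.
pose v' (y : R) : R := 3 / 2 * k * (2 * t y * q' y * q' y * e y + s y * (- 2) * e y +
   s y * q' y * (- (3 * k * s y * q' y * e y))).
pose m (y : R) : R := Num.max a (Num.min y c).
have cm : continuous (fun y => kap (m y)).
  move=> y; apply: continuous_comp; last first.
    apply: kap_continuous; rewrite /m lt_max a0/= gt_max (le_lt_trans ac cr)/=.
    by rewrite gt_min cr orbT.
  apply: (@continuous_max _ R (fun=> a) (fun x => Num.min x c)); first exact: cvg_cst.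
  by apply: (@continuous_min _ R id (fun=> c)); [exact: cvg_id|exact: cvg_cst].
have out (y : R) : ~~ (a <= y <= c) -> s y = 0.
  rewrite negb_and -!ltNge => yac; rewrite /s /pos (max_idPl _) ?expr0n//.
  by rewrite /q; case/orP: yac => yac; nra.
have u0 (y : R) : ~~ (a <= y <= c) -> u y = 0.
  by move=> /out sy; rewrite /u /e sy mul0r mulr0 oppr0 expR0 subrr.
have v0 (y : R) : ~~ (a <= y <= c) -> v y = 0 by move=> /out sy; rewrite /v sy; ring.
have kapu (y : R) : kap (m y) * u y = kap y * u y.
  have [/andP[ay yc]|/u0 ->] := boolP (a <= y <= c); last by rewrite !mulr0.
  by rewrite /m (min_idPl yc) (max_idPr ay).
exists v, (fun y => v' y - kap (m y) * u y + 2 * b y * v y).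
have cu : continuous u by rewrite /u; cont.
have cv : continuous v by rewrite /v; cont.
rewrite uE; split.
- by split => //; rewrite /v'; cont.
- move=> y yr; have ? := ds y; have ? := dq' y; have ? := de y; split.
    by rewrite /u; eapply is_derive_val; [deriv|rewrite /v; field].
  rewrite kapu /v; eapply is_derive_val; first by deriv.
  by rewrite /v' /v /=; ring.
- by rewrite u0 ?v0 ?mulr0// negb_and -ltNge a0.
- by rewrite u0 ?v0 ?mulr0 ?oppr0// negb_and -!ltNge cr orbT.
Qed.

Notation T := (measurableTypeR R).
Variable rho : {measure set T -> \bar R}.
Let I : set R := `]0, r[%classic.
Let mI : measurable (I : set T). Proof. exact: measurable_itv. Qed.
Hypothesis rhoI : (rho I < +oo)%E.

Definition approximable (phi : R -> R) : Prop := forall e : R, 0 < e ->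
  exists f v g, dom f v g /\ \int[rho]_(y in I) (phi y - f y) ^+ 2 <= e.

Definition bounded1 (phi : R -> R) : Prop :=
  measurable_fun I phi /\ forall y, I y -> `|phi y| <= 1.

Let sqr_integrable phi f : bounded1 phi -> continuous f ->
  rho.-integrable I (EFin \o (fun y => (phi y - f y) ^+ 2)).
Proof.
move=> [mphi phi1] cf; have [M M0 MP] := continuous_bounded_itv r0 cf.
apply: (integrable_of_bounded (M := (1 + M) ^+ 2)) => //.
  apply: measurable_funX; apply: measurable_funB => //.
  by apply: measurable_funTS; exact: continuous_measurable_fun.
move=> y Iy; rewrite normrX lerXn2r ?nnegrE//; first by rewrite addr_ge0// ltW.
apply: le_trans (ler_normB _ _) _; apply: lerD; first exact: phi1.
by move: Iy; rewrite /I/= in_itv/= => /andP[y0 yr]; rewrite MP// !ltW.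
Qed.

Let sqr_integrable' phi psi : bounded1 phi -> bounded1 psi ->
  rho.-integrable I (EFin \o (fun y => (phi y - psi y) ^+ 2)).
Proof.
move=> [mphi phi1] [mpsi psi1].
apply: (integrable_of_bounded (M := 2 ^+ 2)) => //.
  by apply: measurable_funX; apply: measurable_funB.
move=> y Iy; rewrite normrX lerXn2r ?nnegrE//.
by apply: le_trans (ler_normB _ _) _; have := phi1 y Iy; have := psi1 y Iy; lra.
Qed.

Let Rint_le2 (f g h : R -> R) :
  rho.-integrable I (EFin \o f) -> rho.-integrable I (EFin \o g) ->
  rho.-integrable I (EFin \o h) ->
  (forall y, I y -> f y <= 2 * g y + 2 * h y) ->
  \int[rho]_(y in I) f y <= 2 * \int[rho]_(y in I) g y + 2 * \int[rho]_(y in I) h y.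
Proof.
move=> fi gi hi fgh.
have gi2 : rho.-integrable I (EFin \o (fun y => 2 * g y)).
  by have := integrableZl mI 2 gi; apply: eq_integrable => // y _ /=; rewrite EFinM.
have hi2 : rho.-integrable I (EFin \o (fun y => 2 * h y)).
  by have := integrableZl mI 2 hi; apply: eq_integrable => // y _ /=; rewrite EFinM.
rewrite -!RintegralZl// -RintegralD//; apply: le_Rintegral => //.
by have := integrableD mI gi2 hi2; apply: eq_integrable => // y _ /=; rewrite EFinD.
Qed.

Lemma approximable_lin (c : R) phi psi : `|c| <= 1 ->
  bounded1 phi -> bounded1 psi -> bounded1 (fun y => phi y + c * psi y) ->
  approximable phi -> approximable psi ->
  approximable (fun y => phi y + c * psi y).
Proof.
move=> c1 b1 b2 b3 A1 A2 e e0.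
have e4 : 0 < e / 4 by rewrite divr_gt0.
have [f1 [v1 [g1 [D1 h1]]]] := A1 _ e4; have [f2 [v2 [g2 [D2 h2]]]] := A2 _ e4.
exists (fun y => f1 y + c * f2 y); eexists; eexists; split; first exact: dom_lin D1 D2.
have [[cf1 _ _] _ _ _] := D1; have [[cf2 _ _] _ _ _] := D2.
have cf : continuous (fun y => f1 y + c * f2 y) by cont.
apply: le_trans (Rint_le2 (sqr_integrable b3 cf) (sqr_integrable b1 cf1)
  (sqr_integrable b2 cf2) _) _; last by lra.
move=> y _; set A := phi y - f1 y; set B := psi y - f2 y.
have -> : phi y + c * psi y - (f1 y + c * f2 y) = A + c * B by rewrite /A /B; ring.
have c2 : c ^+ 2 <= 1 by rewrite -real_normK ?num_real// expr_le1.
have := ler_wpM2r (sqr_ge0 B) c2; rewrite mul1r -exprMn => h3.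
have := sqr_ge0 (A - c * B).
have -> : (A + c * B) ^+ 2 = 2 * A ^+ 2 + 2 * (c * B) ^+ 2 - (A - c * B) ^+ 2 by ring.
by lra.
Qed.

Lemma approximable_lim (phi_ : nat -> R -> R) phi :
  (forall n, bounded1 (phi_ n)) -> bounded1 phi ->
  (forall n, approximable (phi_ n)) ->
  (forall y, I y -> phi_ n y @[n --> \oo] --> phi y) -> approximable phi.
Proof.
move=> bn bphi An lim e e0.
have e4 : 0 < e / 4 by rewrite divr_gt0.
have cvg : (\int[rho]_(y in I) ((phi y - phi_ n y) ^+ 2)%:E)%E @[n --> \oo] -->
    (\int[rho]_(y in I) (cst 0%E y))%E.
  apply: (@dominated_cvg _ T R rho I mI _ (cst 0%E) (cst 4%:E)) => //.
  - move=> n; apply/measurable_EFinP.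
    apply: measurable_funX; apply: measurable_funB; first by case: bphi.
    by case: (bn n).
  - move=> y Iy; apply/cvg_EFin; first by near=> n.
    rewrite [X in _ --> X](_ : _ = (phi y - phi y) * (phi y - phi y)); last first.
      by rewrite subrr mul0r.
    rewrite (_ : fine \o _ = fun n => (phi y - phi_ n y) * (phi y - phi_ n y)); last first.
      by apply/funext => n /=; rewrite expr2.
    by apply: cvgM; apply: cvgB; by [exact: cvg_cst|exact: lim].
  - by apply: (integrable_of_bounded (M := 4) (f := cst 4)) => // y _ /=; rewrite ger0_norm.
  - move=> n y Iy; rewrite /= lee_fin normrX.
    have -> : (4 : R) = 2 ^+ 2 by ring.
    rewrite lerXn2r ?nnegrE//; apply: le_trans (ler_normB _ _) _.
    by have := (bphi).2 y Iy; have := (bn n).2 y Iy; lra.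
rewrite integral0 in cvg.
have /fine_cvg/cvgrPdist_lt /(_ _ e4) [N _ HN] := cvg.
have {}HN := HN N (leqnn N).
rewrite /= sub0r normrN in HN.
have [f [v [g [D h]]]] := An N _ e4; exists f, v, g; split => //.
have [[cf _ _] _ _ _] := D.
apply: le_trans (Rint_le2 (sqr_integrable bphi cf) (sqr_integrable' bphi (bn N))
  (sqr_integrable (bn N) cf) _) _.
  move=> y _; set A := phi y - phi_ N y; set B := phi_ N y - f y.
  have -> : phi y - f y = A + B by rewrite /A /B; ring.
  have := sqr_ge0 (A - B).
  have -> : (A + B) ^+ 2 = 2 * A ^+ 2 + 2 * B ^+ 2 - (A - B) ^+ 2 by ring.
  by lra.
have HN' : `|\int[rho]_(y in I) (phi y - phi_ N y) ^+ 2| < e / 4 := HN.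
by have := ler_norm (\int[rho]_(y in I) (phi y - phi_ N y) ^+ 2); lra.
Unshelve. all: by end_near. Qed.

Lemma approximable_ext phi psi : (forall y, I y -> phi y = psi y) ->
  approximable phi -> approximable psi.
Proof.
move=> E A e /A [f [v [g [D h]]]]; exists f, v, g; split => //.
apply: le_trans h; rewrite le_eqVlt; apply/orP; left; apply/eqP.
by apply: eq_Rintegral => y /set_mem Iy; rewrite E.
Qed.

Lemma approximable_dom f v g : dom f v g -> approximable f.
Proof.
move=> D e e0; exists f, v, g; split => //.
suff -> : \int[rho]_(y in I) (f y - f y) ^+ 2 = 0 by exact: ltW.
rewrite -[RHS](mul0r (fine (rho I))) -(Rintegral_cst rho mI).
by apply: eq_Rintegral => y _; rewrite subrr expr0n.
Qed.

Lemma bump_out (a c k y : R) : a <= c -> ~~ (a < y < c) -> bump a c k y = 0.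
Proof.
move=> ac yac; rewrite /bump /pos (max_idPl _); last first.
  by move: yac; rewrite negb_and -!leNgt => /orP[]; nra.
by rewrite expr0n mul0r mulr0 oppr0 expR0 subrr.
Qed.

Lemma bump_itv (a c k y : R) : 0 <= k -> 0 <= bump a c k y <= 1.
Proof.
move=> k0; rewrite /bump subr_ge0 gerBl expR_ge0 andbT -[leRHS]expR0 ler_expR oppr_le0.
set q := _ * (c - y); rewrite mulr_ge0// /pos; have [q0|/ltW q0] := leP 0 q.
  by rewrite mulr_ge0// sqr_ge0.
by rewrite expr0n mul0r.
Qed.

Lemma bounded1_indic (A : set T) : measurable A -> bounded1 (\1_A).
Proof.
move=> mA; split; first by apply: measurable_funTS; exact: measurable_indic.
by move=> y _; rewrite indicE; case: (_ \in _); rewrite ?normr1 ?normr0.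
Qed.

Lemma bump_cvg (a c y : R) : a < y < c ->
  let d n := (c - a) / n.+3%:R in
  bump (a + d n) (c - d n) n%:R y @[n --> \oo] --> (1 : R).
Proof.
move=> /andP[ay yc] d; apply/cvgrPdist_lt => e e0.
pose m := Num.min (y - a) (c - y).
have [ma mc m0] : [/\ m <= y - a, m <= c - y & 0 < m].
  by rewrite /m !ge_min !lexx orbT lt_min !subr_gt0 ay yc.
pose s := (m / 2) * (m / 2); have s0 : 0 < s by rewrite mulr_gt0 ?divr_gt0.
pose N := maxn (Num.truncn (2 * (c - a) / m)) (Num.truncn (1 / (e * s ^+ 3))).
exists N.+1 => //= n /= Nn.
have dn : d n <= m / 2.
  rewrite /d ler_pdivrMr ?ltr0n// mulrC -ler_pdivrMr ?divr_gt0//.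
  rewrite (_ : _ / (m / 2) = 2 * (c - a) / m); last by field; rewrite gt_eqF.
  apply: le_trans (ltW (truncnS_gt _)) _; rewrite ler_nat.
  by apply: leq_trans (_ : N.+1 <= _)%N; [rewrite ltnS leq_maxl|rewrite (leq_trans Nn)// -addn3 leq_addr].
have d0 : 0 < d n by rewrite divr_gt0 ?ltr0n// subr_gt0 (lt_trans ay).
pose q := (y - (a + d n)) * (c - d n - y).
have sq : s <= q by rewrite /s /q ler_pM ?divr_ge0 ?(ltW m0)//; lra.
have q0 : 0 < q by exact: lt_le_trans sq.
rewrite /bump -/q opprB addrC subrK /pos (max_idPr (ltW q0)) -exprSr.
rewrite gtr0_norm ?expR_gt0//.
have n0 : 0 < n%:R :> R by rewrite ltr0n (leq_trans _ Nn).
have k0 : 0 < n%:R * q ^+ 3 by rewrite mulr_gt0// exprn_gt0.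
rewrite expRN; apply: le_lt_trans (_ : (n%:R * q ^+ 3)^-1 < _).
  rewrite lef_pV2 ?posrE ?expR_gt0//.
  by apply: le_trans (expR_ge1Dx _); rewrite lerDr.
rewrite -[e]invrK ltf_pV2 ?posrE ?invr_gt0//.
apply: lt_le_trans (_ : n%:R * s ^+ 3 <= _); last first.
  by rewrite ler_pM2l// lerXn2r ?nnegrE ?(ltW s0) ?(ltW q0).
rewrite -ltr_pdivrMr ?exprn_gt0//.
rewrite (_ : e^-1 / s ^+ 3 = 1 / (e * s ^+ 3)); last first.
  by field; rewrite !gt_eqF// exprn_gt0.
apply: lt_le_trans (truncnS_gt _) _; rewrite ler_nat.
by apply: leq_trans Nn; rewrite ltnS leq_maxr.
Qed.

Lemma approximable_itv (a c : R) : 0 <= a -> c <= r ->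
  approximable (\1_(`]a, c[%classic : set R)).
Proof.
move=> a0 cr; have rp : 0 < r := r0.
have [ca|ac] := leP c a.
  have [v [g D]] := @bump_dom (r / 2) (r / 2) 0 ltac:(lra) (lexx _) ltac:(lra).
  apply: approximable_ext (approximable_dom D) => y _.
  rewrite bump_out//; last by apply/negP => /andP[]; lra.
  rewrite indicE memNset//= in_itv/= => /andP[]; lra.
pose d n := (c - a) / n.+3%:R.
have dP n : 0 < d n /\ 2 * d n <= c - a.
  have n3 : 0 < n.+3%:R :> R by rewrite ltr0n.
  split; first by rewrite divr_gt0// subr_gt0.
  rewrite /d mulrA ler_pdivrMr// mulrC ler_pM2l ?subr_gt0//.
  by rewrite (ler_nat R 2).
have Dn n : exists v g, dom (bump (a + d n) (c - d n) n%:R) v g.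
  by have [d1 d2] := dP n; apply: bump_dom; lra.
apply: (@approximable_lim (fun n => bump (a + d n) (c - d n) n%:R)).
- move=> n; have [v [g [[cf _ _] _ _ _]]] := Dn n; split.
    by apply: measurable_funTS; exact: continuous_measurable_fun.
  move=> y _; have /andP[h1 h2] := @bump_itv (a + d n) (c - d n) n%:R y (ler0n _ _).
  by rewrite ger0_norm.
- by apply: bounded1_indic; exact: measurable_itv.
- by move=> n; have [v [g D]] := Dn n; exact: approximable_dom D.
move=> y _; have [yac|yac] := boolP (a < y < c).
  rewrite indicE mem_set/= ?in_itv//; exact: bump_cvg.
rewrite indicE memNset/=; last by rewrite in_itv/=; exact/negP.
rewrite (_ : (fun n => _) = fun=> 0); first exact: cvg_cst.
apply/funext => n; have [d1 d2] := dP n; apply: bump_out; first by lra.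
by apply: contra yac => /andP[? ?]; apply/andP; split; lra.
Qed.

Lemma approximable_indic (A : set T) : measurable A -> approximable (\1_A).
Proof.
pose G : set (set T) := @RGenOpens.G R.
have mE : @measurable _ T = <<s G >> by exact: RGenOpens.measurableE.
have b1 := bounded1_indic.
have AT : approximable (\1_(setT : set T)).
  apply: approximable_ext (approximable_itv (lexx 0) (lexx r)) => y Iy.
  by rewrite !indicE !mem_set.
move=> mA; have : <<s G >> A by rewrite -mE.
apply: (@dynkin_induction _ T G (fun A => approximable (\1_A))) => //.
- move=> _ _ [x [y ->]] [x' [y' ->]]; exists (Num.max x x'), (Num.min y y').
  apply/seteqP; split => z /=; rewrite !in_itv/= gt_max lt_min.
    by move=> [/andP[-> ->] /andP[-> ->]].
  by move=> /andP[/andP[-> ->] /andP[-> ->]].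
- move=> _ [x [y ->]].
  have h1 : 0 <= Num.max 0 x by rewrite le_max lexx.
  have h2 : Num.min r y <= r by rewrite ge_min lexx.
  apply: approximable_ext (approximable_itv h1 h2) => z.
  rewrite /I/= in_itv/= => /andP[z0 zr]; rewrite !indicE.
  congr (_%:R); congr nat_of_bool; apply/idP/idP => /set_mem/=;
    rewrite in_itv/= => H; apply/mem_set; rewrite /= in_itv/=; move: H;
    by rewrite gt_max lt_min z0 zr.
- move=> B mB AB.
  have E : \1_(~` B) = (fun y => \1_(setT : set T) y + -1 * \1_B y) :> (R -> R).
    by apply/funext => y; rewrite !indicE in_setC in_setT; case: (y \in B) => /=; ring.
  rewrite E; apply: approximable_lin => //; first by rewrite normrN normr1.
  - exact: b1.
  - exact: b1.
  - by rewrite -E; apply: b1; exact: measurableC.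
move=> F mF tF AF.
pose U n : set T := \big[setU/set0]_(i < n) F i.
have mU n : measurable (U n) by apply: bigsetU_measurable.
have AU n : approximable (\1_(U n)).
  elim: n => [|n IH].
    apply: approximable_ext (approximable_itv (lexx 0) (ltW r0) (c := 0)) => y _.
    rewrite /U big_ord0 !indicE in_set0 memNset//= in_itv/= => /andP[].
    by move=> /lt_trans h /h; rewrite ltxx.
  have dis y : U n y -> ~ F n y.
    rewrite /U -bigcup_mkord => -[i /= ni Fi] Fn.
    have : i = n by apply: tF => //; exists y.
    by move=> E; rewrite E ltnn in ni.
  have E : \1_(U n.+1) = (fun y => \1_(U n) y + 1 * \1_(F n) y) :> (R -> R).
    apply/funext => y; rewrite !indicE /U big_ord_recr/= -/(U n) in_setU mul1r.
    have [/set_mem Uy|_] := boolP (y \in U n); last by rewrite add0r.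
    by rewrite memNset ?addr0//; exact: dis.
  rewrite E; apply: approximable_lin => //; first by rewrite normr1.
  - exact: b1.
  - exact: b1.
  - by rewrite -E; exact: b1.
apply: (@approximable_lim (fun n => \1_(U n))) => //.
- by move=> n; exact: b1.
- by apply: b1; exact: bigcup_measurable.
move=> y _; rewrite !indicE; have [/set_mem[i _ Fi]|yF] := boolP (y \in \bigcup_k F k).
  apply: (@cvg_trans _ ((fun=> 1) @ \oo)); last exact: cvg_cst.
  apply: near_eq_cvg; exists i.+1 => // n /= ni.
  by rewrite indicE mem_set// /U -bigcup_mkord; exists i.
rewrite (_ : (fun n => _) = fun=> 0); first exact: cvg_cst.
apply/funext => n; rewrite indicE memNset// /U -bigcup_mkord => -[i /= _ Fi].
by move: yF; rewrite notin_setE; apply; exists i.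
Qed.

End density.

Section indicator_rate.
Context {R : realType} (S : sl_data R).
Notation r := (sl_r S).
Notation b := (sl_b S).
Notation B := (sl_B S).
Notation kap := (sl_kap S).
Notation p0 := (sl_p0 S).
Notation pr := (sl_pr S).
Notation prim := (prim r).
Notation p := (wt S).
Notation ip := (ip S).
Notation dom := (dom S).
Let r0 : 0 < r := sl_r_gt0 S.
Let rr : 0 <= r <= r. Proof. by rewrite lexx ltW. Qed.
Let cp := @wt_continuous _ S.
Implicit Types f g u v : R -> R.

Variables (b' kappa : R -> R).
Variable P : R -> R -> {measure set (measurableTypeR R) -> \bar R}.
Hypothesis bE : forall x : R, 0 < x < r -> b x = b' x.
Hypothesis kapE : forall x : R, 0 < x < r -> kap x = kappa x.
Hypothesis BE : B r = Bfun b' r.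
Hypothesis PP : killed_diffusion r b' kappa p0 pr P.
Hypothesis kap_continuous : forall x : R, 0 < x < r -> {for x, continuous kap}.
Notation mu := (@lebesgue_measure R).
Notation T := (measurableTypeR R).
Let I : set R := `]0, r[%classic.
Let mI : measurable (I : set T). Proof. exact: measurable_itv. Qed.
Let muI : mu I = r%:E.
Proof. by rewrite lebesgue_measure_itv/= lte_fin r0 oppr0 adde0. Qed.
Let muIy : (mu I < +oo)%E. Proof. by rewrite muI ltry. Qed.

Lemma ip_itvoo f g : continuous f -> continuous g ->
  ip f g = \int[mu]_(y in I) (p y * f y * g y).
Proof.
move=> cf cg; have ci : continuous (fun y => p y * f y * g y) by cont.
have ii := continuous_integrable r ci.
rewrite /ip /prim clamp_id// -Rintegral_itv_obnd_cbnd; last first.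
  apply: integrableS ii => // y /=; rewrite !in_itv/=.
  by move=> /andP[/ltW -> ->].
rewrite -Rintegral_itv_bndo_bndc//.
by apply: integrableS ii => //; exact: subset_itv_oo_cc.
Qed.

Lemma Rintegral_norm_of_sqr (m : {measure set T -> \bar R}) (phi : R -> R) (eta M : R) :
  (m I < +oo)%E -> measurable_fun I phi -> (forall y, I y -> `|phi y| <= M) ->
  0 < eta -> \int[m]_(y in I) phi y ^+ 2 <= eta ^+ 2 ->
  \int[m]_(y in I) `|phi y| <= eta / 2 * (fine (m I) + 1).
Proof.
move=> mIy mphi phiM eta0 h.
have i1 : m.-integrable I (EFin \o (fun=> eta / 2)).
  by apply: (integrable_of_bounded (M := `|eta / 2|)).
have i2 : m.-integrable I (EFin \o (fun y => phi y ^+ 2)).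
  apply: (integrable_of_bounded (M := M ^+ 2)) => //; first exact: measurable_funX.
  move=> y Iy; have := phiM y Iy; rewrite normrX => h1.
  by rewrite lerXn2r ?nnegrE//; apply: le_trans h1.
have i3 : m.-integrable I (EFin \o (fun y => (2 * eta)^-1 * phi y ^+ 2)).
  by have := integrableZl mI (2 * eta)^-1 i2; apply: eq_integrable => // y _ /=; rewrite EFinM.
apply: le_trans (_ : \int[m]_(y in I) (eta / 2 + (2 * eta)^-1 * phi y ^+ 2) <= _).
  apply: le_Rintegral => //.
  - apply: (integrable_of_bounded (M := M)) => //; first exact: measurableT_comp.
    by move=> y Iy; rewrite normr_id phiM.
  - by have := integrableD mI i1 i3; apply: eq_integrable => // y _ /=; rewrite EFinD.
  move=> y _; have := sqr_ge0 (`|phi y| - eta); rewrite sqrrB real_normK ?num_real// => h1.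
  rewrite -(ler_pM2l (mulr_gt0 (ltr0n R 2) eta0)).
  rewrite mulrDr mulVKf ?gt_eqF ?mulr_gt0//.
  by rewrite -mulr_natl in h1; nra.
rewrite (RintegralD mI i1 i3) (RintegralZl _ mI i2) (Rintegral_cst m mI).
rewrite mulrDr mulr1 lerD2l.
rewrite -(ler_pM2l (mulr_gt0 (ltr0n R 2) eta0)) mulVKf ?gt_eqF ?mulr_gt0//.
by apply: le_trans h _; rewrite le_eqVlt; apply/orP; left; apply/eqP; field.
Qed.

Lemma Rintegral_normM_le (m : {measure set T -> \bar R}) (phi psi : R -> R) (M N : R) :
  (m I < +oo)%E -> measurable_fun I phi -> (forall y, I y -> `|phi y| <= M) ->
  measurable_fun I psi -> (forall y, I y -> `|psi y| <= N) ->
  `|\int[m]_(y in I) (psi y * phi y)| <= N * \int[m]_(y in I) `|phi y|.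
Proof.
move=> mIy mphi phiM mpsi psiN.
have i1 : m.-integrable I (EFin \o (fun y => `|phi y|)).
  apply: (integrable_of_bounded (M := M)) => //; first exact: measurableT_comp.
  by move=> y Iy; rewrite normr_id phiM.
have i2 : m.-integrable I (EFin \o (fun y => psi y * phi y)).
  apply: (integrable_of_bounded (M := N * M)) => //; first exact: measurable_funM.
  by move=> y Iy; rewrite normrM ler_pM// ?psiN ?phiM.
apply: le_trans (le_normr_Rintegral mI i2) _.
rewrite -RintegralZl//; apply: le_Rintegral => //.
- apply: (integrable_of_bounded (M := N * M)) => //.
    by apply: measurableT_comp => //; exact: measurable_funM.
  by move=> y Iy; rewrite normr_id normrM ler_pM// ?psiN ?phiM.
- by have := integrableZl mI N i1; apply: eq_integrable => // y _ /=; rewrite EFinM.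
by move=> y Iy; rewrite normrM ler_wpM2r// psiN.
Qed.

Variables (lam gam : R) (h vh : R -> R).
Hypotheses (lam0 : 0 <= lam) (gam0 : 0 < gam).
Hypothesis low : forall u v g, dom u v g -> lam * ip u u <= - ip g u.
Hypothesis Dh : dom h vh (fun x => - lam * h x).
Hypothesis hh : 0 < ip h h.
Hypothesis gap : forall u v g, dom u v g -> ip u h = 0 ->
  gam * ip u u <= - ip g u - lam * ip u u.
Let ch : continuous h. Proof. by have [[]] := Dh. Qed.

Lemma indicator_rate : exists2 C : R, 0 < C &
  forall x t (A : set R), 0 < x < r -> 0 < t -> measurable (A : set T) -> A `<=` I ->
  `|expR (lam * t) * fine (P t x A) -
    \int[mu]_(y in A) (p y * h y) / ip h h * h x| <= Num.sqrt (C / t).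
Proof.
have [C C0 CP] := euler_converges lam0 gam0 low Dh hh gap.
have [Mp Mp0 MpP] := continuous_bounded_itv r0 cp.
have cph : continuous (fun y => p y * h y) by cont.
have [Mh Mh0 MhP] := continuous_bounded_itv r0 cph.
have rp : 0 < r := r0.
exists (2 * C * (Mp * (2 * r + 2))); first by rewrite !mulr_gt0//; lra.
move=> x t A xr t0 mA AI.
have xr' : 0 <= x <= r by case/andP: xr => ? ?; rewrite !ltW.
pose nu := P t x.
have nuI1 : (nu I <= 1)%E := trans_le1 PP xr (ltW t0).
have nuIy : (nu I < +oo)%E by apply: le_lt_trans nuI1 _; rewrite ltry.
have nuI1' : fine (nu I) <= 1.
  by rewrite -[leRHS]/(fine 1%E) fine_le// ge0_fin_numE.
pose rho : {measure set T -> \bar R} := measure_add nu mu.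
have rhoIy : (rho I < +oo)%E
  by rewrite (_ : rho I = nu I + mu I)%E ?lte_add_pinfty//; exact: measure_addE.
have [mone oneb] := @bounded1_indic R S A mA.
have oneA y : I y -> `|(\1_A y : R)| <= 1 := oneb y.
have PhiP := pexp_functional bE kapE BE PP xr.
have rate := semigroup_rate xr' PhiP lam0 Dh hh C0 CP.
have IoA (m : {measure set T -> \bar R}) (q : R -> R) :
    \int[m]_(y in I) (q y * \1_A y) = \int[m]_(y in A) q y.
  rewrite -[A in RHS](setIidr AI) Rintegral_mkcondr; apply: eq_Rintegral => y _.
  by rewrite patchE indicE; case: ifP => _; rewrite ?mulr1 ?mulr0.
set E := expR _; have E0 : 0 < E by exact: expR_gt0.
set cA := _ / ip h h.
apply: (@le_of_harmonic _ _ (E + Mh * (r + 1) / 2 / ip h h * `|h x|) _ 0) => n _.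
set N : R := n.+1%:R; have N0 : 0 < N by rewrite ltr0n.
pose eta := N^-1; have eta0 : 0 < eta by rewrite invr_gt0.
have eta1 : eta <= 1 by rewrite invf_le1// ler1n.
have [f [v [g [Df happ]]]] := approximable_indic kap_continuous rhoIy mA (exprn_gt0 2 eta0).
have [[cf _ _] _ _ _] := Df.
have [Mf Mf0 MfP] := continuous_bounded_itv r0 cf.
pose phi y := \1_A y - f y.
have mphi : measurable_fun I phi.
  apply: measurable_funB => //.
  by apply: measurable_funTS; exact: continuous_measurable_fun.
have Icc y : I y -> 0 <= y <= r by rewrite /I/= in_itv/= => /andP[? ?]; rewrite !ltW.
have phib y : I y -> `|phi y| <= 1 + Mf.
  move=> Iy; apply: le_trans (ler_normB _ _) _; apply: lerD; first exact: oneA.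
  by apply: MfP; exact: Icc.
have mphi2 : measurable_fun I (fun y => phi y ^+ 2) by exact: measurable_funX.
have phi2i (m : {measure set T -> \bar R}) : (m I < +oo)%E ->
    m.-integrable I (EFin \o (fun y => phi y ^+ 2)).
  move=> mIy; apply: (integrable_of_bounded (M := (1 + Mf) ^+ 2)) => //.
  move=> y Iy; have := phib y Iy; rewrite normrX => h1.
  by rewrite lerXn2r ?nnegrE//; apply: le_trans h1.
have split_rho : \int[rho]_(y in I) phi y ^+ 2 =
    \int[nu]_(y in I) phi y ^+ 2 + \int[mu]_(y in I) phi y ^+ 2.
  have EE : (\int[rho]_(y in I) (phi y ^+ 2)%:E =
    \int[nu]_(y in I) (phi y ^+ 2)%:E + \int[mu]_(y in I) (phi y ^+ 2)%:E)%E.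
    by apply: integral_measure_add => //; exact: phi2i.
  rewrite /Rintegral EE fineD//; apply: integrable_fin_num => //; exact: phi2i.
have nu2 : 0 <= \int[nu]_(y in I) phi y ^+ 2 by apply: Rintegral_ge0 => y _; exact: sqr_ge0.
have mu2 : 0 <= \int[mu]_(y in I) phi y ^+ 2 by apply: Rintegral_ge0 => y _; exact: sqr_ge0.
rewrite -/(phi _) in happ.
have happ' : \int[rho]_(y in I) phi y ^+ 2 <= eta ^+ 2 := happ.
rewrite split_rho in happ'.
have nu2' : \int[nu]_(y in I) phi y ^+ 2 <= eta ^+ 2.
  by apply: le_trans happ'; rewrite lerDl.
have mu2' : \int[mu]_(y in I) phi y ^+ 2 <= eta ^+ 2.
  by apply: le_trans happ'; rewrite lerDr.
have nu1 := Rintegral_norm_of_sqr nuIy mphi phib eta0 nu2'.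
have mu1 := Rintegral_norm_of_sqr muIy mphi phib eta0 mu2'.
have h1 : `|fine (nu A) - pexp S P x t f| <= eta.
  have -> : fine (nu A) - pexp S P x t f = \int[nu]_(y in I) (1 * phi y).
    have -> : fine (nu A) = \int[nu]_(y in I) \1_A y.
      rewrite -[LHS]mul1r -(Rintegral_cst nu mA) -IoA.
      by apply: eq_Rintegral => y _; rewrite mul1r.
    rewrite /pexp -RintegralB//.
    - by apply: eq_Rintegral => y _; rewrite mul1r.
    - by apply: (integrable_of_bounded (M := 1)).
    - exact: (trans_integrable PP xr (ltW t0) cf).
  apply: le_trans (Rintegral_normM_le nuIy mphi phib _ _ (N := 1)) _ => //.
    by move=> y _; rewrite normr1.
  rewrite mul1r; apply: le_trans nu1 _.
  have := ler_wpM2l (divr_ge0 (ltW eta0) (ler0n R 2)) nuI1'.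
  by rewrite mulrDr; lra.
have h2 : `|\int[mu]_(y in A) (p y * h y) - ip f h| <= Mh * (eta / 2 * (r + 1)).
  have -> : \int[mu]_(y in A) (p y * h y) - ip f h =
      \int[mu]_(y in I) ((p y * h y) * phi y).
    rewrite -IoA ip_itvoo// -RintegralB//.
    - by apply: eq_Rintegral => y _; rewrite /phi; ring.
    - apply: (integrable_of_bounded (M := Mh * 1)) => //.
        apply: measurable_funM => //.
        by apply: measurable_funTS; exact: continuous_measurable_fun.
      by move=> y Iy; rewrite normrM ler_pM// ?MhP ?oneA//; exact: Icc.
    - have ci : continuous (fun y => p y * f y * h y) by cont.
      by apply: integrableS (continuous_integrable r ci) => //; exact: subset_itv_oo_cc.
  apply: le_trans (Rintegral_normM_le muIy mphi phib _ _ (N := Mh)) _ => //.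
  - by apply: measurable_funTS; exact: continuous_measurable_fun.
  - by move=> y /Icc; exact: MhP.
  rewrite ler_pM2l//; apply: le_trans mu1 _.
  by rewrite (_ : fine _ = r)//; exact: (congr1 fine muI).
have h3 : ip f f <= Mp * (2 * r + 2).
  rewrite ip_itvoo//.
  have if2 : mu.-integrable I (EFin \o (fun y => f y ^+ 2)).
    have ci : continuous (fun y => f y ^+ 2) by cont.
    by apply: integrableS (continuous_integrable r ci) => //; exact: subset_itv_oo_cc.
  have i1 : mu.-integrable I (EFin \o (fun=> 2)).
    by apply: (integrable_of_bounded (M := `|2|)).
  have i2 : mu.-integrable I (EFin \o (fun y => 2 * phi y ^+ 2)).
    by have := integrableZl mI 2 (phi2i mu muIy); apply: eq_integrable => // y _ /=; rewrite EFinM.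
  have i3 : mu.-integrable I (EFin \o (fun y => 2 + 2 * phi y ^+ 2)).
    by have := integrableD mI i1 i2; apply: eq_integrable => // y _ /=; rewrite EFinD.
  apply: le_trans (_ : \int[mu]_(y in I) (Mp * (2 + 2 * phi y ^+ 2)) <= _).
    apply: le_Rintegral => //.
    - have ci : continuous (fun y => p y * f y * f y) by cont.
      by apply: integrableS (continuous_integrable r ci) => //; exact: subset_itv_oo_cc.
    - by have := integrableZl mI Mp i3; apply: eq_integrable => // y _ /=; rewrite EFinM.
    move=> y Iy; rewrite -mulrA -expr2; apply: ler_pM.
    - exact/ltW/wt_gt0.
    - exact: sqr_ge0.
    - by apply: le_trans (ler_norm _) _; apply: MpP; exact: Icc.
    - have a1 : (\1_A y : R) ^+ 2 <= 1 by rewrite -real_normK ?num_real// expr_le1// oneA.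
      have -> : f y = \1_A y - phi y by rewrite /phi; ring.
      have := sqr_ge0 (\1_A y + phi y : R).
      by rewrite sqrrB sqrrD; lra.
  rewrite RintegralZl// ler_pM2l// RintegralD// RintegralZl//; last exact: phi2i.
  rewrite Rintegral_cst// (_ : fine _ = r); last exact: (congr1 fine muI).
  have eta2 : eta ^+ 2 <= 1 by rewrite expr_le1// ltW.
  rewrite lerD2l -[leRHS]mulr1 ler_pM2l//; exact: le_trans mu2' eta2.
have h4 := rate t f v g t0 Df; rewrite -/E in h4.
have h5 : Num.sqrt (2 * C * ip f f / t) <= Num.sqrt (2 * C * (Mp * (2 * r + 2)) / t).
  by rewrite ler_wsqrtr// ler_pM2r ?invr_gt0// ler_pM2l// mulr_gt0.
have -> : E * fine (P t x A) - cA * h x = E * (fine (nu A) - pexp S P x t f) +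
   (- ((cA - coef S h f) * h x) + (E * pexp S P x t f - coef S h f * h x)) by rewrite /nu; ring.
apply: le_trans (ler_normD _ _) _; rewrite [X in _ <= X + _]mulrDl -[leRHS]addrA.
apply: lerD; first by rewrite normrM (gtr0_norm E0) ler_pM2l.
apply: le_trans (ler_normD _ _) _; apply: lerD; last exact: le_trans h5.
rewrite normrN normrM.
have h6 : `|cA - coef S h f| <= Mh * (eta / 2 * (r + 1)) / ip h h.
  rewrite /cA /coef -mulrBl normrM [X in _ * X]gtr0_norm ?invr_gt0//.
  by rewrite ler_pM2r ?invr_gt0.
apply: le_trans (ler_wpM2r (normr_ge0 _) h6) _.
by rewrite le_eqVlt; apply/orP; left; apply/eqP; rewrite /eta; field; rewrite !gt_eqF.
Qed.

End indicator_rate.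

Section integral_off_null_set.
Context d (T : measurableType d) (R : realType).
Variable (m : {measure set T -> \bar R}) (D : set T).
Hypotheses (mD : measurable D) (mD0 : m (~` D) = 0%E).
Local Open Scope ereal_scope.

Let le_integralT (f g : T -> \bar R) : (forall x, 0 <= f x) ->
  (forall x, f x <= g x) -> \int[m]_x f x <= \int[m]_x g x.
Proof.
move=> f0 fg; rewrite !ge0_integralTE//; last by move=> x; apply: le_trans (fg x).
apply: ereal_sup_le => _ [h hf <-]; exists h => // x.
exact: le_trans (fg x).
Qed.

Lemma ge0_integral_off_null (f : T -> \bar R) : (forall x, 0 <= f x) ->
  measurable_fun D f -> \int[m]_x f x = \int[m]_(x in D) f x.
Proof.
move=> f0 mf; apply/eqP; rewrite eq_le; apply/andP; split; last first.
  rewrite integral_mkcond; apply: le_integralT => x; rewrite patchE; case: ifP => //.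
pose g x := if x \in D then f x else +oo.
have gD : {in D, f =1 g} by move=> x xD; rewrite /g xD.
have mg : measurable_fun setT g.
  rewrite -(setUv D); apply/measurable_funU => //; first exact: measurableC.
  split; first by apply: eq_measurable_fun mf.
  apply: (@eq_measurable_fun _ _ _ _ _ (cst +oo)); last exact: measurable_cst.
  by move=> x; rewrite inE /g => /= xD; rewrite memNset.
have g0 x : 0 <= g x by rewrite /g; case: ifP => // _; exact: leey.
apply: le_trans (_ : \int[m]_x g x <= _).
  apply: le_integralT => // x; rewrite /g; case: ifP => // _; exact: leey.
rewrite (ge0_negligible_integral (measurableC mD) measurableT mg)//.
by rewrite setTD setCK (eq_integral g).
Qed.

Lemma integral_off_null (f : T -> \bar R) :
  measurable_fun D f -> \int[m]_x f x = \int[m]_(x in D) f x.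
Proof.
move=> mf; rewrite integralE [RHS]integralE; congr (_ - _).
  by apply: ge0_integral_off_null => //; exact: measurable_funepos.
by apply: ge0_integral_off_null => //; exact: measurable_funeneg.
Qed.

End integral_off_null_set.

Section continuous_extension.
Context {R : realType}.

Definition extend0 (f : R -> R) (l s x : R) : R :=
  if clamp s x <= 0 then l else f (clamp s x).

Lemma extend0_continuous (f : R -> R) (l s r : R) : 0 < s -> s < r ->
  (forall x : R, 0 < x < r -> {for x, continuous f}) -> f x @[x --> 0^'+] --> l ->
  continuous (extend0 f l s).
Proof.
move=> s0 sr cf fl; pose F x := if x <= 0 then l else f x.
apply: (@within_continuous_clamp _ s s0 F).
have near_pos (x : R) : 0 < x -> \forall y \near x, f y = F y.
  move=> x0; apply: filterS (lt_nbhsr x0) => y y0.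
  by rewrite /F leNgt y0.
have cF (x : R) : 0 < x < r -> {for x, continuous F}.
  move=> xr; have x0 : 0 < x by case/andP: xr.
  have Fx : F x = f x by rewrite /F leNgt x0.
  rewrite /prop_for /continuous_at Fx.
  by apply: cvg_trans (cf x xr); apply: near_eq_cvg; exact: near_pos.
apply/continuous_within_itvP => //; split.
- move=> x; rewrite in_itv/= => /andP[x0 xs]; apply: cF.
  by rewrite x0 (lt_trans xs).
- rewrite /F lexx; apply: cvg_trans fl; apply: near_eq_cvg.
  by apply: filterS (nbhs_right_gt 0) => y y0; rewrite leNgt y0.
- by apply: cvg_at_left_filter; apply: cF; rewrite s0.
Qed.

Lemma extend0_id (f : R -> R) (l s x : R) : 0 < x <= s -> extend0 f l s x = f x.
Proof.
by move=> /andP[x0 xs]; rewrite /extend0 clamp_id ?(ltW x0)// leNgt x0.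
Qed.

End continuous_extension.

Section shooting_uniqueness.
Context {R : realType} (S : sl_data R).
Notation r := (sl_r S).

Definition sl_restrict (s : R) (s0 : 0 < s) (sr : s <= r) : sl_data R.
Proof.
apply: (@SLData R s (sl_b S) (sl_B S) (sl_K S) (sl_kap S) (sl_p0 S) (sl_pr S)
  s0 (@sl_b_continuous _ S) (@sl_B_continuous _ S) (@sl_K_continuous _ S)
  (sl_B_at0 S) (sl_K_at0 S)).
- by move=> x /andP[x0 xs]; apply: sl_B_is_derive; rewrite x0 (lt_le_trans xs).
- by move=> x /andP[x0 xs]; apply: sl_K_is_derive; rewrite x0 (lt_le_trans xs).
- by move=> x /andP[x0 xs]; apply: sl_kap_ge0; rewrite x0 (lt_le_trans xs).
- exact: sl_p0_itv.
- exact: sl_pr_itv.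
Defined.

Lemma shooting_unique (lam l1 l2 : R) (u w psi vpsi : R -> R) :
  generator S u w (fun x => - lam * u x) ->
  u x @[x --> 0^'+] --> l1 -> w x @[x --> 0^'+] --> l2 ->
  continuous psi -> continuous vpsi -> psi 0 = l1 -> vpsi 0 = l2 ->
  generator S psi vpsi (fun x => - lam * psi x) ->
  forall x : R, 0 < x < r -> u x = psi x /\ w x = vpsi x.
Proof.
move=> uw u0 w0 cpsi cvpsi psi0 vpsi0 dpsi x /andP[x0 xr].
pose s := (x + r) / 2.
have [xs sr] : x < s /\ s < r by rewrite /s; split; lra.
have s0 : 0 < s by exact: lt_trans xs.
pose S' := sl_restrict s0 (ltW sr).
have cu (y : R) : 0 < y < r -> {for y, continuous u}.
  by move=> /uw[du _]; exact: is_derive_continuous du.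
have cw (y : R) : 0 < y < r -> {for y, continuous w}.
  by move=> /uw[_ dw]; exact: is_derive_continuous dw.
have cu' := extend0_continuous s0 sr cu u0; have cw' := extend0_continuous s0 sr cw w0.
set U := extend0 u l1 s in cu'; set W := extend0 w l2 s in cw'.
have UE (y : R) : 0 < y < s -> u y = U y by move=> /andP[y0 ys]; rewrite /U extend0_id ?y0 ?ltW.
have WE (y : R) : 0 < y < s -> w y = W y by move=> /andP[y0 ys]; rewrite /W extend0_id ?y0 ?ltW.
have dUW : generator S' U W (fun y => - lam * U y).
  move=> y ys; have /andP[y0 ys'] := ys.
  have [du dw] := uw y ltac:(by rewrite y0 (lt_trans ys')).
  split; rewrite -?UE// -?WE//.
    exact: is_derive_eq_on ys UE du.
  exact: is_derive_eq_on ys WE dw.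
have dpsi' : generator S' psi vpsi (fun y => - lam * psi y).
  by move=> y /andP[y0 ys]; apply: dpsi; rewrite y0 (lt_trans ys).
have := generator_lin (-1) dUW dpsi'.
move=> /(generator_ext (g2 := fun y => - lam * (U y + -1 * psi y))) d.
have {}d := d ltac:(by move=> y _; ring).
have z0 f l : extend0 f l s 0 = l by rewrite /extend0 clamp_id ?lexx ?(ltW s0).
have [|||||h1 h2] := @ivp_unique _ S' (- lam) _ _ _ _ d _ _ x.
- by cont.
- by cont.
- by rewrite /U z0 psi0; ring.
- by rewrite /W z0 vpsi0; ring.
- by rewrite /= !ltW.
have xs' : 0 < x < s by rewrite x0.
by rewrite (UE x xs') (WE x xs'); split; lra.
Qed.

End shooting_uniqueness.

Section killed_diffusion_data.
Context {R : realType}.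
Variables (r : R) (b kappa : R -> R) (p0 pr : R).
Hypothesis r0 : 0 < r.
Hypothesis cb : {within `[0, r], continuous b}.
Hypothesis db : forall x : R, 0 < x < r -> derivable b x 1.
Hypothesis ck : forall x : R, 0 < x < r -> {for x, continuous kappa}.
Hypothesis k0 : forall x : R, 0 < x < r -> 0 <= kappa x.
Hypothesis ik : lebesgue_measure.-integrable `]0, r[ (EFin \o kappa).
Hypotheses (p0_itv : 0 <= p0 <= 1) (pr_itv : 0 <= pr <= 1).
Notation mu := (@lebesgue_measure R).

Let ib : mu.-integrable `[0, r] (EFin \o b).
Proof. by apply: continuous_compact_integrable => //; exact: segment_compact. Qed.

Let kappa' := kappa \_ `]0, r[.

Let ik' : mu.-integrable `[0, r] (EFin \o kappa').
Proof.
have -> : EFin \o kappa' = (EFin \o kappa) \_ `]0, r[ by rewrite restrict_EFin.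
apply/(@integrable_restrict _ (measurableTypeR R)) => //.
rewrite (_ : _ `&` _ = `]0, r[)//; apply/setIidr; exact: subset_itv_oo_cc.
Qed.

Let k'E (x : R) : 0 < x < r -> kappa x = kappa' x.
Proof. by move=> xr; rewrite /kappa' patchE mem_set//= in_itv. Qed.

Let cB : continuous (fun x => 2 * prim r b x).
Proof. have ? := prim_continuous r0 ib; cont. Qed.

Let B0 : 2 * prim r b 0 = 0. Proof. by rewrite prim0 ?mulr0. Qed.

Let dB (x : R) : 0 < x < r ->
  is_derive x 1 (fun x => 2 * prim r b x) (2 * (b \o clamp r) x).
Proof.
move=> xr; have /andP[x0 xr'] := xr.
have ? : is_derive x 1 (prim r b) (b x).
  apply: prim_is_derive => //; apply: differentiable_continuous.
  by apply/derivable1_diffP; exact: db.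
by eapply is_derive_val; [deriv|rewrite /= clamp_id ?ltW//; ring].
Qed.

Let dK (x : R) : 0 < x < r -> is_derive x 1 (prim r kappa') (kappa x).
Proof.
move=> xr; rewrite k'E//; apply: prim_is_derive => //.
rewrite /prop_for /continuous_at -k'E//; apply: cvg_trans (ck xr).
apply: near_eq_cvg; have : x \in `]0, r[%R by rewrite in_itv.
by move=> /near_in_itvoo; apply: filterS => y; rewrite in_itv/= => /k'E.
Qed.

Definition sl_of : sl_data R :=
  @SLData R r (b \o clamp r) (fun x => 2 * prim r b x) (prim r kappa') kappa p0 pr
    r0 (within_continuous_clamp r0 cb) cB (prim_continuous r0 ik') B0 (prim0 r0 kappa')
    dB dK k0 p0_itv pr_itv.

Lemma sl_of_b (x : R) : 0 < x < r -> sl_b sl_of x = b x.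
Proof. by move=> /andP[x0 xr]; rewrite /= clamp_id ?ltW. Qed.

Lemma sl_of_B (x : R) : 0 <= x <= r -> sl_B sl_of x = Bfun b x.
Proof. by move=> xr; rewrite /= /Bfun /prim clamp_id. Qed.

End killed_diffusion_data.

Section adjoint_spectrum.
Context {R : realType} (S : sl_data R) (b : R -> R).
Notation r := (sl_r S).
Notation kappa := (sl_kap S).
Notation p0 := (sl_p0 S).
Notation pr := (sl_pr S).
Notation mu := (@lebesgue_measure R).
Hypothesis bE : forall x : R, 0 < x < r -> sl_b S x = b x.
Hypothesis BE : forall x : R, 0 <= x <= r -> sl_B S x = Bfun b x.
Hypothesis db : forall x : R, 0 < x < r -> derivable b x 1.
Hypothesis ck : forall x : R, 0 < x < r -> {for x, continuous kappa}.
Let r0 : 0 < r := sl_r_gt0 S.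

Lemma adj_eigen_generator (lam : R) phi : adj_eigen r b kappa p0 lam phi ->
  let u x := expR (- sl_B S x) * phi x in
  let w x := expR (- sl_B S x) * flux b phi x in
  [/\ generator S u w (fun x => - lam * u x),
      u x @[x --> 0^'+] --> p0 & w x @[x --> 0^'+] --> 1 - p0].
Proof.
move=> [dphi eqn lim0 lim1] u w.
have cE : continuous (fun x => expR (- sl_B S x)).
  by have := @sl_B_continuous _ S => ?; cont.
have E0 : expR (- sl_B S x) @[x --> 0^'+] --> (1 : R).
  have <- : expR (- sl_B S 0) = 1 by rewrite sl_B_at0 oppr0 expR0.
  by apply: cvg_at_right_filter; exact: cE.
split; last 2 first.
- by rewrite -[p0]mul1r; apply: cvgM.
- by rewrite -[1 - p0]mul1r; apply: cvgM.
move=> x xr; have [d1 d2 d3] := dphi x xr.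
have dB := @sl_B_is_derive _ S x xr; rewrite (bE xr) in dB.
have e1 : is_derive x 1 phi ((phi^`())%classic x).
  by rewrite derive1E; exact: (derivableP d1).
have e2 : is_derive x 1 (phi^`())%classic ((phi^`(2))%classic x).
  by rewrite derive1nS derive1n1 derive1E; exact: (derivableP d2).
have e3 : is_derive x 1 (fun y => b y * phi y) (((fun y => b y * phi y)^`())%classic x).
  by rewrite derive1E; exact: (derivableP d3).
have e4 : is_derive x 1 (flux b phi) ((kappa x - lam) * phi x).
  have : is_derive x 1 (fun y => (phi^`())%classic y * 2^-1 - b y * phi y)
     ((phi^`(2))%classic x * 2^-1 - ((fun y => b y * phi y)^`())%classic x).
    have e2' := is_derive_funM e2 (is_derive_fun_cst 2^-1 x).
    by apply: is_derive_val (is_derive_funD e2' (is_derive_funN e3)) _; ring.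
  by move=> H; apply: is_derive_val H _; have := eqn x xr; lra.
rewrite (bE xr); split.
- rewrite /u /w; eapply is_derive_val; first by deriv.
  by rewrite /flux; field.
- by rewrite /u /w; derivr.
Qed.

Lemma adj_eigen_of_dom (lam : R) h vh : dom S h vh (fun x => - lam * h x) ->
  h 0 = p0 -> vh 0 = 1 - p0 ->
  adj_eigen r b kappa p0 lam (fun x => wt S x * h x) /\
  adj_bc_r r b pr (fun x => wt S x * h x).
Proof.
move=> D h0 vh0; have [[ch cvh _] dh _ bc] := D.
have cp := @wt_continuous _ S; pose phi x := wt S x * h x.
have cphi : continuous phi by rewrite /phi; cont.
have cpv : continuous (fun x => wt S x * vh x) by cont.
have dphi (x : R) : 0 < x < r -> is_derive x 1 phi (2 * (wt S x * vh x + b x * phi x)).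
  move=> xr; have [? ?] := dh x xr; have := @wt_is_derive _ S x xr; rewrite bE// => ?.
  by rewrite /phi; derivr.
have fluxE (x : R) : 0 < x < r -> wt S x * vh x = flux b phi x.
  by move=> /dphi/derive1_is_derive; rewrite /flux => ->; field.
have dpv (x : R) : 0 < x < r -> is_derive x 1 (fun x => wt S x * vh x) ((kappa x - lam) * phi x).
  move=> xr; have [_] := dh x xr; have := @wt_is_derive _ S x xr; rewrite bE// => ? ?.
  by rewrite /phi; derivr.
have dbphi (x : R) : 0 < x < r -> derivable (fun y => b y * phi y) x 1.
  by move=> xr; apply: derivableM; [exact: db|have [] := dphi x xr].
have d2phi (x : R) : 0 < x < r -> is_derive x 1 (phi^`())%classic
    (2 * ((kappa x - lam) * phi x + ((fun y => b y * phi y)^`())%classic x)).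
  move=> xr; apply: (@is_derive_eq_on _ (fun x => 2 * (wt S x * vh x + b x * phi x)) _ r) => //.
    by move=> y yr; rewrite (derive1_is_derive (dphi y yr)).
  have d1 := dpv x xr.
  have d2 : is_derive x 1 (fun y => b y * phi y) (((fun y => b y * phi y)^`())%classic x).
    by rewrite derive1E; apply: derivableP; exact: dbphi.
  apply: is_derive_val (is_derive_funM (is_derive_fun_cst 2 x) (is_derive_funD d1 d2)) _.
  by rewrite mul0r add0r.
split.
  split.
  - move=> x xr; split; [by have [] := dphi x xr|by have [] := d2phi x xr|exact: dbphi].
  - move=> x xr; rewrite derive1nS derive1n1 (derive1_is_derive (d2phi x xr)).
    by rewrite -/(phi x) -[fun y => b y * (_ * _)]/(fun y => b y * phi y); field.
  - have <- : phi 0 = p0 by rewrite /phi /wt sl_B_at0 expR0 mul1r.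
    by apply: cvg_at_right_filter; exact: cphi.
  - have <- : wt S 0 * vh 0 = 1 - p0 by rewrite /wt sl_B_at0 expR0 mul1r.
    apply: (@cvg_trans _ ((fun x => wt S x * vh x) @ 0^'+)); last first.
      by apply: cvg_at_right_filter; exact: cpv.
    apply: near_eq_cvg; apply: filterS2 (nbhs_right_gt 0) (nbhs_right_lt r0).
    by move=> y y0 yr; rewrite fluxE// y0.
exists (h r), (wt S r * vh r); split.
- apply: (@cvg_trans _ (h @ r^'-)); last by apply: cvg_at_left_filter; exact: ch.
  apply: near_eq_cvg; apply: filterS2 (nbhs_left_lt r) (nbhs_left_gt r0) => y yr y0.
  by rewrite -BE ?(ltW y0) ?ltW// mulrA -expRD addNr expR0 mul1r.
- apply: (@cvg_trans _ ((fun x => wt S x * vh x) @ r^'-)); last first.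
    by apply: cvg_at_left_filter; exact: cpv.
  apply: near_eq_cvg; apply: filterS2 (nbhs_left_lt r) (nbhs_left_gt r0) => y yr y0.
  by rewrite fluxE// y0.
- rewrite [pr * _]mulrCA [pr * vh r]bc /= mulrN opprK -!mulrA.
  rewrite mulrCA; congr (_ * _).
  by rewrite mulrA /wt -expRD subrr expR0 mul1r.
Qed.

Lemma adj_eigen_shooting (lam : R) phi psi vpsi : adj_eigen r b kappa p0 lam phi ->
  continuous psi -> continuous vpsi -> psi 0 = p0 -> vpsi 0 = 1 - p0 ->
  generator S psi vpsi (fun x => - lam * psi x) ->
  forall x : R, 0 < x < r ->
  phi x = wt S x * psi x /\ flux b phi x = wt S x * vpsi x.
Proof.
move=> A cpsi cvpsi psi0 vpsi0 dpsi x xr; have [g u0 w0] := adj_eigen_generator A.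
have [<- <-] := shooting_unique g u0 w0 cpsi cvpsi psi0 vpsi0 dpsi xr.
by rewrite !mulrA /wt -expRD subrr expR0 !mul1r.
Qed.

Lemma adj_spectrum_ge (lam0 lam : R) phi :
  (forall u v g, dom S u v g -> lam0 * ip S u u <= - ip S g u) ->
  adj_eigen r b kappa p0 lam phi -> adj_bc_r r b pr phi -> lam0 <= lam.
Proof.
move=> low A [L1 [L2 [l1 l2 bc]]].
have [psi [vpsi [c1 c2 e1 e2]]] := @ivp_exists _ S (- lam) (fun=> 0) p0 (1 - p0) ltac:(cont).
move=> /(generator_ext (g2 := fun x => - lam * psi x)) d.
have {}d := d ltac:(by move=> ? _; rewrite subr0).
have phiE := adj_eigen_shooting A c1 c2 e1 e2 d.
have cp := @wt_continuous _ S.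
have cpv : continuous (fun x => wt S x * vpsi x) by cont.
have L1E : psi r = L1.
  apply: (@cvg_unique _ (@Rhausdorff R) (psi @ r^'-)).
    by apply: cvg_at_left_filter; exact: c1.
  apply: cvg_trans l1.
  apply: near_eq_cvg; apply: filterS2 (nbhs_left_lt r) (nbhs_left_gt r0) => y yr y0.
  have [-> _] := phiE y ltac:(by rewrite y0).
  by rewrite -BE ?(ltW y0) ?ltW// mulrA -expRD addNr expR0 mul1r.
have L2E : wt S r * vpsi r = L2.
  apply: (@cvg_unique _ (@Rhausdorff R) ((fun x => wt S x * vpsi x) @ r^'-)).
    by apply: cvg_at_left_filter; exact: cpv.
  apply: cvg_trans l2.
  apply: near_eq_cvg; apply: filterS2 (nbhs_left_lt r) (nbhs_left_gt r0) => y yr y0.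
  by have [_ ->] := phiE y ltac:(by rewrite y0).
have D : dom S psi vpsi (fun x => - lam * psi x).
  apply: bcr_dom => //; [by cont|by rewrite e1 e2 /= mulrC|].
  move: bc; rewrite -L1E -L2E /bcr /= -/(sl_B S r) => bc.
  have -> : (1 - pr) * expR (- sl_B S r) * psi r = expR (- sl_B S r) * ((1 - pr) * psi r) by ring.
  rewrite bc (_ : wt S r = expR (sl_B S r))// expRN.
  by field; rewrite gt_eqF// expR_gt0.
have n0 := eigenpair_norm_gt0 D e1 e2.
have := low _ _ _ D; rewrite ipZl// mulNr opprK ler_pM2r//.
Qed.

Lemma lambda_underE (lam0 : R) h vh :
  (forall u v g, dom S u v g -> lam0 * ip S u u <= - ip S g u) ->
  dom S h vh (fun x => - lam0 * h x) -> h 0 = p0 -> vh 0 = 1 - p0 ->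
  lambda_under r b kappa p0 pr = lam0.
Proof.
move=> low D e1 e2; rewrite /lambda_under; set A := [set _ | _].
have Alam0 : A lam0 by exists (fun x => wt S x * h x); exact: adj_eigen_of_dom D e1 e2.
have Alow : lbound A lam0 by move=> lam [phi [Ae Abc]]; exact: adj_spectrum_ge Ae Abc.
apply/eqP; rewrite eq_le; apply/andP; split.
  by apply: ge_inf => //; exists lam0.
by apply: lb_le_inf => //; exists lam0.
Qed.

Let negl := mu.-negligible [set x | 0 < x < r /\ kappa x != 0].

Lemma principal_eq0 (lam0 : R) :
  (forall u v g, dom S u v g -> lam0 * ip S u u <= - ip S g u) -> 0 <= lam0 ->
  p0 = 1 -> pr = 1 -> negl -> lam0 = 0.
Proof.
move=> low l0 p01 pr1 ng.
have kz (x : R) : 0 < x < r -> kappa x = 0.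
  move=> xr; apply/eqP/negPn/negP => kx.
  have /cvgrPdist_lt /(_ `|kappa x|) [] := ck xr; first by rewrite normr_gt0.
  move=> e /= e0 He.
  have [d d0 dP] : exists2 d : R, 0 < d & forall y, x - d < y < x + d ->
      0 < y < r /\ kappa y != 0.
    have /andP[x0 xr'] := xr.
    exists (Num.min e (Num.min x (r - x))).
      by rewrite !lt_min e0 x0 subr_gt0.
    move=> y /andP[]; set d := Num.min _ _ => y1 y2.
    have [de dx drx] : [/\ d <= e, d <= x & d <= r - x].
      by rewrite /d !ge_min !lexx !orbT.
    split; first by apply/andP; split; lra.
    apply/negP => /eqP ky.
    have := He y; rewrite /= ky subr0 ltxx.
    by move=> H; suff : false by []; apply: H; rewrite ltr_norml; apply/andP; split; lra.
  have : mu `]x - d, x + d[ = 0%E.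
    have [N [mN N0 sN]] := ng.
    apply/eqP; rewrite -measure_le0 -[leRHS]N0 le_measure ?inE//.
    by move=> y; rewrite /= in_itv => /dP /sN.
  have xd : x - d < x + d by lra.
  rewrite lebesgue_measure_itv/= lte_fin xd => /eqP; rewrite -EFinD eqe; apply/negP.
  by rewrite gt_eqF//; lra.
have D1 : dom S (fun=> 1) (fun=> 0) (fun=> 0).
  split => /=.
  - by split; cont.
  - move=> x xr; split; first by apply: is_derive_val (is_derive_fun_cst 1 x) _; ring.
    by apply: is_derive_val (is_derive_fun_cst 0 x) _; rewrite kz//; ring.
  - by rewrite p01; ring.
  - by rewrite pr1; ring.
have := low _ _ _ D1.
have -> : ip S (fun=> 0) (fun=> 1) = 0.
  have := @ipZl _ S 0 (fun=> 1) (fun=> 1) ltac:(cont) ltac:(cont).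
  by rewrite !mul0r.
have : 0 < ip S (fun=> 1) (fun=> 1).
  apply: (eigenpair_norm_gt0 (vh := fun=> 0) (lam := 0)); rewrite /= ?p01 ?subrr//.
  by have -> : (fun=> - 0 * 1) = (fun=> 0) :> (R -> R) by apply/funext => x; rewrite oppr0 mul0r.
by move=> i0; rewrite oppr0 pmulr_lle0// => l1; apply/eqP; rewrite eq_le l1.
Qed.

Lemma principal_gt0 (lam0 : R) h vh : dom S h vh (fun x => - lam0 * h x) ->
  h 0 = p0 -> vh 0 = 1 - p0 -> 0 <= lam0 ->
  ~ [/\ p0 = 1, pr = 1 & negl] -> 0 < lam0.
Proof.
move=> D e1 e2 l0 nr; rewrite lt_neqAle l0 andbT; apply/eqP => lz; apply: nr.
have [[ch cvh _] d _ bc] := D; have rr : 0 <= (0 : R) <= r by rewrite lexx ltW.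
have rr' : 0 <= r <= r by rewrite lexx ltW.
have := dom_energy D; rewrite ipZl// -lz oppr0 mul0r oppr0 => vv.
have vh0 : ip S vh vh = 0 by have := ip_ge0 S cvh; lra.
have vz (x : R) : 0 <= x <= r -> vh x = 0 by exact: ip_eq0 vh0.
have p01 : p0 = 1 by have := vz 0 rr; rewrite e2; lra.
have h1 (x : R) : 0 <= x <= r -> h x = 1.
  move=> xr; rewrite -p01 -e1.
  have := @eq_of_derive _ r h (fun=> 0) (fun=> 0) x ch (@continuous_fun_cst _ 0) _ _ xr.
  rewrite subrr => H; apply/eqP; rewrite -subr_eq0; apply/eqP; apply: H.
    move=> z zr; have [dz _] := d z zr; have /andP[z0 zr'] := zr.
    by apply: is_derive_val dz _; rewrite vz ?mulr0// !ltW.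
split => //.
- move: bc; rewrite /= vz// h1// mulr0 mulr1 => /esym/eqP.
  by rewrite oppr_eq0 mulf_eq0 [X in _ || X]gt_eqF ?expR_gt0// orbF subr_eq0 => /eqP.
- rewrite /negl (_ : [set x | _] = set0); first exact: negligible_set0.
  apply/seteqP; split => // x [xr /eqP]; apply.
  have [_ dv] := d x xr; have /andP[x0 xr'] := xr.
  have xr2 : 0 <= x <= r by rewrite !ltW.
  have : - lam0 * h x + kappa x * h x - 2 * sl_b S x * vh x = 0.
    rewrite -(derive1_is_derive dv); apply: derive1_is_derive.
    apply: is_derive_eq_on xr _ (is_derive_fun_cst 0 x) => y /andP[y0 yr].
    by rewrite vz// !ltW.
  by rewrite vz// h1// -lz; lra.
Qed.

End adjoint_spectrum.

Lemma cvg_integral_rate (R : realType) (D : set (measurableTypeR R))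
    (mu : probability (measurableTypeR R) R) (Q : R -> R -> \bar R) (lam c C : R) (h : R -> R) :
  measurable D -> mu (~` D) = 0%E -> (forall t x, (0 <= Q t x)%E) ->
  (forall t x, 0 <= t -> D x -> (Q t x <= 1)%E) ->
  (forall t, 0 <= t -> measurable_fun D (Q t)) ->
  mu.-integrable D (EFin \o h) -> 0 < C ->
  (forall x t, D x -> 0 < t ->
    `|expR (lam * t) * fine (Q t x) - c * h x| <= Num.sqrt (C / t)) ->
  ((expR (lam * t))%:E * \int[mu]_x Q t x)%E @[t --> +oo%R] -->
  (c * \int[mu]_(x in D) h x)%:E.
Proof.
move=> mD muD Q0 Q1 mQ ih C0 rate.
have muD1 : mu D = 1%E.
  have : mu setT = (mu D + mu (~` D))%E by rewrite -measureU ?setUv ?setICr//; exact: measurableC.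
  by rewrite muD adde0 => <-; exact: probability_setT.
have muDy : (mu D < +oo)%E by rewrite muD1 ltry.
have Qfin t x : 0 <= t -> D x -> Q t x = (fine (Q t x))%:E.
  move=> t0 Dx; rewrite fineK// ge0_fin_numE// (le_lt_trans (Q1 t x t0 Dx))//.
  by rewrite ltry.
have mq t : 0 <= t -> measurable_fun D (fine \o Q t).
  by move=> t0; apply: measurableT_comp => //; exact: mQ.
have iq t : 0 <= t -> mu.-integrable D (EFin \o (fine \o Q t)).
  move=> t0; apply: (integrable_of_bounded (M := 1)) => //.
  - exact: mq.
  - move=> x Dx; rewrite /= ger0_norm ?fine_ge0//.
    by rewrite -lee_fin -Qfin// Q1.
have QE t : 0 <= t -> (\int[mu]_x Q t x = (\int[mu]_(x in D) fine (Q t x))%:E)%E.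
  move=> t0; rewrite (ge0_integral_off_null mD muD)//; last exact: mQ.
  rewrite /Rintegral fineK; last exact: integrable_fin_num (iq t t0).
  by apply: eq_integral => x; rewrite inE => Dx; exact: Qfin.
apply: (@cvg_trans _ ((expR (lam * t) * \int[mu]_(x in D) fine (Q t x))%:E @[t --> +oo%R])).
  apply: near_eq_cvg; near=> t; have t0 : 0 <= t by near: t; exact: nbhs_pinfty_ge.
  by rewrite QE// EFinM.
apply: cvg_EFin; first by near=> t.
apply/cvgrPdist_le => e e0; near=> t.
have t0 : 0 < t by near: t; apply: nbhs_pinfty_gt; exact: num_real.
have tC : C / e ^+ 2 <= t by near: t; apply: nbhs_pinfty_ge; exact: num_real.
have sC : Num.sqrt (C / t) <= e.
  rewrite -[leRHS](gtr0_norm e0) -sqrtr_sqr ler_wsqrtr//.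
  by rewrite ler_pdivrMr// mulrC -ler_pdivrMr// exprn_gt0.
have iEq : mu.-integrable D (EFin \o (fun x => expR (lam * t) * fine (Q t x))).
  have := integrableZl mD (expR (lam * t)) (iq t (ltW t0)).
  by apply: eq_integrable => // y _ /=; rewrite EFinM.
have ich : mu.-integrable D (EFin \o (fun x => c * h x)).
  by have := integrableZl mD c ih; apply: eq_integrable => // y _ /=; rewrite EFinM.
have -> : c * \int[mu]_(x in D) h x - expR (lam * t) * \int[mu]_(x in D) fine (Q t x) =
    \int[mu]_(x in D) (c * h x - expR (lam * t) * fine (Q t x)).
  by rewrite RintegralB// !RintegralZl//; exact: iq (ltW t0).
have iB : mu.-integrable D (EFin \o (fun x => c * h x - expR (lam * t) * fine (Q t x))).
  by have := integrableB mD ich iEq; apply: eq_integrable => // y _ /=; rewrite EFinB.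
apply: le_trans (le_normr_Rintegral mD iB) _.
apply: le_trans (_ : \int[mu]_(x in D) e <= _); last first.
  by rewrite Rintegral_cst// (_ : fine _ = 1) ?mulr1//; exact: (congr1 fine muD1).
apply: le_Rintegral => //.
- exact: integrable_norm iB.
- exact: (integrable_of_bounded (M := `|e|)).
- by move=> x Dx; rewrite distrC; apply: le_trans (rate x t Dx t0) sC.
Unshelve. all: by end_near.
Qed.

Theorem theorem3p2 (R : realType) (r : R) (b kappa : R -> R) (p0 pr : R)
  (P : R -> R -> {measure set (measurableTypeR R) -> \bar R}) :
  0 < r ->
  {within `[0, r], continuous b} ->
  (forall x, 0 < x < r -> derivable b x 1) ->
  (forall x, 0 < x < r -> {for x, continuous (b^`())%classic}) ->
  (forall x, 0 < x < r -> {for x, continuous kappa}) ->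
  (forall x, 0 < x < r -> 0 <= kappa x) ->
  (* both endpoints regular *)
  lebesgue_measure.-integrable `]0, r[ (EFin \o kappa) ->
  0 <= p0 <= 1 -> 0 <= pr <= 1 ->
  killed_diffusion r b kappa p0 pr P ->
  let lam := lambda_under r b kappa p0 pr in
  let refl_nokill := [/\ p0 = 1, pr = 1 &
        lebesgue_measure.-negligible [set x | 0 < x < r /\ kappa x != 0]] in
  [/\ (refl_nokill -> lam = 0),
      (~ refl_nokill -> 0 < lam) &
      forall phi, adj_eigen r b kappa p0 lam phi ->
      forall (A : set R) (mu : probability (measurableTypeR R) R),
        measurable A -> A `<=` `]0, r[ -> mu (~` `]0, r[) = 0%E ->
        ((expR (lam * t))%:E * \int[mu]_x P t x A)%E @[t --> +oo%R] -->
        ((Rintegral mu setT (fun x => expR (- Bfun b x) * phi x)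
          * Rintegral lebesgue_measure A phi)
         / Rintegral lebesgue_measure `]0, r[
             (fun y => expR (- Bfun b y) * phi y ^+ 2))%:E].
Proof.
move=> r0 cb db _ ck k0 ik p0_itv pr_itv PP lam refl_nokill.
pose S := sl_of r0 cb db ck k0 ik p0_itv pr_itv.
have [lam0 [gam [h [vh [[l0 g0] D [e1 e2 hh] low gap]]]]] := principal_eigenpair S.
have bE := sl_of_b r0 cb db ck k0 ik p0_itv pr_itv.
have BE := sl_of_B r0 cb db ck k0 ik p0_itv pr_itv.
rewrite -/S in bE BE.
have lamE : lam = lam0 := @lambda_underE _ S b bE BE db _ _ _ low D e1 e2.
have [[ch cvh _] dh _ _] := D.
rewrite lamE; split.
- by move=> [p01 pr1 ng]; exact: (@principal_eq0 _ S ck _ low l0 p01 pr1 ng).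
- by move=> nr; exact: (@principal_gt0 _ S _ _ _ D e1 e2 l0 nr).
move=> phi aphi A m mA AI mI.
have rr : 0 <= r <= r by rewrite lexx ltW.
have [C C0 CP] := @indicator_rate _ S b kappa P bE (fun _ _ => erefl) (BE r rr)
  PP ck _ _ _ _ l0 g0 low D hh gap.
have phiE (x : R) : `]0, r[%classic x -> phi x = wt S x * h x.
  rewrite /= in_itv/= => xr.
  by have [] := @adj_eigen_shooting _ S b bE _ _ _ _ aphi ch cvh e1 e2 dh x xr.
have BphiE (x : R) : `]0, r[%classic x -> expR (- Bfun b x) * phi x = h x.
  move=> xI; rewrite phiE//; move: xI; rewrite /= in_itv/= => /andP[x0 xr].
  rewrite -BE ?(ltW x0) ?ltW//.
  by rewrite mulrA -expRD addNr expR0 mul1r.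
have mI0 : measurable (`]0, r[%classic : set (measurableTypeR R)) by exact: measurable_itv.
have [Mh Mh0 MhP] := continuous_bounded_itv r0 ch.
have mh : measurable_fun (`]0, r[%classic : set (measurableTypeR R)) h.
  by apply: measurable_funTS; exact: continuous_measurable_fun.
have ih : m.-integrable `]0, r[ (EFin \o h).
  apply: (integrable_of_bounded (M := Mh)) => //.
    by apply: le_lt_trans (probability_le1 m mI0) _; rewrite ltry.
  by move=> x; rewrite /= in_itv/= => /andP[x0 xr]; apply: MhP; rewrite !ltW.
have -> : Rintegral m setT (fun x => expR (- Bfun b x) * phi x) =
    \int[m]_(x in `]0, r[) h x.
  rewrite /Rintegral (integral_off_null mI0 mI).
    by congr fine; apply: eq_integral => x; rewrite inE => xI; rewrite BphiE.
  apply: (@eq_measurable_fun _ _ _ _ _ (EFin \o h)).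
    by move=> x; rewrite inE => xI; rewrite /= BphiE.
  by apply: measurableT_comp => //; exact: mh.
have -> : Rintegral lebesgue_measure A phi =
    \int[lebesgue_measure]_(y in A) (wt S y * h y).
  by apply: eq_Rintegral => y; rewrite inE => /AI; exact: phiE.
have -> : Rintegral lebesgue_measure `]0, r[ (fun y => expR (- Bfun b y) * phi y ^+ 2) =
    ip S h h.
  rewrite ip_itvoo//; apply: eq_Rintegral => y; rewrite inE => yI.
  by rewrite expr2 mulrA BphiE// phiE//; ring.
rewrite -mulrA mulrC.
have [P1 [P2 _] _ _ _] := PP.
apply: (cvg_integral_rate (C := C) mI0 mI _ _ _ ih C0).
- by move=> t x; exact: measure_ge0.
- move=> t x t0; rewrite /= in_itv/= => xr.
  apply: le_trans (P1 t x t0 xr).1; apply: le_measure => //; rewrite ?inE//.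
- by move=> t t0; exact: P2.
- by move=> x t; rewrite /= in_itv/= => xr t0; exact: CP.
Qed.
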